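(* Let $m,q,r\in\mathbb{N}$, let $\mathcal{B}$ be an arbitrary real $(m+q)\times(m+r)$ matrix with blocks $\mathcal{B}^{11}$ ($m\times m$), $\mathcal{B}^{12}$ ($m\times r$), $\mathcal{B}^{21}$ ($q\times m$), $\mathcal{B}^{22}$ ($q\times r$), and let $p\in[1,\infty)$. Let $(A_p,D(A_p))$ be the operator in $\boldsymbol{X}_p=(L^p(0,1))^m\times(L^p(0,\infty))^{q+r}$ and $T=(T(t))_{t\ge 0}$ the family of operators on $\boldsymbol{X}_p$ defined in the context. Then for all $\lambda\in\mathbb{C}$ with sufficiently large real part (i.e. there is $\lambda_0\in\mathbb{R}$ such that this holds for all $\lambda$ with $\operatorname{Re}\lambda>\lambda_0$), $\lambda$ belongs to the resolvent set of $A_p$ and $$R(\lambda,A_p)=\mathcal{L}\{T\}(\lambda),$$ where $R(\lambda,A_p)=(\lambda I-A_p)^{-1}$ and $\mathcal{L}\{T\}(\lambda)$ is the Laplace transform of $T$, that is, for every $\boldsymbol{\phi}=(\boldsymbol{f},\boldsymbol{g},\boldsymbol{h})^T\in\boldsymbol{X}_p$ and (componentwise) almost every $x$, $$\bigl(\mathcal{L}\{T\}(\lambda)\boldsymbol{\phi}\bigr)(x)=\int_0^\infty e^{-\lambda t}\,\bigl(T(t)\boldsymbol{\phi}\bigr)(x)\,dt.$$ In consequence, $(T(t))_{t\ge 0}$ is the $C_0$-semigroup on $\boldsymbol{X}_p$ generated by the operator $(A_p,D(A_p))$.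
   Context: Block form of the matrix: $\mathcal{B}=\begin{pmatrix}\mathcal{B}^{11}&\mathcal{B}^{12}\\ \mathcal{B}^{21}&\mathcal{B}^{22}\end{pmatrix}$. Elements of $\boldsymbol{X}_p=(L^p(0,1))^m\times(L^p(0,\infty))^{q+r}$ are written $(\boldsymbol{u},\boldsymbol{v},\boldsymbol{w})^T$ with $\boldsymbol{u}\in(L^p(0,1))^m$, $\boldsymbol{v}\in(L^p(0,\infty))^q$, $\boldsymbol{w}\in(L^p(0,\infty))^r$. For complex $\lambda$, the resolvent and Laplace transform are understood on the complexification (complex-valued $L^p$ functions). The operator $A_p$: $$A_p(\boldsymbol{u},\boldsymbol{v},\boldsymbol{w})^T=(-\partial_x\boldsymbol{u},\,-\partial_x\boldsymbol{v},\,\partial_x\boldsymbol{w})^T,$$ $$D(A_p)=\left\{(\boldsymbol{u},\boldsymbol{v},\boldsymbol{w})^T\in (W^{1,p}(0,1))^m\times(W^{1,p}(0,\infty))^{q+r}:\ \binom{\boldsymbol{u}(0)}{\boldsymbol{v}(0)}=\mathcal{B}\binom{\boldsymbol{u}(1)}{\boldsymbol{w}(0)}\right\},$$ where boundary values are those of the continuous representatives. The family $T(t)$, $t\ge0$: for $(\mathring{\boldsymbol{u}},\mathring{\boldsymbol{v}},\mathring{\boldsymbol{w}})^T\in\boldsymbol{X}_p$, $$T(t)\begin{pmatrix}\mathring{\boldsymbol{u}}\\ \mathring{\boldsymbol{v}}\\ \mathring{\boldsymbol{w}}\end{pmatrix}(x)=\begin{pmatrix}\boldsymbol{u}(x,t)\\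 \boldsymbol{v}(x,t)\\ \boldsymbol{w}(x,t)\end{pmatrix}$$ (for almost every $x$), where: - for $x\in(0,1)$, $$\boldsymbol{u}(x,t)=(\mathcal{B}^{11})^n\,\mathring{\boldsymbol{u}}(n-t+x)+\sum_{k=0}^{n-1}(\mathcal{B}^{11})^k\mathcal{B}^{12}\,\mathring{\boldsymbol{w}}(t-x-k),$$ with $n\in\mathbb{N}\cup\{0\}$ determined by $0<n-t+x<1$; - for $x>0$, $$\boldsymbol{v}(x,t)=\mathring{\boldsymbol{v}}(x-t)\quad\text{if } x>t,$$ $$\boldsymbol{v}(x,t)=\mathcal{B}^{21}(\mathcal{B}^{11})^n\,\mathring{\boldsymbol{u}}(n-t+x+1)+\mathcal{B}^{21}\sum_{k=0}^{n-1}(\mathcal{B}^{11})^k\mathcal{B}^{12}\,\mathring{\boldsymbol{w}}(t-x-k-1)+\mathcal{B}^{22}\,\mathring{\boldsymbol{w}}(t-x)\quad\text{if } x<t,$$ with $n\in\mathbb{N}\cup\{0\}$ determined by $0<n-t+x+1<1$ (this $n$ is in general different from the one used for $\boldsymbol{u}$); - for $x>0$, $\boldsymbol{w}(x,t)=\mathring{\boldsymbol{w}}(x+t)$. Conventions: $\sum_{k=0}^{-1}=0$ and $(\mathcal{B}^{11})^0$ is the identity matrix. *)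

(* Defs.v *)
From HB Require Import structures.
From mathcomp Require Import all_boot all_order all_algebra.
From mathcomp Require Import all_classical all_reals all_analysis measurable_realfun ess_sup_inf.
From mathcomp.real_closed Require Import complex.

Set Implicit Arguments.
Unset Strict Implicit.
Unset Printing Implicit Defensive.
Import Order.TTheory GRing.Theory Num.Theory.
Import numFieldNormedType.Exports.

Local Open Scope classical_set_scope.
Local Open Scope ring_scope.

Section Lspace_normed.
Context d (T : measurableType d) (R : realType).
Context (mu : {measure set T -> \bar R}) (p : \bar R) (p1 : (1 <= p)%E).
Local Notation Lp := (LspaceType mu p1).
Local Notation Lf := (LfunType mu p1).
Local Open Scope quotient_scope.

Local Notation M := {mfun_ mu, T >-> measurableTypeR R}.

HB.instance Definition _ := gen_eqMixin Lp.
HB.instance Definition _ := gen_choiceMixin Lp.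

Fact Lrep_subproof (f : Lp) : (f : T -> R) \in Lfun mu p.
Proof.
rewrite inE; apply/andP; split; rewrite inE/=.
  exact: (@measurable_funPT _ _ _ _ (repr (f : M))).
exact: Lebesgue_finite.
Qed.

Definition Lrep (f : Lp) : Lf := Lfun_Sub p1 (Lrep_subproof f).

Let mf_subproof (f : Lf) : @measurable_fun _ _ T (measurableTypeR R) setT f.
Proof. exact: (@measurable_funPT _ _ _ _ f). Qed.

Let mfR (f : Lf) : {mfun T >-> measurableTypeR R} :=
  @mfun_Sub _ _ T (measurableTypeR R) f (mem_set (mf_subproof f)).

Let Lpi (f : Lf) : M := \pi_M (mfR f).

Let Lpi_ae (f : Lf) : (Lpi f : T -> R) = f %[ae mu].
Proof.
have /eqP : repr (\pi_M (mfR f)) = mfR f %[mod M] by rewrite reprK.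
by rewrite eqmodE => /asboolP.
Qed.

Lemma Lnorm_ae_eq (f g : T -> R) :
  measurable_fun setT f -> measurable_fun setT g -> f = g %[ae mu] ->
  ('N[mu]_p[EFin \o f] = 'N[mu]_p[EFin \o g])%E.
Proof.
move=> mf mg fg; rewrite unlock; case: p p1 => [r r1| |//] /=.
  have mr (h : T -> R) : measurable_fun setT h ->
      measurable_fun setT (fun x => (`|(h x)%:E| `^ r)%E).
    move=> mh; apply/measurable_EFinP.
    by apply: (measurableT_comp (measurable_powR _)); exact: measurableT_comp.
  apply: (congr1 (fun z => z `^ r^-1)%E).
  apply: (@ae_eq_integral _ _ _ mu setT _ _ measurableT (mr f mf) (mr g mg)).
  by apply: filterS fg => x fgx xT /=; rewrite fgx.
move=> _; case: ifP => // _; apply: eq_ess_sup.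
by apply: filterS fg => x fgx /=; rewrite fgx.
Qed.

Let Lpi_finite (f : Lf) : finite_norm mu p (Lpi f).
Proof.
rewrite /finite_norm (@Lnorm_ae_eq (Lpi f) f).
- exact: Lfunction_finite.
- exact: (@measurable_funPT _ _ _ _ (repr (Lpi f))).
- exact: (@measurable_funPT _ _ _ _ f).
- exact: Lpi_ae.
Qed.

HB.instance Definition _ (f : Lf) :=
  isFinLebesgue.Build d T R mu p p1 (Lpi f) (Lpi_finite f).

Definition Lclass (f : Lf) : Lp := Lpi f.

Lemma LclassE (f : Lf) : (Lclass f : T -> R) = f %[ae mu].
Proof. exact: Lpi_ae. Qed.

Lemma LspaceP (f g : Lp) : f = g <-> (f : T -> R) = g %[ae mu].
Proof.
split=> [->|fg]; first exact: ae_eq_refl.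
have fgM : f = g :> M.
  apply/eqP; rewrite -[f : M]reprK -[g : M]reprK eqmodE; exact/asboolP.
case: f g fgM {fg} => [f [[Pf]]] [g [[Pg]]] /= fg; subst g.
by rewrite (Prop_irrelevance Pf Pg).
Qed.

Lemma LrepK : cancel Lrep Lclass.
Proof. by move=> f; apply/LspaceP; exact: LclassE. Qed.

Let eqL (f g : Lf) : (f : T -> R) = g %[ae mu] -> Lclass f = Lclass g.
Proof.
move=> fg; apply/LspaceP.
apply: (ae_eq_trans (LclassE f)); apply: (ae_eq_trans fg).
exact/ae_eq_sym/LclassE.
Qed.

Let zero := Lclass 0.
Let opp f := Lclass (- Lrep f).
Let add f g := Lclass (Lrep f + Lrep g).
Let scale a f := Lclass (a *: Lrep f).

Let LrepC (f : Lf) : (Lrep (Lclass f) : T -> R) = f %[ae mu].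
Proof. exact: LclassE. Qed.

Let oppC f : opp (Lclass f) = Lclass (- f).
Proof.
by apply: eqL; apply: filterS (LrepC f) => x + xT => /(_ xT); exact: congr1.
Qed.

Let addC f g : add (Lclass f) (Lclass g) = Lclass (f + g).
Proof.
apply: eqL; apply: filterS2 (LrepC f) (LrepC g) => x + + xT.
by move=> /(_ xT) + /(_ xT); exact: congr2.
Qed.

Let scaleC a f : scale a (Lclass f) = Lclass (a *: f).
Proof.
apply: eqL; apply: filterS (LrepC f) => x + xT => /(_ xT).
exact: (congr1 ( *%R a)).
Qed.

Let addA : associative add.
Proof.
by move=> f g h; rewrite -(LrepK f) -(LrepK g) -(LrepK h) !addC addrA.
Qed.

Let addc : commutative add.
Proof. by move=> f g; rewrite /add addrC. Qed.

Let add0 : left_id zero add.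
Proof. by move=> f; rewrite -(LrepK f) addC add0r. Qed.

Let addN : left_inverse zero opp add.
Proof. by move=> f; rewrite -(LrepK f) oppC addC addNr. Qed.

HB.instance Definition _ := GRing.isZmodule.Build Lp addA addc add0 addN.

Let scaleA a b f : scale a (scale b f) = scale (a * b) f.
Proof. by rewrite -(LrepK f) !scaleC scalerA. Qed.

Let scale1 : left_id 1 scale.
Proof. by move=> f; rewrite -(LrepK f) scaleC scale1r. Qed.

Let scaleD : right_distributive scale +%R.
Proof.
move=> a f g; rewrite -(LrepK f) -(LrepK g).
by rewrite /GRing.add/= !(addC, scaleC) scalerDr.
Qed.

Let scaleDl f : {morph scale^~ f : a b / a + b}.
Proof.
move=> a b /=; rewrite -(LrepK f) [RHS]/GRing.add/= !(addC, scaleC).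
by rewrite scalerDl.
Qed.

HB.instance Definition _ :=
  GRing.Zmodule_isLmodule.Build R Lp scaleA scale1 scaleD scaleDl.

Lemma Lclass_linear a f g : Lclass (a *: f + g) = a *: Lclass f + Lclass g.
Proof. exact: esym (etrans (congr2 add (scaleC a f) erefl) (addC _ _)). Qed.

Definition Lspace_norm (f : Lp) : R := fine 'N[mu]_p[EFin \o f]%E.

Let normC (f : Lf) : Lspace_norm (Lclass f) = fine 'N[mu]_p[EFin \o f]%E.
Proof.
rewrite /Lspace_norm (@Lnorm_ae_eq (Lclass f) f)//.
- exact: (@measurable_funPT _ _ _ _ (Lrep (Lclass f))).
- exact: LclassE.
Qed.

Let normD f g : Lspace_norm (f + g) <= Lspace_norm f + Lspace_norm g.
Proof.
rewrite -(LrepK f) -(LrepK g) -[X in X + _]scale1r -Lclass_linear.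
rewrite [in leLHS]scale1r !normC.
exact: (ler_LnormD (Lrep f) (Lrep g)).
Qed.

Let normZ a f : Lspace_norm (a *: f) = `|a| * Lspace_norm f.
Proof.
rewrite -(LrepK f) -[_ *: _]addr0.
have -> : 0 = Lclass 0 :> Lp by [].
rewrite -Lclass_linear addr0 !normC.
have -> : EFin \o (a *: Lrep f) = EFin \o (a \*: Lrep f) by [].
by rewrite LnormZ fineM// -finite_norm_fine.
Qed.

Let norm_eq0 f : Lspace_norm f = 0 -> f = 0.
Proof.
rewrite -(LrepK f) normC => /fine_Lnormr_eq0 f0.
exact: eqL.
Qed.

HB.instance Definition _ := Lmodule_isNormed.Build R Lp normD normZ norm_eq0.

End Lspace_normed.

Section ffun_normed.
Context (R : realType) (n : nat) (V : normedModType R).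
Implicit Types f g : {ffun 'I_n -> V}.

(* The sum norm, equivalent to any other l^s combination of the |f i|. *)
Definition ffun_norm f : R := \sum_i `|f i|.

Let normD f g : ffun_norm (f + g) <= ffun_norm f + ffun_norm g.
Proof.
by rewrite -big_split/=; apply: ler_sum => i _; rewrite ffunE ler_normD.
Qed.

Let normZ (a : R) f : ffun_norm (a *: f) = `|a| * ffun_norm f.
Proof. by rewrite mulr_sumr; apply: eq_bigr => i _; rewrite ffunE normrZ. Qed.

Let norm_eq0 f : ffun_norm f = 0 -> f = 0.
Proof.
move=> /psumr_eq0P f0; apply/ffunP => i; apply/eqP.
by rewrite ffunE -normr_eq0 f0.
Qed.

HB.instance Definition _ :=
  Lmodule_isNormed.Build R {ffun 'I_n -> V} normD normZ norm_eq0.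

End ffun_normed.

Section operators.
Context (R : realType) (V : normedModType R).

(* An unbounded operator on V is represented by its graph. *)
Implicit Types A : set (V * V).

(* S is only constrained on nonnegative times. *)
Definition C0_semigroup (S : R -> V -> V) : Prop :=
  [/\ forall t, 0 <= t -> linear (S t) /\ continuous (S t),
      forall x, S 0 x = x,
      forall s t x, 0 <= s -> 0 <= t -> S (s + t) x = S s (S t x) &
      forall x, S t x @[t --> 0^'+] --> x].

Definition generator (S : R -> V -> V) : set (V * V) :=
  [set xy | h^-1 *: (S h xy.1 - xy.1) @[h --> 0^'+] --> xy.2].

(* The complexification of V is V * V, the pair (x, y) standing for x + iy. *)
Definition cscale (l : R[i]) (z : V * V) : V * V :=
  (complex.Re l *: z.1 - complex.Im l *: z.2,
   complex.Im l *: z.1 + complex.Re l *: z.2).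

Definition complexify A : set ((V * V) * (V * V)) :=
  [set zw | A (zw.1.1, zw.2.1) /\ A (zw.1.2, zw.2.2)].

(* The z in the domain of A such that (l I - A) z = y. *)
Definition resolvent_eq A (l : R[i]) (y : V * V) : set (V * V) :=
  [set z | exists2 w, complexify A (z, w) & cscale l z - w = y].

Definition resolvent A (l : R[i]) (y : V * V) : V * V :=
  xget 0 (resolvent_eq A l y).

Definition resolvent_set A : set R[i] :=
  [set l | (forall y, exists! z, resolvent_eq A l y z) /\
           continuous (resolvent A l)].

End operators.

Section laplace.
Context (R : realType).
Local Notation mu := (@lebesgue_measure R).

Definition cexp (z : R[i]) : R[i] :=
  ((expR (complex.Re z))%:C * (cos (complex.Im z) +i* sin (complex.Im z)))%C.

(* The Laplace integral of g at l converges absolutely, with value v. *)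
Definition has_laplace (l : R[i]) (g : R -> R[i]) (v : R[i]) : Prop :=
  let k t := cexp (- l * t%:C%C) * g t in
  [/\ mu.-integrable `[0, +oo[ (fun t => (complex.Re (k t))%:E),
      mu.-integrable `[0, +oo[ (fun t => (complex.Im (k t))%:E) &
      v = ((\int[mu]_(t in `[0, +oo[) complex.Re (k t)) +i*
           (\int[mu]_(t in `[0, +oo[) complex.Im (k t)))%C].

End laplace.

Section sobolev.
Context (R : realType).
Local Notation mu := (@lebesgue_measure R).
Implicit Types (D : set R) (f g eta : R -> R).

(* Test functions are taken in C^1_c(D), as in Brezis, Functional Analysis,
   Sobolev Spaces and PDE, Section 8.2. *)
Definition test_function D eta : Prop :=
  [/\ forall x, derivable eta x 1, continuous (derive1 eta) &
      exists K, [/\ compact K, K `<=` D & forall x, ~ K x -> eta x = 0]].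

(* For D open and f, g in L^p(D): f is in W^{1,p}(D), with derivative g. *)
Definition weak_derivative D f g : Prop :=
  forall eta, test_function D eta ->
    \int[mu]_(x in D) (f x * derive1 eta x) = - \int[mu]_(x in D) (g x * eta x).

(* The representative of f which is continuous on D takes the value a at x. *)
Definition boundary_value D f (x a : R) : Prop :=
  exists g, [/\ {within D, continuous g},
                {ae mu, forall y, D y -> g y = f y} & g x = a].

End sobolev.

Section transport.
Context (R : realType) (m q r : nat) (p : R) (p1 : (1 <= p%:E)%E).
Context (B : 'M[R]_(m + q, m + r)).
Local Notation mu := (@lebesgue_measure R).

Definition Lp01 : normedModType R :=
  LspaceType (mrestr mu (measurable_itv `]0, 1[)) p1.
Definition Lp0y : normedModType R :=
  LspaceType (mrestr mu (measurable_itv `]0, +oo[)) p1.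
Definition Xp : normedModType R :=
  ({ffun 'I_m -> Lp01} * {ffun 'I_q -> Lp0y} * {ffun 'I_r -> Lp0y})%type.
Implicit Types phi psi : Xp.

Definition uval phi (x : R) : 'cV[R]_m := \col_i phi.1.1 i x.
Definition vval phi (x : R) : 'cV[R]_q := \col_i phi.1.2 i x.
Definition wval phi (x : R) : 'cV[R]_r := \col_i phi.2 i x.

Local Notation B11 := (ulsubmx B).
Local Notation B12 := (ursubmx B).
Local Notation B21 := (dlsubmx B).
Local Notation B22 := (drsubmx B).

Definition Ap_eq phi psi : Prop :=
  (exists dphi : Xp,
    [/\ forall i, weak_derivative `]0, 1[ (phi.1.1 i) (dphi.1.1 i),
        forall i, weak_derivative `]0, +oo[ (phi.1.2 i) (dphi.1.2 i),
        forall i, weak_derivative `]0, +oo[ (phi.2 i) (dphi.2 i) &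
        psi = (- dphi.1.1, - dphi.1.2, dphi.2)]) /\
  (exists (u0 u1 : 'cV[R]_m) (v0 : 'cV[R]_q) (w0 : 'cV[R]_r),
    [/\ forall i, boundary_value `[0, 1] (phi.1.1 i) 0 (u0 i 0) /\
                  boundary_value `[0, 1] (phi.1.1 i) 1 (u1 i 0),
        forall i, boundary_value `[0, +oo[ (phi.1.2 i) 0 (v0 i 0),
        forall i, boundary_value `[0, +oo[ (phi.2 i) 0 (w0 i 0) &
        col_mx u0 v0 = B *m col_mx u1 w0]).

(* The graph of the operator A_p with domain D(A_p). *)
Definition Ap : set (Xp * Xp) := [set xy | Ap_eq xy.1 xy.2].

(* The n such that 0 < n + y < 1, which exists and is unique unless y is an
   integer or y >= 1. *)
Definition shift_index (y : R) : nat := xget 0%N [set n : nat | 0 < n%:R + y < 1].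

Definition Tu (t : R) phi (x : R) : 'cV[R]_m :=
  let n := shift_index (x - t) in
  B11 ^+ n *m uval phi (n%:R - t + x) +
  \sum_(k < n) B11 ^+ k *m B12 *m wval phi (t - x - k%:R).

Definition Tv (t : R) phi (x : R) : 'cV[R]_q :=
  if t < x then vval phi (x - t) else
  let n := shift_index (x - t + 1) in
  B21 *m B11 ^+ n *m uval phi (n%:R - t + x + 1) +
  B21 *m (\sum_(k < n) B11 ^+ k *m B12 *m wval phi (t - x - k%:R - 1)) +
  B22 *m wval phi (t - x).

Definition Tw (t : R) phi (x : R) : 'cV[R]_r := wval phi (x + t).

Definition is_Tp (t : R) phi psi : Prop :=
  [/\ {ae mu, forall x, 0 < x < 1 -> uval psi x = Tu t phi x},
      {ae mu, forall x, 0 < x -> vval psi x = Tv t phi x} &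
      {ae mu, forall x, 0 < x -> wval psi x = Tw t phi x}].

(* The class given almost everywhere by the formulas (unique if it exists). *)
Definition Tp (t : R) phi : Xp := xget 0 [set psi | is_Tp t phi psi].

(* z = L{T}(l) zeta, for z and zeta in the complexification of Xp. *)
Definition is_laplace_Tp (l : R[i]) (zeta z : Xp * Xp) : Prop :=
  [/\ {ae mu, forall x, 0 < x < 1 -> forall i, has_laplace l
        (fun t => (Tu t zeta.1 x i 0 +i* Tu t zeta.2 x i 0)%C)
        (uval z.1 x i 0 +i* uval z.2 x i 0)%C},
      {ae mu, forall x, 0 < x -> forall i, has_laplace l
        (fun t => (Tv t zeta.1 x i 0 +i* Tv t zeta.2 x i 0)%C)
        (vval z.1 x i 0 +i* vval z.2 x i 0)%C} &
      {ae mu, forall x, 0 < x -> forall i, has_laplace l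
        (fun t => (Tw t zeta.1 x i 0 +i* Tw t zeta.2 x i 0)%C)
        (wval z.1 x i 0 +i* wval z.2 x i 0)%C}].

End transport.

Arguments Xp {R} m q r {p} p1.
Arguments Ap {R m q r p} p1 B.
Arguments Tp {R m q r p} p1 B t phi.
Arguments is_Tp {R m q r p p1} B t phi psi.
Arguments is_laplace_Tp {R m q r p p1} B l zeta z.

(* Main.v *)
Require Import Defs.
From HB Require Import structures.
From mathcomp Require Import all_boot all_order all_algebra.
From mathcomp Require Import all_classical all_reals all_analysis measurable_realfun.
From mathcomp.real_closed Require Import complex.
From mathcomp Require Import ring lra.
Set Implicit Arguments.
Unset Strict Implicit.
Unset Printing Implicit Defensive.
Import Order.TTheory GRing.Theory Num.Theory.
Import numFieldNormedType.Exports.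

Local Open Scope classical_set_scope.
Local Open Scope ring_scope.

(* Along characteristics u(x, t) = U(x - t) and v(x, t) = V(x - t), where U, V
   extend the initial data to the left by U(y) = B11 U(y + 1) + B12 w(- y) and
   V(y) = B21 U(y + 1) + B22 w(- y). Hence T(t) translates L^p functions, which
   gives the C0-semigroup property by continuity of translations, and for phi
   in D(A_p) the quotients (T(h) phi - phi) / h are averages of the translates
   of A_p phi, so that A_p is contained in the generator. If Re l is large,
   then int_(-oo)^1 e^(Re l y) |U(y)| dy is finite, because the recursion for U
   contracts, and the Laplace transform z(x) = int_(s <= x) e^(- l (x - s)) U(s) ds
   satisfies z' = U - l z and, by the recursion at 0, the boundary condition.
   So l - A_p is onto; as T is bounded on [0, 1], a generator has no
   eigenvalue with large real part, and both operators coincide. *)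

(** As [B] is arbitrary, no dissipativity is available. The inclusion of A_p in the generator
    becomes an equality because [a - A_p] is onto and [a] minus the generator is injective, and
    injectivity needs only a bound [M] for T on [[0, 1]]: an eigenvector for [a] would grow by a
    factor near [1 + a] in unit time. A complex eigenvalue is made real by rotating the semigroup on
    the complexification, which at most doubles [M]. The spaces being real, the transform is split
    into cosine and sine kernels, a family closed under differentiation. The recursion for U
    contracts because a shift by 1 multiplies the weighted mass by [e^(- a)], which beats the
    entries of [B11] for large [a]. The extended data may grow to the left and need not be in
    L^p(R), so T is built for times up to 1 only, where at most one reflection occurs, and continued
    by composition. The domain is given by weak derivatives, whereas difference quotients and
    boundary values need absolutely continuous representatives; du Bois-Reymond's lemma and
    integration by parts connect the two. *)

(** * Translations and reflections of the line *)

Section affine.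
Context (R : realType).
Local Notation mu := (@lebesgue_measure R).
Implicit Types (s : bool) (c x : R).

(** The boolean sign treats translations ([false]) and reflections ([true]) together: [u] and [v]
    need the former, the reflected datum [w] the latter. *)
Definition aff s c x : R := (-1) ^+ s * x + c.

Lemma affE s c x : aff s c x = if s then c - x else x + c.
Proof. by rewrite /aff; case: s => /=; ring. Qed.

Lemma aff_continuous s c : continuous (aff s c).
Proof.
move=> x; apply: cvgD; last exact: cvg_cst.
by apply: cvgM; [exact: cvg_cst|exact: cvg_id].
Qed.

Lemma measurable_aff s c : measurable_fun setT (aff s c).
Proof. by apply: continuous_measurable_fun; exact: aff_continuous. Qed.

(** Uniqueness of Lebesgue measure: the pushforward under the affine map has the same values on
    half-open intervals, whose preimages are half-open on one side or the other. *)
Lemma lebesgue_measure_aff s c (A : set R) :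
  measurable A -> mu (aff s c @^-1` A) = mu A.
Proof.
have maff : @measurable_fun _ _ (measurableTypeR R) (measurableTypeR R) setT
  (aff s c) by exact: measurable_aff.
move=> mA; apply/esym.
apply: (@lebesgue_measure_unique R
  (measure_function_pushforward__canonical__measure_function_Measure mu maff)) => //.
move=> _ [[u v]] _ <- /=; rewrite /pushforward /=.
have -> : aff s c @^-1` `]u, v] =
    if s then `[c - v, c - u[%classic else `]u - c, v - c]%classic.
  apply/seteqP; split=> x /=; rewrite affE; case: s {maff} => /=;
    rewrite ?in_itv/= => /andP[? ?]; apply/andP; split; lra.
rewrite -/mu lebesgue_measure_itv/=; case: s {maff}; rewrite lebesgue_measure_itv/= !lte_fin.
  have -> : (c - v < c - u) = (u < v) by apply/idP/idP; lra.
  by case: ifP => // _; rewrite -!EFinB; congr EFin; lra.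
have -> : (u - c < v - c) = (u < v) by apply/idP/idP; lra.
by case: ifP => // _; rewrite -!EFinB; congr EFin; lra.
Qed.

Lemma ge0_integral_aff s c (f : R -> \bar R) : measurable_fun setT f ->
  (forall x, 0 <= f x)%E -> (\int[mu]_x f (aff s c x) = \int[mu]_x f x)%E.
Proof.
move=> mf f0; have maff : @measurable_fun _ _ (measurableTypeR R) (measurableTypeR R) setT
  (aff s c) by exact: measurable_aff.
rewrite -[LHS](ge0_integral_pushforward maff _ measurableT)//.
by apply: eq_measure_integral => A mA _; exact: lebesgue_measure_aff.
Qed.

Lemma integrable_aff s c (f : R -> \bar R) :
  mu.-integrable setT f -> mu.-integrable setT (f \o aff s c).
Proof.
move=> /integrableP[mf foo]; apply/integrableP; split.
  by apply: measurableT_comp => //; exact: measurable_aff.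
rewrite (@ge0_integral_aff s c (abse \o f))//.
  exact: measurableT_comp.
by move=> x; exact: abse_ge0.
Qed.

Lemma integral_aff s c (f : R -> \bar R) : mu.-integrable setT f ->
  (\int[mu]_x f (aff s c x) = \int[mu]_x f x)%E.
Proof.
move=> mf; have maff : @measurable_fun _ _ (measurableTypeR R) (measurableTypeR R) setT
  (aff s c) by exact: measurable_aff.
rewrite -[LHS](@integral_pushforward _ _ _ _ _ _ maff _ setT)//.
- by apply: eq_measure_integral => A mA _; exact: lebesgue_measure_aff.
- exact: (measurable_int mu).
- exact: integrable_aff.
Qed.

Lemma ae_aff s c (P : R -> Prop) :
  {ae mu, forall x, P x} -> {ae mu, forall x, P (aff s c x)}.
Proof.
move=> [A [mA A0 PA]]; exists (aff s c @^-1` A); split.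
- by rewrite -[X in measurable X]setTI; exact: measurable_aff.
- by rewrite lebesgue_measure_aff.
- by move=> x /= nP; exact: PA.
Qed.

End affine.

#[global] Instance ae_lebesgue_filter (R : realType) :
  Filter (almost_everywhere (@lebesgue_measure R)).
Proof. exact: (ae_filter_ringOfSetsType (@lebesgue_measure R)). Qed.

(** * Lebesgue measure restricted to a domain *)

Section mrestr.
Context (R : realType).
Local Notation mu := (@lebesgue_measure R).
Context (D : set (measurableTypeR R)) (mD : measurable D).

Lemma ae_mrestr (P : R -> Prop) :
  {ae mrestr mu mD, forall x, P x} <-> {ae mu, forall x, D x -> P x}.
Proof.
split=> -[A [mA A0 PA]].
  exists (A `&` D); split => //; first exact: measurableI.
  by move=> x /= /not_implyP[Dx nP]; split => //; exact: PA.
exists (A `|` ~` D); split; first by apply: measurableU => //; exact: measurableC.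
  rewrite /mrestr setIUl setICl setU0; apply/eqP.
  by rewrite eq_le measure_ge0 andbT -A0 le_measure// inE//; exact: measurableI.
move=> x /= nP; have [Dx|nDx] := pselect (D x); last by right.
by left; apply: PA => /= /(_ Dx).
Qed.

Lemma ge0_integral_mrestr (f : R -> \bar R) : measurable_fun setT f ->
  (forall x, 0 <= f x)%E ->
  (\int[mrestr mu mD]_x f x = \int[mu]_(x in D) f x)%E.
Proof.
move=> mf f0; have mDC := measurableC mD.
rewrite -(setUv D) ge0_integral_setU//=; first last.
- exact/disj_setPCl.
- exact: measurable_funTS.
rewrite [X in (_ + X)%E](_ : _ = 0%E) ?adde0; last first.
  rewrite null_set_integral//; first exact: measurable_funTS.
  by transitivity (mu (~` D `&` D)) => //; rewrite setICl measure0.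
apply: eq_measure_integral => A mA AD.
by transitivity (mu (A `&` D)) => //; rewrite (setIidl AD).
Qed.

End mrestr.

(** * L^p functions, their classes and the p-th power of the norm *)

Section Lp_classes.
Context (R : realType) (p : R) (p1 : (1 <= p%:E)%E).
Local Notation mu := (@lebesgue_measure R).

(** The p-th power of the norm, for plain functions and with values up to [+oo]: estimates on it
    need neither roots nor membership proofs. *)
Definition Np (f : R -> R) : \bar R := (\int[mu]_x (`|f x| `^ p)%:E)%E.

Definition inLp (f : R -> R) := measurable_fun setT f /\ (Np f < +oo)%E.

Lemma p_ge1 : 1 <= p. Proof. by rewrite -lee_fin. Qed.

Lemma p_gt0 : 0 < p. Proof. exact: lt_le_trans ltr01 p_ge1. Qed.

Lemma Np_ge0 f : (0 <= Np f)%E.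
Proof. by apply: integral_ge0 => x _; rewrite lee_fin powR_ge0. Qed.

Lemma measurable_powRabs (f : R -> R) : measurable_fun setT f ->
  measurable_fun setT (fun x => (`|f x| `^ p)%:E).
Proof.
move=> mf; apply/measurable_EFinP.
by apply: (measurableT_comp (measurable_powR _)); exact: measurableT_comp.
Qed.

Lemma Np_aff s c (f : R -> R) : measurable_fun setT f -> Np (f \o aff s c) = Np f.
Proof.
move=> mf; rewrite /Np.
by rewrite (@ge0_integral_aff _ s c (fun x => (`|f x| `^ p)%:E))//; exact: measurable_powRabs.
Qed.

Lemma inLp_aff s c (f : R -> R) : inLp f -> inLp (f \o aff s c).
Proof.
move=> [mf Nf]; split; last by rewrite Np_aff.
by apply: measurableT_comp => //; exact: measurable_aff.
Qed.

Lemma le_Np (f g : R -> R) : measurable_fun setT f -> measurable_fun setT g ->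
  {ae mu, forall x, `|f x| <= `|g x|} -> (Np f <= Np g)%E.
Proof.
move=> mf mg fg; apply: (@ae_ge0_le_integral _ _ _ mu setT measurableT).
- by move=> x _; rewrite lee_fin powR_ge0.
- exact: measurable_powRabs.
- by move=> x _; rewrite lee_fin powR_ge0.
- exact: measurable_powRabs.
- by apply: filterS fg => x fgx _; rewrite lee_fin ge0_ler_powR ?nnegrE// ltW// p_gt0.
Qed.

Section on_domain.
Context (D : set (measurableTypeR R)) (mD : measurable D).
Local Notation Lp := (LspaceType (mrestr mu mD) p1).
Implicit Types (f g : R -> R) (F G : Lp).

Lemma measurable_Lp F : measurable_fun setT (F : R -> R).
Proof. exact: (@measurable_funPT _ _ _ _ (Lrep F)). Qed.

Lemma LpP F G : F = G <-> {ae mu, forall x, D x -> F x = G x}.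
Proof.
rewrite LspaceP -ae_mrestr.
by split; apply: filterS => x; [exact|].
Qed.

Lemma measurable_patch_Lp F : measurable_fun setT ((F : R -> R) \_ D).
Proof. by apply/(measurable_restrictT _ mD)/measurable_funTS; exact: measurable_Lp. Qed.

Lemma Np_restrict (f : R -> R) :
  Np (f \_ D) = (\int[mu]_(x in D) (`|f x| `^ p)%:E)%E.
Proof.
rewrite [RHS]integral_mkcond; apply: eq_integral => x _.
rewrite !patchE; case: ifP => // _.
by rewrite normr0 powR0// gt_eqF// p_gt0.
Qed.

Lemma Lp_normE F : (\int[mu]_(x in D) (`|F x| `^ p)%:E = (`|F| `^ p)%:E)%E.
Proof.
have E : (`|F|%:E = 'N[mrestr mu mD]_p%:E[EFin \o F])%E :=
  finite_norm_fine (Lrep F).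
rewrite -poweR_EFin E poweR_Lnorm ?gt_eqF ?p_gt0//.
rewrite ge0_integral_mrestr//.
- by apply: measurable_powRabs; exact: measurable_Lp.
- by move=> x; rewrite poweR_ge0.
Qed.

Lemma Np_patch F : Np ((F : R -> R) \_ D) = (`|F| `^ p)%:E.
Proof. by rewrite Np_restrict Lp_normE. Qed.

Lemma inLp_patch F : inLp ((F : R -> R) \_ D).
Proof. by split; [exact: measurable_patch_Lp | rewrite Np_patch ltry]. Qed.

Lemma Lp_exists (f : R -> R) : measurable_fun setT f -> (Np (f \_ D) < +oo)%E ->
  exists F : Lp, {ae mu, forall x, D x -> F x = f x}.
Proof.
move=> mf Nf.
have fL : f \in Lfun (mrestr mu mD) p%:E.
  rewrite inE; apply/andP; split; rewrite inE//=.
  apply: (@lty_poweRy _ _ p); first by rewrite gt_eqF// p_gt0.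
  rewrite poweR_Lnorm; last by rewrite gt_eqF// p_gt0.
  rewrite ge0_integral_mrestr; [|exact: measurable_powRabs|by move=> x; rewrite poweR_ge0].
  by rewrite Np_restrict in Nf.
exists (Lclass (Lfun_Sub p1 fL)); apply/ae_mrestr.
by apply: filterS (LclassE (Lfun_Sub p1 fL)) => x; exact.
Qed.

(** Total in [f]: a function that agrees almost everywhere on [D] with no L^p function gets the
    class 0, so that terms carry no membership proof. *)
Definition cls (f : R -> R) : Lp :=
  xget 0 [set F : Lp | {ae mu, forall x, D x -> F x = f x}].

Lemma clsE (f : R -> R) : measurable_fun setT f -> (Np (f \_ D) < +oo)%E ->
  {ae mu, forall x, D x -> cls f x = f x}.
Proof.
move=> mf /(Lp_exists mf)[F FE].
apply: (@xgetPex _ 0 [set F : Lp | {ae mu, forall x, D x -> F x = f x}]).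
by exists F.
Qed.

Lemma norm_cls (f : R -> R) : measurable_fun setT f ->
  (Np (f \_ D) < +oo)%E -> ((`|cls f| `^ p)%:E = Np (f \_ D))%E.
Proof.
move=> mf Nf; rewrite -Lp_normE Np_restrict.
apply: ae_eq_integral => //.
- by apply: measurable_funTS; apply: measurable_powRabs; exact: measurable_Lp.
- by apply: measurable_funTS; exact: measurable_powRabs.
- by apply: filterS (clsE mf Nf) => x + Dx => ->.
Qed.

Lemma Lp_addE F G : {ae mu, forall x, D x -> (F + G) x = F x + G x}.
Proof.
by apply/ae_mrestr; apply: filterS (LclassE (Lrep F + Lrep G)) => x; exact.
Qed.

Lemma Lp_scaleE (a : R) F : {ae mu, forall x, D x -> (a *: F) x = a * F x}.
Proof.
by apply/ae_mrestr; apply: filterS (LclassE (a *: Lrep F)) => x; exact.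
Qed.

Lemma Lp_oppE F : {ae mu, forall x, D x -> (- F) x = - F x}.
Proof.
by apply/ae_mrestr; apply: filterS (LclassE (- Lrep F)) => x; exact.
Qed.

Lemma Lp_0E : {ae mu, forall x, D x -> (0 : Lp) x = 0}.
Proof.
by apply/ae_mrestr; apply: filterS (LclassE (0 : LfunType _ p1)) => x; exact.
Qed.

End on_domain.
End Lp_classes.
Arguments Np {R} p f%_R.

(** * Nonnegative integrals of real-valued functions *)

Section real_integrals.
Context (R : realType).
Local Notation mu := (@lebesgue_measure R).
Implicit Types f g : R -> R.

Lemma measurable_EFin_comp d (T : measurableType d) (D : set T) (f : T -> R) :
  measurable_fun D f ->
  measurable_fun D (fun x => (f x)%:E).
Proof. by move=> mf; apply/measurable_EFinP. Qed.

Lemma le_integral_EFin f g : measurable_fun setT f -> measurable_fun setT g ->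
  (forall x, 0 <= f x) -> (forall x, f x <= g x) ->
  (\int[mu]_x (f x)%:E <= \int[mu]_x (g x)%:E)%E.
Proof.
move=> mf mg f0 fg; apply: ge0_le_integral => //.
- by move=> x _; rewrite lee_fin.
- exact: measurable_EFin_comp.
- exact: measurable_EFin_comp.
- by move=> x _; rewrite lee_fin.
Qed.

Lemma ge0_integralD_EFin f g : measurable_fun setT f -> measurable_fun setT g ->
  (forall x, 0 <= f x) -> (forall x, 0 <= g x) ->
  (\int[mu]_x (f x + g x)%:E = \int[mu]_x (f x)%:E + \int[mu]_x (g x)%:E)%E.
Proof.
move=> mf mg f0 g0; rewrite -ge0_integralD//.
- by move=> x _; rewrite lee_fin.
- exact: measurable_EFin_comp.
- by move=> x _; rewrite lee_fin.
- exact: measurable_EFin_comp.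
Qed.

Lemma ge0_integralZ_EFin (a : R) f : measurable_fun setT f ->
  (forall x, 0 <= f x) -> 0 <= a ->
  (\int[mu]_x (a * f x)%:E = a%:E * \int[mu]_x (f x)%:E)%E.
Proof.
move=> mf f0 a0; rewrite -ge0_integralZl//; first exact: measurable_EFin_comp.
by move=> x _; rewrite lee_fin.
Qed.

End real_integrals.

(** * Jensen's inequality for powers *)

Section jensen.
Context (R : realType) (p : R) (p1 : 1 <= p).
Local Notation mu := (@lebesgue_measure R).

(** The tangent to the p-th power at [a], obtained from Young's inequality for [x] and
    [a ^ (p - 1)]. The case [p = 1] is separate because its conjugate exponent is infinite. *)
Lemma young_powR (x a : R) : 0 <= x -> 0 <= a ->
  p * (x * a `^ (p - 1)) <= x `^ p + (p - 1) * a `^ p.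
Proof.
move=> x0 a0; have [->|pN1] := eqVneq p 1.
  by rewrite subrr powRr0 !powRr1// !mul0r addr0 !mul1r mulr1.
have p0 : 0 < p by rewrite (lt_le_trans ltr01).
have p10 : 0 < p - 1 by rewrite subr_gt0 lt_neqAle eq_sym pN1.
have := @conjugate_powR R x (a `^ (p - 1)) p (p / (p - 1)) x0 (powR_ge0 _ _) p0.
have -> : (a `^ (p - 1)) `^ (p / (p - 1)) = a `^ p.
  by rewrite -powRrM mulrC divfK// gt_eqF.
rewrite divr_gt0// invf_div => /(_ erefl).
have -> : p^-1 + (p - 1) / p = 1 by field; rewrite gt_eqF.
move=> /(_ erefl); rewrite -(ler_pM2l p0); congr (_ <= _).
by field; rewrite !gt_eqF.
Qed.

Lemma le1_powR (x : R) : 0 <= x -> x <= 1 + x `^ p.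
Proof.
move=> x0; have [x1|/ltW x1] := leP x 1; first by rewrite (le_trans x1)// lerDl powR_ge0.
by rewrite (@le_trans _ _ (x `^ p)) ?lerDr//; rewrite -{1}(powRr1 x0) ler_powR.
Qed.

(** Integrate the tangent inequality of [young_powR], taken at the mean [a] of [g] under the density
    [k]: the tangent terms combine to [a ^ p]. *)
Lemma jensen_powR (k g : R -> R) :
  measurable_fun setT k -> measurable_fun setT g ->
  (forall x, 0 <= k x) -> (forall x, 0 <= g x) -> (\int[mu]_x (k x)%:E = 1)%E ->
  ((\int[mu]_x (k x * g x)%:E) `^ p <= \int[mu]_x (k x * g x `^ p)%:E)%E.
Proof.
move=> mk mg k0 g0 k1; have p0 : 0 < p by rewrite (lt_le_trans ltr01).
have p10 : 0 <= p - 1 by rewrite subr_ge0.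
set I := (leRHS); have [->|] := eqVneq I +oo%E; first by rewrite leey.
have I0 : (0 <= I)%E.
  by apply: integral_ge0 => x _; rewrite lee_fin mulr_ge0// powR_ge0.
move=> Ioo; have Ifin : I \is a fin_num by rewrite ge0_fin_numE// ltey.
have mgp : measurable_fun setT (fun x => g x `^ p).
  exact: (measurableT_comp (measurable_powR p)).
have mkg : measurable_fun setT (fun x => k x * g x) by exact: measurable_funM.
have mkgp : measurable_fun setT (fun x => k x * g x `^ p) by exact: measurable_funM.
have kg0 x : 0 <= k x * g x by rewrite mulr_ge0.
have kgp0 x : 0 <= k x * g x `^ p by rewrite mulr_ge0// powR_ge0.
have J0 : (0 <= \int[mu]_x (k x * g x)%:E)%E.
  by apply: integral_ge0 => x _; rewrite lee_fin.
(* The mean must be finite before it can serve as tangent point; [g <= 1 + g ^ p] gives this. *)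
have Jfin : (\int[mu]_x (k x * g x)%:E)%E \is a fin_num.
  rewrite ge0_fin_numE//.
  apply: (@le_lt_trans _ _ (\int[mu]_x (k x + k x * g x `^ p)%:E)%E).
    apply: le_integral_EFin => //; first exact: measurable_funD.
    move=> x; rewrite -[X in X + _]mulr1 -mulrDr.
    by rewrite ler_wpM2l// le1_powR.
  by rewrite ge0_integralD_EFin// k1 -/I lte_add_pinfty// ?ltry// ltey.
set J := (\int[mu]_x (k x * g x)%:E)%E in J0 Jfin *.
set a := fine J; have JE : J = a%:E by rewrite fineK.
have a0 : 0 <= a by rewrite fine_ge0.
have c0 : 0 <= p * a `^ (p - 1) by rewrite mulr_ge0 ?powR_ge0// ltW.
have d0 : 0 <= (p - 1) * a `^ p by rewrite mulr_ge0// powR_ge0.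
have : ((p * a `^ (p - 1))%:E * J <= I + ((p - 1) * a `^ p)%:E * 1)%E.
  rewrite -k1 -!ge0_integralZ_EFin//.
  rewrite -ge0_integralD_EFin//; last 2 first.
  - by apply: measurable_funM => //; exact: measurable_cst.
  - by move=> x; rewrite mulr_ge0.
  apply: le_integral_EFin => //.
  - by apply: measurable_funM => //; exact: measurable_cst.
  - apply: measurable_funD => //.
    by apply: measurable_funM => //; exact: measurable_cst.
  - by move=> x; rewrite mulr_ge0.
  - move=> x; rewrite [leLHS](_ : _ = k x * (p * (g x * a `^ (p - 1)))); last by ring.
    rewrite [leRHS](_ : _ = k x * (g x `^ p + (p - 1) * a `^ p)); last by ring.
    by rewrite ler_wpM2l// young_powR.
rewrite mule1 JE poweR_EFin -(fineK Ifin) -EFinM -EFinD !lee_fin.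
have -> : p * a `^ (p - 1) * a = p * a `^ p.
  rewrite -mulrA; congr (_ * _); have [->|an0] := eqVneq a 0.
    by rewrite mulr0 powR0// gt_eqF.
  by rewrite -[X in _ * X]powRr1// -powRD ?subrK// an0 implybT.
by rewrite mulrBl mul1r addrCA lerDl subr_ge0.
Qed.

End jensen.

(** * Averages over a parameter, and continuity of translations in L^1 *)

Section averages.
Context (R : realType) (p : R) (p1 : (1 <= p%:E)%E).
Local Notation mu := (@lebesgue_measure R).

(** Jensen in [t] for each [x], then Tonelli. Both the averages of translates over [[0, h]] and the
    exponential averages are instances, with different densities [k]. *)
Lemma Np_average (k : R -> R) (G : R * R -> R) (H : R -> R) (M : \bar R) : (0 <= M)%E ->
  measurable_fun setT k -> (forall t, 0 <= k t) -> (\int[mu]_t (k t)%:E = 1)%E ->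
  measurable_fun setT G -> (forall z, 0 <= G z) -> measurable_fun setT H ->
  (forall x, `|H x|%:E <= \int[mu]_t (k t * G (x, t))%:E)%E ->
  (forall t, (k t != 0)%R -> \int[mu]_x (G (x, t) `^ p)%:E <= M)%E ->
  (Np p H <= M)%E.
Proof.
move=> M0 mk k0 k1 mG G0 mH HG GM; have p_1 := p_ge1 p1; have p0 := p_gt0 p1.
have mGp : measurable_fun setT (fun z => G z `^ p).
  exact: (measurableT_comp (measurable_powR p)).
pose F (z : measurableTypeR R * measurableTypeR R) := (k z.2 * G z `^ p)%:E.
have mF : measurable_fun setT F.
  apply: measurable_EFin_comp; apply: measurable_funM => //.
  exact: (measurableT_comp mk).
have F0 z : (0 <= F z)%E by rewrite lee_fin mulr_ge0// powR_ge0.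
have mGx x : measurable_fun setT (fun t => G (x, t)).
  exact: (measurableT_comp mG).
have mGt t : measurable_fun setT (fun x => G (x, t)).
  exact: (measurableT_comp mG).
apply: (@le_trans _ _ (\int[mu]_x \int[mu]_t F (x, t))%E).
  apply: (@ge0_le_integral _ _ _ mu setT measurableT).
  - by move=> x _; rewrite lee_fin powR_ge0.
  - exact: measurable_powRabs.
  - exact: (measurable_fun_fubini_tonelli_F F).
  - move=> x _; apply: (le_trans _ (jensen_powR p_1 mk (mGx x) k0 _ k1)) => //.
    rewrite -poweR_EFin; apply: gt0_ler_poweR; rewrite ?in_itv/= ?leey ?andbT//.
    + exact: ltW.
    + by apply: integral_ge0 => t _; rewrite lee_fin mulr_ge0.
rewrite (fubini_tonelli F)//.
rewrite -[leRHS]mul1e -k1.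
rewrite -ge0_integralZr//; last 2 first.
- exact: measurable_EFin_comp.
- by move=> t _; rewrite lee_fin.
apply: (@ge0_le_integral _ _ _ mu setT measurableT).
- by move=> t _; apply: integral_ge0.
- exact: (measurable_fun_fubini_tonelli_G F).
- apply: emeasurable_funM => //. exact: measurable_EFin_comp.
- move=> t _; rewrite /F /=.
  rewrite ge0_integralZ_EFin//; last 2 first.
    exact: (measurableT_comp (measurable_powR p)).
    by move=> x; rewrite powR_ge0.
  have [->|kt] := eqVneq (k t) 0; first by rewrite !mul0e.
  by rewrite lee_wpmul2l ?lee_fin// GM.
Qed.

(** Tonelli applies to the positive and the negative part separately. *)
Lemma measurable_Rintegral (G : R * R -> R) : measurable_fun setT G ->
  measurable_fun setT (fun x => \int[mu]_t G (x, t)).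
Proof.
move=> mG.
pose F (z : measurableTypeR R * measurableTypeR R) := (G z)%:E.
have mF : measurable_fun setT F by exact: measurable_EFin_comp.
rewrite /Rintegral; apply: (@measurableT_comp _ _ _ _ _ _ fine _ (fun x => \int[mu]_t (F (x, t)))%E) => //.
rewrite (_ : (fun x => _) = (fun x => \int[mu]_t F^\+ (x, t) -
    \int[mu]_t F^\- (x, t))%E); last first.
  apply/funext => x; rewrite -[X in integral _ _ X]/(F \o pair x) [LHS]integralE.
  by rewrite funepos_comp funeneg_comp.
apply: emeasurable_funB.
- have h := @measurable_fun_fubini_tonelli_F _ _ _ _ R mu F^\+%E (measurable_funepos mF).
  by apply: h => z; rewrite funepos_ge0.
- have h := @measurable_fun_fubini_tonelli_F _ _ _ _ R mu F^\-%E (measurable_funeneg mF).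
  by apply: h => z; rewrite funeneg_ge0.
Qed.

(** Continuity of [g (x - h) - g x] in the pair [(x, h)] gives a local bound at each [(x, 0)];
    compactness of [K] makes it uniform in [x]. *)
Lemma near_translation_unif (g : R -> R) (K : set R) (e : R) : continuous g ->
  compact K -> 0 < e ->
  \forall h \near (0:R), forall x, K x -> `|g (x - h) - g x| <= e.
Proof.
move=> cg cK e0; have /compact_near_coveringP cK' := cK.
apply: (cK' R (nbhs (0:R)) (fun h x => `|g (x - h) - g x| <= e)) => x Kx.
have : (fun z : R * R => g (z.1 - z.2) - g z.1) @ (x, 0) --> g (x - 0) - g x.
  apply: cvgB; last first.
    by apply: (@cvg_comp _ _ _ fst g _ (nbhs x)); [exact: cvg_fst|exact: cg].
  apply: (@cvg_comp _ _ _ (fun z : R * R => z.1 - z.2) g _ (nbhs (x - 0))); last exact: cg.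
  by apply: cvgB; [exact: cvg_fst|exact: cvg_snd].
rewrite subr0 subrr => /cvgr0Pnorm_le /(_ _ e0).
by case=> -[U V] [/= Ux Vx UV]; exists (U, V) => //= z [Uz Vz]; exact: (UV z).
Qed.

(* Comparison with a continuous function reduces the claim to uniform
   continuity on a compact interval. *)
Lemma translation_L1 (f : R -> R) (N e : R) : 0 < N -> measurable_fun setT f ->
  mu.-integrable setT (EFin \o f) -> (forall x, N < `|x| -> f x = 0) -> 0 < e ->
  \forall h \near (0:R), (\int[mu]_x (`|f (x - h) - f x|)%:E <= e%:E)%E.
Proof.
move=> N0 mf intf f0 e0.
(* The margin 2 keeps [x] and [x - h] in [E] when [|x| <= N + 1] and [|h| <= 1]; if [|x| > N + 1],
   then [f] vanishes at both points. *)
pose E : set (measurableTypeR R) := `[- (N + 2), N + 2]%classic.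
have mE : measurable E by exact: measurable_itv.
pose L := N + 2 - (- (N + 2)).
have L0 : 0 < L by rewrite /L; lra.
have muE : (mu E = L%:E)%E.
  rewrite /E lebesgue_measure_itv/= lte_fin ifT//; lra.
have intfE : mu.-integrable E (EFin \o f) by exact: integrableS intf.
have muEy : (mu E < +oo)%E by rewrite muE ltry.
have [g_ [cg ig gf]] := approximation_continuous_integrable mE muEy intfE.
have e30 : 0 < e / 3 by rewrite divr_gt0.
have [n gn] : exists n, (\int[mu]_(z in E) `|(f z - g_ n z)%:E| <= (e / 3)%:E)%E.
  have /fine_cvgP[gfin /cvgr0Pnorm_le /(_ _ e30) gle] := gf.
  near \oo => n; exists n.
  have h1 : (\int[mu]_(z in E) `|(f z - g_ n z)%:E|)%E \is a fin_num by near: n.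
  rewrite -(fineK h1) lee_fin (le_trans (ler_norm _))//.
  by near: n.
have mg : measurable_fun setT (g_ n) by exact: continuous_measurable_fun.
pose A (x : R) := `|f x - g_ n x| * \1_E x.
have mA : measurable_fun setT A.
  apply: measurable_funM; last exact: measurable_indic.
  by apply: measurableT_comp => //; exact: measurable_funB.
have A0 x : 0 <= A x by rewrite mulr_ge0.
have IA : (\int[mu]_x (A x)%:E <= (e / 3)%:E)%E.
  apply: le_trans gn; rewrite [leRHS]integral_mkcond.
  apply: (@ge0_le_integral _ _ _ mu setT measurableT).
  - by move=> x _; rewrite lee_fin.
  - exact: measurable_EFin_comp.
  - apply/(measurable_restrictT _ mE)/measurable_funTS.
    by apply: measurable_EFin_comp; apply: measurableT_comp => //; exact: measurable_funB.
  - by move=> x _; rewrite patchE /A indicE; case: ifP => _; rewrite /= ?mulr1 ?mulr0.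
have K : compact E by exact: segment_compact.
have c0 : 0 < e / 3 / L by rewrite divr_gt0.
near=> h.
have h1 : `|h| <= 1 by near: h; exact: (@nbhs0_le R R^o 1 ltr01).
have hg : forall x, E x -> `|g_ n (x - h) - g_ n x| <= e / 3 / L.
  by near: h; exact: near_translation_unif.
have mAh : measurable_fun setT (fun x : R => A (x - h)).
  by apply: (measurableT_comp mA); exact: measurable_funB.
have mC : measurable_fun setT (fun x : R => e / 3 / L * \1_E x).
  by apply: measurable_funM => //; exact: measurable_indic.
have mfh : measurable_fun setT (fun x : R => f (x - h)).
  by apply: (measurableT_comp mf); exact: measurable_funB.
apply: (@le_trans _ _ (\int[mu]_x (A (x - h) + (e / 3 / L * \1_E x + A x))%:E)%E).
  apply: le_integral_EFin.
  - by apply: measurableT_comp => //; exact: measurable_funB.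
  - by apply: measurable_funD => //; exact: measurable_funD.
  - by [].
  - move=> x; have [xN|xN] := leP (`|x|) (N + 1).
      have Ex : E x.
        by rewrite /E/= in_itv/=; move: xN; rewrite ler_norml => /andP[? ?]; apply/andP; split; lra.
      have Exh : E (x - h).
        rewrite /E/= in_itv/=; move: xN h1; rewrite !ler_norml => /andP[? ?] /andP[? ?].
        by apply/andP; split; lra.
      rewrite /A !indicE !mem_set//= !mulr1.
      have -> : f (x - h) - f x = (f (x - h) - g_ n (x - h)) +
        ((g_ n (x - h) - g_ n x) + - (f x - g_ n x)) by ring.
      rewrite (le_trans (ler_normD _ _))// lerD2l (le_trans (ler_normD _ _))//.
      by rewrite normrN lerD2r hg.
    have -> : f x = 0 by rewrite f0//; lra.
    have -> : f (x - h) = 0.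
      rewrite f0//; have := ler_distD h x 0; rewrite !subr0; lra.
    rewrite subrr normr0 !addr_ge0// mulr_ge0//; exact: ltW.
rewrite ge0_integralD_EFin//; last 2 first.
- exact: measurable_funD.
- by move=> x; rewrite addr_ge0// mulr_ge0// ltW.
rewrite ge0_integralD_EFin//; last first.
- by move=> x; rewrite mulr_ge0// ltW.
rewrite ge0_integralZ_EFin//; last first.
- exact: ltW.
have -> : (\int[mu]_x (\1_E x)%:E = L%:E)%E by rewrite integral_indic// setIT; exact: muE.
have -> : (\int[mu]_x (A (x - h))%:E = \int[mu]_x (A x)%:E)%E.
  rewrite -(@ge0_integral_aff _ false (- h) (EFin \o A))//.
  - by apply: eq_integral => x _; rewrite /= affE.
  - exact: measurable_EFin_comp.
have eE : (e%:E = (e / 3)%:E + ((e / 3 / L)%:E * L%:E + (e / 3)%:E))%E.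
  by rewrite -EFinM -!EFinD; congr EFin; field; rewrite gt_eqF.
by rewrite [leRHS]eE leeD// leeD2l.
Unshelve. all: by end_near. Qed.

End averages.

(** * Continuity of translations in L^p *)

Section Lp_translation.
Context (R : realType) (p : R) (p1 : (1 <= p%:E)%E).
Local Notation mu := (@lebesgue_measure R).

(** A crude substitute for Minkowski's inequality on p-th powers: each term is at most the maximum
    of the three. *)
Lemma powR3 (a b c : R) :
  `|a + b + c| `^ p <= 3 `^ p * (`|a| `^ p + `|b| `^ p + `|c| `^ p).
Proof.
have p0 := p_gt0 p1.
pose m := Num.max `|a| (Num.max `|b| `|c|).
have m0 : 0 <= m by rewrite /m le_max normr_ge0.
have am : `|a| <= m by rewrite /m le_max lexx.
have bm : `|b| <= m by rewrite /m !le_max lexx orbT.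
have cm : `|c| <= m by rewrite /m !le_max lexx !orbT.
apply: (@le_trans _ _ ((3 * m) `^ p)).
  apply: ge0_ler_powR; rewrite ?nnegrE ?mulr_ge0//; first exact: ltW.
  apply: (le_trans (ler_normD _ _)); apply: (le_trans (lerD (ler_normD _ _) (lexx _))).
  by rewrite (_ : 3 * m = m + m + m) ?lerD//; ring.
rewrite powRM// ler_wpM2l ?powR_ge0//.
have a0 := powR_ge0 `|a| p; have b0 := powR_ge0 `|b| p; have c0 := powR_ge0 `|c| p.
rewrite /m; case: (leP `|a|) => _; last by rewrite -addrA lerDl addr_ge0.
case: (leP `|b|) => _; first by rewrite lerDr addr_ge0.
by rewrite addrAC lerDr addr_ge0.
Qed.

Lemma NpD3 (f g h : R -> R) : measurable_fun setT f -> measurable_fun setT g ->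
  measurable_fun setT h ->
  (Np p (fun x => f x + g x + h x)%R <= (3 `^ p)%:E * (Np p f + Np p g + Np p h))%E.
Proof.
move=> mf mg mh; have mp (u : R -> R) : measurable_fun setT u -> measurable_fun setT (fun x => `|u x| `^ p).
  by move=> mu'; apply: (measurableT_comp (measurable_powR _)); exact: measurableT_comp.
have mpf := mp _ mf; have mpg := mp _ mg; have mph := mp _ mh.
have mfg : measurable_fun setT (fun x => `|f x| `^ p + `|g x| `^ p) by exact: measurable_funD.
rewrite /Np -ge0_integralD_EFin//.
rewrite -ge0_integralD_EFin//.
rewrite -ge0_integralZ_EFin//; last exact: measurable_funD.
apply: le_integral_EFin => //.
- by apply: mp; apply: measurable_funD => //; exact: measurable_funD.
- by apply: measurable_funM => //; exact: measurable_funD.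
- by move=> x; exact: powR3.
Qed.

Lemma NpZ (a : R) (f : R -> R) : measurable_fun setT f ->
  (Np p (fun x => a * f x)%R = (`|a| `^ p)%:E * Np p f)%E.
Proof.
move=> mf; rewrite /Np -ge0_integralZ_EFin//; first last.
- by apply: (measurableT_comp (measurable_powR _)); exact: measurableT_comp.
by apply: eq_integral => x _; rewrite normrM powRM.
Qed.

Lemma inLp_integrable (f : R -> R) (E : set (measurableTypeR R)) : inLp p f -> measurable E ->
  (mu E < +oo)%E -> mu.-integrable E (EFin \o f).
Proof.
move=> [mf Nf] mE Ey; have p_1 := p_ge1 p1.
have mfp := measurable_powRabs p mf.
apply: (@le_integrable _ _ _ _ _ mE _ (fun x => (1 + `|f x| `^ p)%:E)).
- by apply: measurable_funTS; exact: measurable_EFin_comp.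
- move=> x _; rewrite /= lee_fin [leRHS]ger0_norm ?addr_ge0 ?powR_ge0//.
  exact: le1_powR.
- apply: (@integrableD _ _ _ mu _ mE (cst 1%E) (fun x => (`|f x| `^ p)%:E)); last first.
    apply: (@integrableS _ _ _ _ setT) => //; apply/integrableP; split.
      exact: mfp.
    by under eq_integral do rewrite gee0_abs ?lee_fin ?powR_ge0//.
  apply/integrableP; split; first exact: measurable_cst.
  by under eq_integral do rewrite /= normr1; rewrite integral_cst// mul1e.
Qed.

(** Dominated convergence along integer [N]. Both the domain and the values are cut, so that the
    truncated function is bounded with bounded support and the L^1 result applies to it. *)
Lemma truncation_Lp (f : R -> R) (e : R) : inLp p f -> 0 < e ->
  exists2 N : R, 0 < N & (Np p (fun x => f x - (f \_ [set x | `|x| <= N /\ `|f x| <= N]) x)%R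
    <= e%:E)%E.
Proof.
move=> [mf Nf] e0; have p0 := p_gt0 p1.
have mA N : measurable [set x : R | `|x| <= N /\ `|f x| <= N].
  apply: measurableI.
    rewrite -[X in measurable X]setTI.
    by apply: measurable_fun_le => //; exact: measurableT_comp.
  rewrite -[X in measurable X]setTI.
  by apply: measurable_fun_le => //; exact: measurableT_comp.
pose A (n : nat) := [set x : R | `|x| <= n.+1%:R /\ `|f x| <= n.+1%:R].
pose u (n : nat) (x : R) := f x - (f \_ (A n)) x.
have mu_ n : measurable_fun setT (u n).
  apply: measurable_funB => //; apply/(measurable_restrictT _ (mA _)).
  exact: measurable_funTS.
have mfp := measurable_powRabs p mf.
have mup n := measurable_powRabs p (mu_ n).
have [] := @dominated_convergence _ _ _ mu setT measurableT
  (fun n x => (`|u n x| `^ p)%:E) (cst 0%E) (fun x => (`|f x| `^ p)%:E) mup.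
- exact: measurable_cst.
- apply: aeW => x _ /=; apply: cvg_near_cst.
  near=> n; rewrite /u patchE mem_set; first by rewrite subrr normr0 powR0// gt_eqF.
  rewrite /A/=; split.
  + apply: (@le_trans _ _ n%:R); last by rewrite ler_nat.
    by near: n; exact: nbhs_infty_ger.
  + apply: (@le_trans _ _ n%:R); last by rewrite ler_nat.
    by near: n; exact: nbhs_infty_ger.
- apply/integrableP; split => //.
  by under eq_integral do rewrite gee0_abs ?lee_fin ?powR_ge0//.
- apply: aeW => x n _ /=; rewrite lee_fin ger0_norm ?powR_ge0//.
  rewrite /u patchE; case: ifP => _; rewrite ?subr0// subrr normr0 powR0 ?powR_ge0//.
  by rewrite gt_eqF.
move=> _ _; rewrite integral0 => /fine_cvgP[fin /cvgr0Pnorm_le /(_ _ e0) le_e].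
near \oo => n; exists n.+1%:R => //; rewrite -/(A n) /Np.
have fin_n : (\int[mu]_x (`|u n x| `^ p)%:E)%E \is a fin_num by near: n.
rewrite [leLHS](_ : _ = (\int[mu]_x (`|u n x| `^ p)%:E)%E)// -(fineK fin_n) lee_fin.
by rewrite (le_trans (ler_norm _))//; near: n.
Unshelve. all: by end_near. Qed.

(** Replace [f] by its truncation [g]. As [|g| <= N], the p-th power of a difference of values of
    [g] is at most [(2 N) ^ (p - 1)] times the difference, which reduces the claim to L^1. *)
Lemma translation_Lp (f : R -> R) (e : R) : inLp p f -> 0 < e ->
  \forall h \near (0:R), (Np p (fun x => f (x - h) - f x)%R <= e%:E)%E.
Proof.
move=> Lf e0; have p0 := p_gt0 p1; have p_1 := p_ge1 p1; have [mf Nf] := Lf.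
have c0 : 0 < 3 `^ p :> R by rewrite powR_gt0.
pose e' := e / (3 `^ p) / 3.
have e'0 : 0 < e' by rewrite !divr_gt0.
have [N N0 fN] := truncation_Lp Lf e'0.
set A := (X in f \_ X) in fN.
set g := f \_ A in fN.
have mA : measurable A.
  apply: measurableI.
    rewrite -[X in measurable X]setTI.
    by apply: measurable_fun_le => //; exact: measurableT_comp.
  rewrite -[X in measurable X]setTI.
  by apply: measurable_fun_le => //; exact: measurableT_comp.
have mg : measurable_fun setT g.
  by apply/(measurable_restrictT _ mA); exact: measurable_funTS.
have gN x : `|g x| <= N.
  by rewrite /g patchE; case: ifPn => [|_]; [rewrite inE => -[]|rewrite normr0 ltW].
have g0 x : N < `|x| -> g x = 0.
  by rewrite /g patchE; case: ifPn => //; rewrite inE => -[/le_lt_trans h _ /h]; rewrite ltxx.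
have ig : mu.-integrable setT (EFin \o g).
  rewrite -restrict_EFin; apply/(integrable_restrict mu mA measurableT); rewrite setTI.
  apply: (@integrableS _ _ _ mu `[- N, N]%classic) => //.
    by move=> x [xN _]; rewrite /= in_itv/= -ler_norml.
  apply: inLp_integrable => //; rewrite lebesgue_measure_itv; case: ifP => _; rewrite ltry//.
have c1 : 0 < (2 * N) `^ (p - 1) by rewrite powR_gt0 ?mulr_gt0.
have e''0 : 0 < e' / (2 * N) `^ (p - 1) by rewrite divr_gt0.
near=> h.
have gh : (\int[mu]_x (`|g (x - h) - g x|)%:E <= (e' / (2 * N) `^ (p - 1))%:E)%E.
  by near: h; exact: (translation_L1 N0 mg ig g0).
have mh (u : R -> R) : measurable_fun setT u -> measurable_fun setT (fun x : R => u (x - h)).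
  by move=> mu'; apply: (measurableT_comp mu'); exact: measurable_funB.
have mfg : measurable_fun setT (fun x => f x - g x) by exact: measurable_funB.
rewrite (_ : (fun x => _) = (fun x => (f (x - h) - g (x - h)) + (g (x - h) - g x)
   + (-1) * (f x - g x))); last by apply/funext => x; ring.
apply: (le_trans (NpD3 _ _ _)).
- exact: (mh _ mfg).
- by apply: measurable_funB => //; exact: mh.
- exact: measurable_funM.
rewrite NpZ// normrN1 powR1 mul1e.
have -> : Np p (fun x : R => f (x - h) - g (x - h)) = Np p (fun x => f x - g x).
  rewrite -(Np_aff p false (- h) mfg).
  by congr (Np p); apply/funext => x /=; rewrite affE.
have gh' : (Np p (fun x : R => g (x - h) - g x)%R <= e'%:E)%E.
  apply: (@le_trans _ _ (((2 * N) `^ (p - 1))%:E * \int[mu]_x (`|g (x - h) - g x|)%:E)%E).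
    rewrite -ge0_integralZ_EFin//; last 2 first.
    - by apply: measurableT_comp => //; apply: measurable_funB => //; exact: mh.
    - exact: ltW.
    apply: le_integral_EFin.
    - apply: (measurableT_comp (measurable_powR _)); apply: measurableT_comp => //.
      by apply: measurable_funB => //; exact: mh.
    - apply: measurable_funM => //; apply: measurableT_comp => //.
      by apply: measurable_funB => //; exact: mh.
    - by move=> x; exact: powR_ge0.
    - move=> x; set y := `|_ - _|.
      have y0 : 0 <= y by rewrite /y.
      have y2 : y <= 2 * N.
        by rewrite (le_trans (ler_normB _ _))// mulr_natl mulr2n lerD.
      have -> : y `^ p = y `^ (p - 1) * y.
        have [->|yn0] := eqVneq y 0; first by rewrite mulr0 powR0// gt_eqF.
        by rewrite -[X in _ * X]powRr1// -powRD ?subrK// yn0 implybT.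
      rewrite ler_wpM2r// ge0_ler_powR ?nnegrE ?subr_ge0// mulr_ge0// ltW//.
  rewrite -lee_pdivlMl//; apply: (le_trans gh).
  by rewrite -EFinM lee_fin mulrC.
have eE : (e%:E = (3 `^ p)%:E * (e'%:E + e'%:E + e'%:E))%E.
  by rewrite -!EFinD -EFinM; congr EFin; rewrite /e'; field; rewrite gt_eqF.
rewrite [leRHS]eE; apply: lee_wpmul2l; first by rewrite lee_fin ltW.
exact: leeD (leeD fN gh') fN.
Unshelve. all: by end_near. Qed.

End Lp_translation.

(** * Averages of translates over short times, and exponential averages *)

Section Lp_averages.
Context (R : realType) (p : R) (p1 : (1 <= p%:E)%E).
Local Notation mu := (@lebesgue_measure R).

Definition avg (h : R) (f : R -> R) (x : R) : R :=
  h^-1 * \int[mu]_(t in `[0, h]) f (x - t).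

Lemma measurable_avg h (f : R -> R) : measurable_fun setT f ->
  measurable_fun setT (avg h f).
Proof.
move=> mf; apply: measurable_funM => //; rewrite (_ : (fun x => _) = (fun x : R =>
    \int[mu]_t (f (x - t) * \1_(`[0, h]) t))); last first.
  apply/funext => x; rewrite Rintegral_mkcond; apply: eq_Rintegral => t _.
  by rewrite patchE indicE; case: ifP => _; rewrite ?mulr1 ?mulr0.
apply: (@measurable_Rintegral _ (fun z => f (z.1 - z.2) * \1_(`[0, h]) z.2)).
apply: measurable_funM.
  by apply: (measurableT_comp mf); exact: measurable_funB.
have mi : measurable_fun setT (\1_(`[0, h]%classic) : R -> R) by exact: measurable_indic.
exact: (measurableT_comp mi).
Qed.

Lemma inLp_translate_integrable (f : R -> R) (x h : R) : inLp p f ->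
  mu.-integrable `[0, h] (fun t => (f (x - t))%:E).
Proof.
move=> Lf; apply: (@inLp_integrable _ _ p1 (fun t => f (x - t))).
- have := inLp_aff true x Lf; congr (inLp p _).
  by apply/funext => t; rewrite /= affE.
- exact: measurable_itv.
- by rewrite lebesgue_measure_itv; case: ifP => _; rewrite ltry.
Qed.

(** By Jensen for the uniform density on [[0, h]], the error of the average is at most a common
    bound for the errors of the translates by [t] in [[0, h]]. *)
Lemma avg_Lp (f : R -> R) (e : R) : inLp p f -> 0 < e ->
  \forall h \near 0^'+, (Np p (fun x => avg h f x - f x)%R <= e%:E)%E.
Proof.
move=> Lf e0; have [mf Nf] := Lf.
have [d /= d0 fd] := translation_Lp p1 Lf e0.
near=> h.
have h0 : 0 < h by near: h; exact: nbhs_right_gt.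
have hd : h < d by near: h; exact: nbhs_right_lt.
pose k (t : R) := h^-1 * \1_(`[0, h]%classic) t.
have mk : measurable_fun setT k by apply: measurable_funM => //; exact: measurable_indic.
have hV0 : 0 <= h^-1 by rewrite invr_ge0 ltW.
have k0 t : 0 <= k t by rewrite mulr_ge0.
have mu0h : mu `[0, h]%classic = h%:E.
  by rewrite lebesgue_measure_itv/= lte_fin h0 sube0.
have k1 : (\int[mu]_t (k t)%:E = 1)%E.
  rewrite ge0_integralZ_EFin//.
  have -> : (\int[mu]_x (\1_(`[0, h]%classic) x)%:E = h%:E)%E.
    by rewrite integral_indic// setIT; exact: mu0h.
  by rewrite -EFinM mulVf// gt_eqF.
pose G (z : R * R) := `|f (z.1 - z.2) - f z.1|.
have mG : measurable_fun setT G.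
  apply: measurableT_comp => //; apply: measurable_funB.
    by apply: (measurableT_comp mf); exact: measurable_funB.
  exact: (measurableT_comp mf).
apply: (@Np_average _ _ p1 k G) => //.
- by rewrite lee_fin ltW.
- by move=> z; rewrite /G.
- by apply: measurable_funB => //; exact: measurable_avg.
- move=> x; have ix := inLp_translate_integrable x h Lf.
  have icst : mu.-integrable `[0, h] (fun t : R => (f x)%:E).
    apply/integrableP; split; first exact: measurable_cst.
    by rewrite integral_cst//= mu0h -EFinM ltry.
  have -> : avg h f x - f x = h^-1 * \int[mu]_(t in `[0, h]) (f (x - t) - f x).
    have cst_h : \int[mu]_(t in `[0, h]) (f x) = f x * h.
      by rewrite Rintegral_cst//; congr (_ * _); exact: (congr1 fine mu0h).
    rewrite RintegralB// cst_h mulrBr /avg; congr (_ - _).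
    by rewrite mulrCA mulVf ?mulr1// gt_eqF.
  rewrite normrM ger0_norm//.
  have iB : mu.-integrable `[0, h] (fun t => (f (x - t) - f x)%:E).
    exact: (integrableB _ ix icst).
  apply: (@le_trans _ _ (h^-1%:E * \int[mu]_(t in `[0%R, h]) `|(f (x - t) - f x)%:E|)%E).
    rewrite EFinM lee_wpmul2l ?lee_fin// EFin_normr_Rintegral//.
    by apply: le_abse_integral => //; exact: (measurable_int mu).
  rewrite integral_mkcond -ge0_integralZl//; last 2 first.
  - apply/(measurable_restrictT _ (measurable_itv _)); apply: measurableT_comp => //.
    exact: (measurable_int mu iB).
  - by move=> t _; rewrite patchE; case: ifP.
  rewrite le_eqVlt; apply/orP; left; apply/eqP; apply: eq_integral => t _.
  rewrite patchE /k /G indicE /=; case: ifP => _ /=; first by rewrite mulr1 -EFinM.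
  by rewrite mulr0 mul0r mule0.
- move=> t kt; have /fd : ball_ (fun x : R => `|x|) 0 d t.
    move: kt; rewrite /k indicE /=; case: (boolP (t \in _)); last by rewrite mulr0 eqxx.
    rewrite inE/= in_itv/= => /andP[t0 th] _; rewrite sub0r normrN ger0_norm//.
    exact: le_lt_trans hd.
  exact.
Unshelve. all: by end_near. Qed.

(** Convolution of [|f|] with the exponential density of rate [a]. Up to a constant it dominates the
    Laplace integrals with real part [a]. *)
Definition expconv (a : R) (f : R -> R) (x : R) : R :=
  \int[mu]_t (exponential_pdf a t * `|f (x - t)|).

Lemma measurable_expconv a (f : R -> R) : measurable_fun setT f ->
  measurable_fun setT (expconv a f).
Proof.
move=> mf; apply: (@measurable_Rintegral _ (fun z => exponential_pdf a z.2 * `|f (z.1 - z.2)|)).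
apply: measurable_funM.
  by apply: (measurableT_comp (measurable_exponential_pdf a)).
apply: measurableT_comp => //.
by apply: (measurableT_comp mf); exact: measurable_funB.
Qed.

(** The density has mass 1 and every translate of [f] has the same [Np]. *)
Lemma expconv_Lp (a : R) (f : R -> R) : inLp p f -> 0 < a ->
  (Np p (expconv a f) <= Np p f)%E.
Proof.
move=> [mf Nf] a0.
pose G (z : R * R) := `|f (z.1 - z.2)|.
apply: (@Np_average _ _ p1 (exponential_pdf a) G).
- exact: Np_ge0.
- exact: measurable_exponential_pdf.
- by move=> t; apply: exponential_pdf_ge0; exact: ltW.
- exact: integral_exponential_pdf.
- apply: measurableT_comp => //.
  by apply: (measurableT_comp mf); exact: measurable_funB.
- by move=> z; rewrite /G.
- exact: measurable_expconv.
- move=> x; rewrite /expconv /Rintegral -[X in fine X]/(\int[mu]_t (exponential_pdf a t * G (x, t))%:E)%E.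
  have : (0 <= \int[mu]_t (exponential_pdf a t * G (x, t))%:E)%E.
    apply: integral_ge0 => t _; rewrite lee_fin mulr_ge0//.
      by apply: exponential_pdf_ge0; exact: ltW.
    by rewrite /G.
  (* The real-valued integral is compared with the extended one; where the latter is [+oo] there is
     nothing to show. *)
  case: (integral _ _ _) => [s s0| _|/=]; last by rewrite leeNy_eq.
    by rewrite /= ger0_norm.
  by rewrite leey.
- move=> t _; rewrite -(Np_aff p false (- t) mf) /Np le_eqVlt; apply/orP; left.
  by apply/eqP; apply: eq_integral => x _; rewrite /= affE.
Qed.

End Lp_averages.

(** * Convergence of classes of translates and averages *)

Section class_operations.
Context (R : realType) (p : R) (p1 : (1 <= p%:E)%E).
Local Notation mu := (@lebesgue_measure R).

Definition LpT : normedModType R := LspaceType (mrestr mu (@measurableT _ (measurableTypeR R))) p1.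

Lemma inLp_LpT (F : LpT) : inLp p (F : R -> R).
Proof. by have := @inLp_patch _ _ p1 _ measurableT F; rewrite patch_setT. Qed.

Lemma Np_LpT (F : LpT) : Np p F = (`|F| `^ p)%:E.
Proof. by have := @Np_patch _ _ p1 _ measurableT F; rewrite patch_setT. Qed.

Section domain.
Context (D : set (measurableTypeR R)) (mD : measurable D).
Local Notation Lp := (LspaceType (mrestr mu mD) p1).
Local Notation cls := (cls p1 mD).

Lemma le_Np_patch (f : R -> R) : measurable_fun setT f -> (Np p (f \_ D) <= Np p f)%E.
Proof.
move=> mf; apply: (le_Np p1) => //.
  by apply/(measurable_restrictT _ mD)/measurable_funTS.
by apply: aeW => x; rewrite patchE; case: ifP => _ //; rewrite normr0.
Qed.

Lemma inLp_clsE (f : R -> R) : inLp p f -> {ae mu, forall x, D x -> cls f x = f x}.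
Proof.
move=> [mf Nf]; apply: (clsE _ _ mf); apply: (le_lt_trans (le_Np_patch mf)); exact: Nf.
Qed.

Lemma norm_cls_le (f : R -> R) K : measurable_fun setT f -> 0 <= K ->
  (Np p (f \_ D) <= (K `^ p)%:E)%E -> `|cls f| <= K.
Proof.
move=> mf K0 NK; have p0 := p_gt0 p1.
have : ((`|cls f| `^ p)%:E <= (K `^ p)%:E)%E.
  by rewrite norm_cls// (le_lt_trans NK)// ltry.
rewrite lee_fin => h; rewrite leNgt; apply/negP => Kf.
move: h; rewrite leNgt => /negP; apply.
by rewrite gt0_ltr_powR// nnegrE.
Qed.

Lemma norm_clsB_le (f g : R -> R) (e : R) : inLp p f -> inLp p g -> 0 <= e ->
  (Np p (fun x => g x - f x)%R <= (e `^ p)%:E)%E -> `|cls f - cls g| <= e.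
Proof.
move=> Lf Lg e0 gf.
have fg : (Np p (fun x => f x - g x)%R <= (e `^ p)%:E)%E.
  have E : (Np p (fun x => f x - g x) = Np p (fun x => g x - f x))%R.
    by apply: eq_integral => x _; rewrite distrC.
  by rewrite E.
have mfg : measurable_fun setT (fun x => f x - g x).
  by apply: measurable_funB; [exact: Lf.1|exact: Lg.1].
have fgD : (Np p ((fun x => f x - g x)%R \_ D) <= (e `^ p)%:E)%E.
  exact: le_trans (le_Np_patch mfg) fg.
rewrite [cls f - cls g](_ : _ = cls (fun x => f x - g x)); first exact: norm_cls_le.
apply/LpP.
have h1 := Lp_addE (cls f) (- cls g); have h2 := Lp_oppE (cls g).
have h3 := inLp_clsE Lf; have h4 := inLp_clsE Lg.
have h5 := @clsE _ _ p1 _ mD _ mfg (le_lt_trans fgD (ltry _)).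
apply: filterS (filterI h1 (filterI h2 (filterI h3 (filterI h4 h5)))).
by move=> x [a [b [c [d e']]]] Dx; rewrite a// b// c// d// e'.
Qed.

Lemma cls_LpT_norm (F : LpT) s c : `|cls (F \o aff s c)| <= `|F|.
Proof.
have LF := inLp_LpT F.
have LF' := inLp_aff s c LF.
apply: norm_cls_le => //; first exact: LF'.1.
apply: (le_trans (le_Np_patch LF'.1)).
by rewrite Np_aff ?Np_LpT//; exact: LF.1.
Qed.

Lemma cvg_cls_translate s (f : R -> R) : inLp p f ->
  cls (fun x => f (x - (-1) ^+ s * h)) @[h --> 0^'+] --> cls f.
Proof.
move=> Lf; have p0 := p_gt0 p1.
apply/cvgrPdist_le => e e0.
have ep : 0 < e `^ p by rewrite powR_gt0.
have [d /= d0 fd] := translation_Lp p1 Lf ep.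
near=> h; apply: norm_clsB_le; first exact: Lf.
- have := inLp_aff false (- ((-1) ^+ s * h)) Lf; congr inLp.
  by apply/funext => x; rewrite /= affE.
- exact: ltW.
- apply: fd; rewrite /ball_ /= sub0r normrN normrM normr_sign mul1r.
  have h0 : 0 < h by near: h; exact: nbhs_right_gt.
  by rewrite gtr0_norm//; near: h; exact: nbhs_right_lt.
Unshelve. all: by end_near. Qed.

(** With [false] the average looks to the left, as for [u] and [v], which move to the right; with
    [true] it looks to the right, as for [w]. *)
Definition avg_sign (s : bool) (h : R) (f : R -> R) (x : R) : R :=
  h^-1 * \int[mu]_(t in `[0, h]) f (x - (-1) ^+ s * t).

Lemma avg_signE s h f : avg_sign s h f = avg h (f \o aff s 0) \o aff s 0.
Proof.
apply/funext => x; rewrite /avg_sign /avg /=; congr (_ * _).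
apply: eq_Rintegral => t _; congr f; rewrite !affE.
by case: s; rewrite ?expr1 ?expr0; ring.
Qed.

Lemma near_avg_sign_Lp s (f : R -> R) (e : R) : inLp p f -> 0 < e ->
  \forall h \near 0^'+, (Np p (fun x => avg_sign s h f x - f x)%R <= e%:E)%E.
Proof.
move=> Lf e0; have Lf' := inLp_aff s 0 Lf.
near=> h.
have hu : (Np p (fun x => avg h (f \o aff s 0) x - (f \o aff s 0) x)%R <= e%:E)%E.
  by near: h; exact: avg_Lp.
pose u x := avg h (f \o aff s 0) x - (f \o aff s 0) x.
have {hu} : (Np p u <= e%:E)%E := hu.
have mu' : measurable_fun setT u.
  by apply: measurable_funB; [exact: measurable_avg Lf'.1|exact: Lf'.1].
rewrite -(Np_aff p s 0 mu').
rewrite (_ : u \o aff s 0 = (fun x => avg_sign s h f x - f x))//.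
apply/funext => x; rewrite avg_signE /u /=; congr (_ - f _).
by rewrite !affE; case: (s); ring.
Unshelve. all: by end_near. Qed.

(** For small [h] the average is close to [f], hence in L^p by [NpD3]. *)
Lemma near_inLp_avg_sign s (f : R -> R) : inLp p f ->
  \forall h \near 0^'+, inLp p (avg_sign s h f).
Proof.
move=> Lf; have Lf' := inLp_aff s 0 Lf; near=> h.
have mavg : measurable_fun setT (avg_sign s h f).
  rewrite avg_signE; apply: measurableT_comp; last exact: measurable_aff.
  exact: measurable_avg Lf'.1.
split => //.
have h1 : (Np p (fun x => avg_sign s h f x - f x)%R <= 1%:E)%E.
  by near: h; exact: near_avg_sign_Lp.
have -> : avg_sign s h f = (fun x => (avg_sign s h f x - f x) + f x + 0).
  by apply/funext => x; ring.
apply: (le_lt_trans (NpD3 p1 _ Lf.1 (measurable_cst _))).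
  by apply: measurable_funB => //; exact: Lf.1.
have -> : (Np p (cst 0%R) = 0)%E.
  rewrite /Np; under eq_integral do rewrite normr0 powR0 ?gt_eqF ?p_gt0//.
  exact: integral0.
rewrite adde0 lte_mul_pinfty ?lee_fin ?powR_ge0// lte_add_pinfty//; last exact: Lf.2.
exact: le_lt_trans h1 (ltry _).
Unshelve. all: by end_near. Qed.

Lemma cvg_cls_avg s (f : R -> R) : inLp p f ->
  cls (avg_sign s h f) @[h --> 0^'+] --> cls f.
Proof.
move=> Lf; have p0 := p_gt0 p1.
apply/cvgrPdist_le => e e0.
have ep : 0 < e `^ p by rewrite powR_gt0.
near=> h; apply: norm_clsB_le; first exact: Lf.
- by near: h; exact: near_inLp_avg_sign.
- exact: ltW.
- by near: h; exact: near_avg_sign_Lp.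
Unshelve. all: by end_near. Qed.

End domain.
End class_operations.

(** * The number of reflections *)

Section shift_index.
Context (R : realType).
Implicit Types y : R.

(** Excludes 0, -1, -2, ..., the points from which unit steps to the right hit an endpoint of []0,
    1[]. They form a null set. *)
Definition good y := forall n : nat, n%:R + y != 0.

Lemma natSD y n : n.+1%:R + y = n%:R + (y + 1).
Proof. by rewrite -natr1; ring. Qed.

Lemma goodS y : good y -> good (y + 1).
Proof. by move=> gy n; have := gy n.+1; rewrite natSD. Qed.

Lemma good_neq0 y : good y -> y != 0.
Proof. by move=> /(_ 0%N); rewrite add0r. Qed.

Lemma shift_index_uniq y n : 0 < n%:R + y < 1 -> shift_index y = n.
Proof.
move=> hn; rewrite /shift_index; case: xgetP => [k _ /= hk|/(_ n)//].
move: hn hk => /andP[? ?] /andP[? ?].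
have kn : (k < n.+1)%N by rewrite -(ltr_nat R) -natr1; lra.
have nk : (n < k.+1)%N by rewrite -(ltr_nat R) -natr1; lra.
by apply/eqP; rewrite eqn_leq -ltnS kn -ltnS nk.
Qed.

(* Every good y < 1 is reached from ]0, 1[ by finitely many steps of length 1 to the left. *)
Lemma good_ind (P : R -> Prop) :
  (forall y, 0 < y < 1 -> P y) ->
  (forall y, good y -> y < 0 -> P (y + 1) -> P y) ->
  forall y, good y -> y < 1 -> P y.
Proof.
move=> P0 PS y gy y1.
have [n ny] : exists n : nat, - y < n%:R.
  by exists (Num.truncn (- y)).+1; exact: truncnS_gt.
elim: n y gy y1 ny => [|n IH] y gy y1 ny.
  by apply: P0; rewrite y1 andbT; move: ny; rewrite oppr_lt0.
have [y0|y0|y0] := ltgtP y 0.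
- apply: PS => //; apply: IH; [exact: goodS|lra|move: ny; rewrite -natr1; lra].
- by apply: P0; rewrite y0.
- by have := good_neq0 gy; rewrite y0 eqxx.
Qed.

(** The existence of an index at [y + 1] has to be established first: the default value 0 on both
    sides would violate the equation. *)
Lemma shift_index_neg y : good y -> y < 0 -> shift_index y = (shift_index (y + 1)).+1.
Proof.
move=> gy y0.
suff [n hn] : exists n : nat, 0 < n%:R + (y + 1) < 1.
  by rewrite (shift_index_uniq hn); apply: shift_index_uniq; rewrite natSD.
have : y + 1 < 1 by lra.
move: (y + 1) (goodS gy); apply: good_ind => [z z01|z gz z0 [n hn]].
  by exists 0%N; rewrite add0r.
by exists n.+1; rewrite natSD.
Qed.

Local Notation mu := (@lebesgue_measure R).

Lemma ae_good : {ae mu, forall y, good y}.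
Proof.
apply: ae_foralln => n; exists [set - n%:R].
split; [exact: measurable_set1|exact: lebesgue_measure_set1|].
by move=> y /= /negP; rewrite negbK addrC addr_eq0 => /eqP.
Qed.

Lemma ae_shift c (P : R -> Prop) :
  {ae mu, forall x, P x} -> {ae mu, forall x, P (x + c)}.
Proof.
by move=> /(ae_aff false c); apply: filterS => x; rewrite affE.
Qed.

Lemma ae_reflect c (P : R -> Prop) :
  {ae mu, forall x, P x} -> {ae mu, forall x, P (c - x)}.
Proof.
by move=> /(ae_aff true c); apply: filterS => x; rewrite affE.
Qed.

End shift_index.

(** * Extension of the data to the left of 0 *)

Section extension.
Context (R : realType) (m q r : nat) (B : 'M[R]_(m + q, m + r)).
Local Notation mu := (@lebesgue_measure R).
Local Notation B11 := (ulsubmx B).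
Local Notation B12 := (ursubmx B).
Local Notation B21 := (dlsubmx B).
Local Notation B22 := (drsubmx B).
Implicit Types (fu : R -> 'cV[R]_m) (fv : R -> 'cV[R]_q) (fw : R -> 'cV[R]_r) (y : R).

(* The solution of the transport problem is u(x, t) = Uf (x - t),
   v(x, t) = Vf (x - t): Uf and Vf extend the initial data to the left. *)
Definition Uf fu fw y : 'cV[R]_m :=
  let n := shift_index y in
  B11 ^+ n *m fu (n%:R + y) + \sum_(k < n) B11 ^+ k *m B12 *m fw (- y - k%:R).

Definition Vf fu fv fw y : 'cV[R]_q :=
  if 0 < y then fv y else B21 *m Uf fu fw (y + 1) + B22 *m fw (- y).

Lemma Uf_pos fu fw y : 0 < y < 1 -> Uf fu fw y = fu y.
Proof.
move=> y01; rewrite /Uf (@shift_index_uniq _ y 0) ?add0r//.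
by rewrite big_ord0 addr0 expr0 mul1mx.
Qed.

(** The term [k = 0] of the sum is the inflow of [w]; in the others one factor [B11] comes out and
    the index drops by one. *)
Lemma Uf_neg fu fw y : good y -> y < 0 ->
  Uf fu fw y = B11 *m Uf fu fw (y + 1) + B12 *m fw (- y).
Proof.
move=> gy y0; rewrite /Uf shift_index_neg//; set n := shift_index (y + 1).
rewrite big_ord_recl/= expr0 mul1mx subr0 natSD exprS mulmxDr mulmxA.
rewrite (addrC (B12 *m _)) addrA; congr (_ + _ + _).
rewrite mulmx_sumr; apply: eq_bigr => k _.
rewrite exprS !mulmxA; congr (_ *m fw _).
by rewrite /bump/= add1n -natr1; ring.
Qed.

(** Unrolling from [y] reads the data only at points [y + n] and [- y - n], so the exceptional
    points lie in countably many translated or reflected null sets. *)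
Lemma Uf_congr fu fu' fw fw' :
  {ae mu, forall x, 0 < x < 1 -> fu x = fu' x} ->
  {ae mu, forall x, 0 < x -> fw x = fw' x} ->
  {ae mu, forall y, y < 1 -> Uf fu fw y = Uf fu' fw' y}.
Proof.
move=> uu ww; pose H y := forall n : nat,
  (0 < y + n%:R < 1 -> fu (y + n%:R) = fu' (y + n%:R)) /\
  (0 < - n%:R - y -> fw (- n%:R - y) = fw' (- n%:R - y)).
have HH : {ae mu, forall y, H y}.
  apply: ae_foralln => n; apply: filterS2 (ae_shift n%:R uu) (ae_reflect (- n%:R) ww).
  by move=> y; split.
apply: filterS2 (ae_good R) HH => y gy Hy y1; move: y gy y1 Hy.
apply: good_ind => [y y01 /(_ 0%N)[+ _]|y gy y0 IH Hy].
  by rewrite addr0 !Uf_pos// => /(_ y01).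
rewrite (Uf_neg fu fw gy y0) (Uf_neg fu' fw' gy y0) IH.
  by have [_] := Hy 0%N; rewrite oppr0 sub0r oppr_gt0 => ->.
move=> n; have := Hy n.+1; rewrite -natr1.
have -> : y + 1 + n%:R = y + (n%:R + 1) by ring.
by have -> : - n%:R - (y + 1) = - (n%:R + 1) - y by ring.
Qed.

Lemma Vf_congr fu fu' fv fv' fw fw' :
  {ae mu, forall x, 0 < x < 1 -> fu x = fu' x} ->
  {ae mu, forall x, 0 < x -> fv x = fv' x} ->
  {ae mu, forall x, 0 < x -> fw x = fw' x} ->
  {ae mu, forall y, Vf fu fv fw y = Vf fu' fv' fw' y}.
Proof.
move=> uu vv ww; have := ae_reflect 0 ww.
have := ae_shift 1 (Uf_congr uu ww).
move=> h1 h2; apply: filterS (filterI (ae_good R) (filterI vv (filterI h1 h2))).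
move=> y [gy [vy [uy wy]]]; rewrite /Vf; case: ltP => y0; first exact: vy.
have {}y0 : y < 0 by rewrite lt_neqAle y0 good_neq0.
by rewrite uy ?gtrDr//; move: wy; rewrite sub0r oppr_gt0 => ->.
Qed.

Lemma Uf_linear (a : R) fu fu' fw fw' y :
  Uf (fun x => a *: fu x + fu' x) (fun x => a *: fw x + fw' x) y =
  a *: Uf fu fw y + Uf fu' fw' y.
Proof.
rewrite /Uf; set n := shift_index y.
rewrite mulmxDr -scalemxAr scalerDr addrACA; congr (_ + _).
rewrite scaler_sumr -big_split/=; apply: eq_bigr => k _.
by rewrite mulmxDr -scalemxAr.
Qed.

Lemma Vf_linear (a : R) fu fu' fv fv' fw fw' y :
  Vf (fun x => a *: fu x + fu' x) (fun x => a *: fv x + fv' x)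
     (fun x => a *: fw x + fw' x) y =
  a *: Vf fu fv fw y + Vf fu' fv' fw' y.
Proof.
rewrite /Vf; case: ifP => // _; rewrite Uf_linear.
by rewrite (mulmxDr B21) (mulmxDr B22) -!scalemxAr scalerDr addrACA.
Qed.

(** The semigroup law in terms of extensions: both sides satisfy the same recursion and agree on
    []0, 1[]. Both [y] and [y - s] are unrolled, whence the two conditions [good]. *)
Lemma Uf_translate s fu fw y : 0 <= s -> good y -> good (y - s) -> y < 1 ->
  Uf (fun x => Uf fu fw (x - s)) (fun x => fw (x + s)) y = Uf fu fw (y - s).
Proof.
move=> s0 gy gys y1; move: y gy y1 gys.
apply: good_ind => [y y01 _|y gy y0 IH gys]; first by rewrite Uf_pos.
rewrite Uf_neg// IH; last by rewrite addrAC; exact: goodS.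
rewrite [RHS]Uf_neg//; last lra.
by congr (_ *m Uf _ _ _ + _ *m fw _); ring.
Qed.

Lemma Vf_translate s fu fv fw y : 0 <= s -> good y -> good (y - s) ->
  Vf (fun x => Uf fu fw (x - s)) (fun x => Vf fu fv fw (x - s))
     (fun x => fw (x + s)) y = Vf fu fv fw (y - s).
Proof.
move=> s0 gy gys; rewrite {1}/Vf; case: ltP => // y0.
have {}y0 : y < 0 by rewrite lt_neqAle y0 good_neq0.
rewrite Uf_translate//; [|exact: goodS|by rewrite addrAC; exact: goodS|lra].
rewrite /Vf ifF; last by apply/negbTE; rewrite -leNgt; lra.
by congr (_ *m Uf _ _ _ + _ *m fw _); ring.
Qed.

End extension.

(** * The defining relation of T(t): uniqueness, linearity, composition *)

Section Tp_relation.
Context (R : realType) (m q r : nat) (p : R) (p1 : (1 <= p%:E)%E).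
Context (B : 'M[R]_(m + q, m + r)).
Local Notation mu := (@lebesgue_measure R).
Local Notation X := (Xp m q r p1).
Implicit Types phi psi chi : X.

Lemma TuE t phi x : Tu B t phi x = Uf B (uval phi) (wval phi) (x - t).
Proof.
rewrite /Tu /Uf; congr (_ *m uval _ _ + _); first by ring.
by apply: eq_bigr => k _; congr (_ *m wval _ _); ring.
Qed.

Lemma TvE t phi x : Tv B t phi x = Vf B (uval phi) (vval phi) (wval phi) (x - t).
Proof.
rewrite /Tv /Vf subr_gt0; case: ifP => // _; rewrite /Uf /=.
rewrite mulmxDr mulmxA; congr (_ + _ + _).
- by congr (_ *m uval _ _); ring.
- by congr (_ *m _); apply: eq_bigr => k _; congr (_ *m wval _ _); ring.
- by congr (_ *m wval _ _); ring.
Qed.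

Lemma XpP phi psi : phi = psi <->
  [/\ {ae mu, forall x, 0 < x < 1 -> uval phi x = uval psi x},
      {ae mu, forall x, 0 < x -> vval phi x = vval psi x} &
      {ae mu, forall x, 0 < x -> wval phi x = wval psi x}].
Proof.
split=> [->|[hu hv hw]]; first by split; apply: aeW.
case: phi psi hu hv hw => [[u v] w] [[u' v'] w'] hu hv hw; congr (_, _, _).
- apply/ffunP => i; apply/LpP; apply: filterS hu => x + xD.
  by rewrite /= in_itv/= in xD => /(_ xD)/colP/(_ i); rewrite !mxE.
- apply/ffunP => i; apply/LpP; apply: filterS hv => x + xD.
  by rewrite /= in_itv/= andbT in xD => /(_ xD)/colP/(_ i); rewrite !mxE.
- apply/ffunP => i; apply/LpP; apply: filterS hw => x + xD.
  by rewrite /= in_itv/= andbT in xD => /(_ xD)/colP/(_ i); rewrite !mxE.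
Qed.

Lemma uval_linear (a : R) phi psi : {ae mu, forall x, 0 < x < 1 ->
  uval (a *: phi + psi) x = a *: uval phi x + uval psi x}.
Proof.
have h i : {ae mu, forall x, 0 < x < 1 ->
    (a *: phi + psi).1.1 i x = a * phi.1.1 i x + psi.1.1 i x}.
  rewrite [(a *: phi + psi).1.1 i](_ : _ = a *: phi.1.1 i + psi.1.1 i); last by rewrite /= !ffunE.
  have h1 := Lp_addE (a *: phi.1.1 i) (psi.1.1 i); have h2 := Lp_scaleE a (phi.1.1 i).
  apply: filterS2 h1 h2 => x h1 h2 x01; have xD : `]0, 1[%classic x by rewrite /= in_itv.
  by rewrite h1// h2.
have := @filter_forall _ _ _ _ (ae_lebesgue_filter R) h.
by apply: filterS => x hx x01; apply/colP => i; rewrite !mxE hx.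
Qed.

Lemma vval_linear (a : R) phi psi : {ae mu, forall x, 0 < x ->
  vval (a *: phi + psi) x = a *: vval phi x + vval psi x}.
Proof.
have h i : {ae mu, forall x, 0 < x ->
    (a *: phi + psi).1.2 i x = a * phi.1.2 i x + psi.1.2 i x}.
  rewrite [(a *: phi + psi).1.2 i](_ : _ = a *: phi.1.2 i + psi.1.2 i); last by rewrite /= !ffunE.
  have h1 := Lp_addE (a *: phi.1.2 i) (psi.1.2 i); have h2 := Lp_scaleE a (phi.1.2 i).
  apply: filterS2 h1 h2 => x h1 h2 x0; have xD : `]0, +oo[%classic x by rewrite /= in_itv/= x0.
  by rewrite h1// h2.
have := @filter_forall _ _ _ _ (ae_lebesgue_filter R) h.
by apply: filterS => x hx x01; apply/colP => i; rewrite !mxE hx.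
Qed.

Lemma wval_linear (a : R) phi psi : {ae mu, forall x, 0 < x ->
  wval (a *: phi + psi) x = a *: wval phi x + wval psi x}.
Proof.
have h i : {ae mu, forall x, 0 < x ->
    (a *: phi + psi).2 i x = a * phi.2 i x + psi.2 i x}.
  rewrite [(a *: phi + psi).2 i](_ : _ = a *: phi.2 i + psi.2 i); last by rewrite /= !ffunE.
  have h1 := Lp_addE (a *: phi.2 i) (psi.2 i); have h2 := Lp_scaleE a (phi.2 i).
  apply: filterS2 h1 h2 => x h1 h2 x0; have xD : `]0, +oo[%classic x by rewrite /= in_itv/= x0.
  by rewrite h1// h2.
have := @filter_forall _ _ _ _ (ae_lebesgue_filter R) h.
by apply: filterS => x hx x01; apply/colP => i; rewrite !mxE hx.
Qed.

Lemma is_Tp_uniq t phi psi psi' : is_Tp B t phi psi -> is_Tp B t phi psi' -> psi = psi'.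
Proof.
move=> [u v w] [u' v' w']; apply/XpP; split.
- by apply: filterS2 u u' => x h h' x0; rewrite h// h'.
- by apply: filterS2 v v' => x h h' x0; rewrite h// h'.
- by apply: filterS2 w w' => x h h' x0; rewrite h// h'.
Qed.

Lemma is_Tp_TpE t phi psi : is_Tp B t phi psi -> Tp p1 B t phi = psi.
Proof.
move=> h; apply: (is_Tp_uniq _ h).
exact: (@xgetPex _ 0 [set psi | is_Tp B t phi psi] (ex_intro _ psi h)).
Qed.

Lemma is_Tp0 phi : is_Tp B 0 phi phi.
Proof.
split.
- by apply: aeW => x x01; rewrite TuE subr0 Uf_pos.
- by apply: aeW => x x0; rewrite TvE subr0 /Vf x0.
- by apply: aeW => x x0; rewrite /Tw addr0.
Qed.

Lemma is_Tp_linear t (a : R) phi phi' psi psi' : 0 <= t ->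
  is_Tp B t phi psi -> is_Tp B t phi' psi' ->
  is_Tp B t (a *: phi + phi') (a *: psi + psi').
Proof.
move=> t0 [u v w] [u' v' w'].
have lu := uval_linear a phi phi'; have lv := vval_linear a phi phi'.
have lw := wval_linear a phi phi'; split.
- have h := ae_shift (- t) (Uf_congr B lu lw).
  apply: filterS (filterI (uval_linear a psi psi') (filterI h (filterI u u'))).
  move=> x [xl [xh [xu xu']]] x01; rewrite xl// xu// xu'// !TuE.
  have xt1 : x - t < 1 by case/andP: x01 => _ x1; rewrite ltrBlDr (lt_le_trans x1)// lerDl.
  by rewrite (xh xt1) Uf_linear.
- have h := ae_shift (- t) (Vf_congr B lu lv lw).
  apply: filterS (filterI (vval_linear a psi psi') (filterI h (filterI v v'))).
  move=> x [xl [xh [xu xu']]] x01; rewrite xl// xu// xu'// !TvE.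
  by rewrite xh Vf_linear.
- have h := ae_shift t lw.
  apply: filterS (filterI (wval_linear a psi psi') (filterI h (filterI w w'))).
  move=> x [xl [xh [xu xu']]] x01; rewrite xl// xu// xu'// /Tw.
  by rewrite xh// ltr_wpDr.
Qed.

(** Stated for the relation and not for [Tp], since the existence of T(t) phi for large [t] is
    deduced from it. *)
Lemma is_Tp_comp s t phi psi chi : 0 <= s -> 0 <= t ->
  is_Tp B s phi psi -> is_Tp B t psi chi -> is_Tp B (s + t) phi chi.
Proof.
move=> s0 t0 [u v w] [u' v' w'].
have {}u : {ae mu, forall x, 0 < x < 1 ->
    uval psi x = Uf B (uval phi) (wval phi) (x - s)}.
  by apply: filterS u => x + x01 => /(_ x01); rewrite TuE.
have {}v : {ae mu, forall x, 0 < x ->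
    vval psi x = Vf B (uval phi) (vval phi) (wval phi) (x - s)}.
  by apply: filterS v => x + x01 => /(_ x01); rewrite TvE.
have gt := ae_shift (- t) (ae_good R).
have gst := ae_shift (- (s + t)) (ae_good R).
split.
- have h := ae_shift (- t) (Uf_congr B u w).
  apply: filterS (filterI u' (filterI h (filterI gt gst))).
  move=> x [xu [xh [g1 g2]]] x01; rewrite xu// !TuE.
  have xt1 : x - t < 1 by case/andP: x01 => _ x1; rewrite ltrBlDr (lt_le_trans x1)// lerDl.
  rewrite (xh xt1).
  have E : x - (s + t) = x - t - s by ring.
  by rewrite Uf_translate// ?E// -E.
- have h := ae_shift (- t) (Vf_congr B u v w).
  apply: filterS (filterI v' (filterI h (filterI gt gst))).
  move=> x [xu [xh [g1 g2]]] x01; rewrite xu// !TvE xh.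
  have E : x - (s + t) = x - t - s by ring.
  by rewrite Vf_translate// ?E// -E.
- have h := ae_shift t w.
  apply: filterS (filterI w' h) => x [xw xh] x0.
  rewrite xw// /Tw xh; last by rewrite ltr_wpDr.
  by rewrite /Tw; congr wval; ring.
Qed.

End Tp_relation.

(** * Norm and convergence in the product space *)

Section Xp_norm.
Context (R : realType) (m q r : nat) (p : R) (p1 : (1 <= p%:E)%E).
Local Notation X := (Xp m q r p1).
Implicit Types phi : X.

Lemma norm_ffun n (V : normedModType R) (f : {ffun 'I_n -> V}) : `|f| = \sum_i `|f i|.
Proof. by []. Qed.

Lemma norm_ffun_ge n (V : normedModType R) (f : {ffun 'I_n -> V}) i : `|f i| <= `|f|.
Proof. by rewrite norm_ffun (bigD1 i)//= lerDl sumr_ge0. Qed.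

Lemma norm_u_le phi i : `|phi.1.1 i| <= `|phi|.
Proof.
by rewrite (le_trans (norm_ffun_ge _ _))// !prod_normE /= !le_max lexx.
Qed.

Lemma norm_v_le phi i : `|phi.1.2 i| <= `|phi|.
Proof.
by rewrite (le_trans (norm_ffun_ge _ _))// !prod_normE /= !le_max lexx orbT.
Qed.

Lemma norm_w_le phi i : `|phi.2 i| <= `|phi|.
Proof.
by rewrite (le_trans (norm_ffun_ge _ _))// !prod_normE /= !le_max lexx orbT.
Qed.

Lemma norm_Xp_le phi : `|phi| <= \sum_i `|phi.1.1 i| + \sum_i `|phi.1.2 i| + \sum_i `|phi.2 i|.
Proof.
rewrite !prod_normE !norm_ffun !ge_max; have s0 n (V : normedModType R) (f : {ffun 'I_n -> V}) :
  0 <= \sum_i `|f i| by rewrite sumr_ge0.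
rewrite -!andbA; apply/and3P; split.
- by rewrite -addrA lerDl addr_ge0.
- by rewrite addrAC lerDr addr_ge0.
- by rewrite lerDr addr_ge0.
Qed.

Lemma cvg_XpP (T : Type) (F : set_system T) {FF : Filter F} (f : T -> X) (l : X) :
  (forall i, (f t).1.1 i @[t --> F] --> l.1.1 i) ->
  (forall i, (f t).1.2 i @[t --> F] --> l.1.2 i) ->
  (forall i, (f t).2 i @[t --> F] --> l.2 i) -> f t @[t --> F] --> l.
Proof.
move=> hu hv hw; apply/cvgrPdist_le => e e0.
pose N := (m + q + r)%N; pose e' := e / N.+1%:R.
have e'0 : 0 < e' by rewrite divr_gt0.
have small k (V : normedModType R) (a : 'I_k -> V) (b : T -> 'I_k -> V) :
    (forall i, b t i @[t --> F] --> a i) ->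
    \forall t \near F, \sum_i `|a i - b t i| <= k%:R * e'.
  move=> ba.
  have : \forall t \near F, forall i, `|a i - b t i| <= e'.
    by apply: filter_forall => i; move/cvgrPdist_le : (ba i); exact.
  apply: filterS => t h; rewrite (le_trans (ler_sum _ (fun i _ => h i)))//.
  by rewrite sumr_const card_ord mulr_natl.
have hu' := small _ _ _ _ hu; have hv' := small _ _ _ _ hv; have hw' := small _ _ _ _ hw.
apply: filterS (filterI hu' (filterI hv' hw')) => t [tu [tv tw]].
apply: (le_trans (norm_Xp_le _)).
apply: (@le_trans _ _ (m%:R * e' + q%:R * e' + r%:R * e')).
  apply: lerD; [apply: lerD|].
  - by apply: le_trans tu; apply: ler_sum => i _; rewrite /= !ffunE.
  - by apply: le_trans tv; apply: ler_sum => i _; rewrite /= !ffunE.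
  - by apply: le_trans tw; apply: ler_sum => i _; rewrite /= !ffunE.
rewrite -!mulrDl -!natrD -/N /e' mulrCA ger_pMr// ler_pdivrMr// mul1r ler_nat.
exact: leqnSn.
Qed.

End Xp_norm.

(** * Linear combinations of classes *)

Section Lp_sum.
Context (R : realType) (p : R) (p1 : (1 <= p%:E)%E).
Local Notation mu := (@lebesgue_measure R).
Context (D : set (measurableTypeR R)) (mD : measurable D).
Local Notation Lp := (LspaceType (mrestr mu mD) p1).

Lemma Lp_sumE n (a : 'I_n -> R) (F : 'I_n -> Lp) (f : 'I_n -> R -> R) :
  (forall i, {ae mu, forall x, D x -> F i x = f i x}) ->
  {ae mu, forall x, D x -> (\sum_i a i *: F i) x = \sum_i a i * f i x}.
Proof.
move=> Ff; elim: (index_enum _) => [|i s IH].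
  by apply: filterS (Lp_0E p1 mD) => x + xD; rewrite !big_nil => ->.
have h1 := Lp_addE (a i *: F i) (\sum_(j <- s) a j *: F j).
apply: filterS (filterI IH (filterI (Ff i) (filterI (Lp_scaleE (a i) (F i)) h1))).
by move=> x [e1 [e2 [e3 e4]]] xD; rewrite !big_cons e4// e1// e3// e2.
Qed.

End Lp_sum.

(** * T(h) for [h <= 1] as a translation in L^p(R) *)

Section Tp_small.
Context (R : realType) (m q r : nat) (p : R) (p1 : (1 <= p%:E)%E).
Context (B : 'M[R]_(m + q, m + r)).
Local Notation mu := (@lebesgue_measure R).
Local Notation X := (Xp m q r p1).
Local Notation D01 := (measurable_itv (Interval (BRight (0:R)) (BLeft (1:R)))).
Local Notation D0y := (measurable_itv (Interval (BRight (0:R)) (BInfty R false))).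
Implicit Types phi psi : X.

(** A component extended by zero to the whole line and then translated or reflected; the extensions
    of the data are sums of such pieces. *)
Definition piece (D : set (measurableTypeR R)) (mD : measurable D) (s : bool) (c : R)
  (F : LspaceType (mrestr mu mD) p1) : LpT p1 :=
  cls p1 measurableT ((F \_ D : R -> R) \o aff s c).

Lemma pieceE D (mD : measurable D) s c (F : LspaceType (mrestr mu mD) p1) :
  {ae mu, forall x, setT x -> piece s c F x = (F \_ D : R -> R) (aff s c x)}.
Proof. by apply: inLp_clsE; apply: inLp_aff; exact: inLp_patch. Qed.

Lemma norm_piece D (mD : measurable D) s c (F : LspaceType (mrestr mu mD) p1) :
  `|piece s c F| <= `|F|.
Proof.
have LF := inLp_patch F; have LF' := inLp_aff s c LF.
apply: norm_cls_le => //; first exact: LF'.1.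
by rewrite patch_setT Np_aff ?Np_patch//; exact: LF.1.
Qed.

(* The restriction of Uf to ]-1, 1[, as an element of L^p(R). *)
Definition Gu phi (i : 'I_m) : LpT p1 :=
  piece false 0 (phi.1.1 i) +
  (\sum_j ulsubmx B i j *: piece false 1 (phi.1.1 j) +
   \sum_k ursubmx B i k *: piece true 0 (phi.2 k)).

(** Agrees with [Vf] to the right of -1. Further left only the contribution of [w] is kept, which
    keeps the function in L^p(R). *)
Definition Gv phi (i : 'I_q) : LpT p1 :=
  piece false 0 (phi.1.2 i) +
  (\sum_j dlsubmx B i j *: piece false 1 (phi.1.1 j) +
   \sum_k drsubmx B i k *: piece true 0 (phi.2 k)).

Definition Gw phi (i : 'I_r) : LpT p1 := piece false 0 (phi.2 i).

Let sum3E n1 n2 (F : LpT p1) (a1 : 'I_n1 -> R) (F1 : 'I_n1 -> LpT p1)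
    (a2 : 'I_n2 -> R) (F2 : 'I_n2 -> LpT p1) f (f1 : 'I_n1 -> R -> R) (f2 : 'I_n2 -> R -> R) :
  {ae mu, forall x, setT x -> F x = f x} ->
  (forall i, {ae mu, forall x, setT x -> F1 i x = f1 i x}) ->
  (forall i, {ae mu, forall x, setT x -> F2 i x = f2 i x}) ->
  {ae mu, forall x, (F + (\sum_i a1 i *: F1 i + \sum_i a2 i *: F2 i)) x =
    f x + (\sum_i a1 i * f1 i x + \sum_i a2 i * f2 i x)}.
Proof.
move=> h h1 h2.
have e1 := Lp_addE F (\sum_i a1 i *: F1 i + \sum_i a2 i *: F2 i).
have e2 := Lp_addE (\sum_i a1 i *: F1 i) (\sum_i a2 i *: F2 i).
apply: filterS (filterI h (filterI (Lp_sumE a1 h1) (filterI (Lp_sumE a2 h2) (filterI e1 e2)))).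
by move=> x [d1 [d2 [d3 [d4 d5]]]]; rewrite d4// d5// d1// d2// d3.
Qed.

(** To the right of -1 the recursion is used at most once: if [y < 0], then [y + 1] is already in
    []0, 1[]. *)
Lemma GuE phi i : {ae mu, forall y, -1 < y < 1 ->
  Gu phi i y = Uf B (uval phi) (wval phi) y i 0}.
Proof.
have h := sum3E (ulsubmx B i) (ursubmx B i) (pieceE false 0 (phi.1.1 i))
  (fun j => pieceE false 1 (phi.1.1 j)) (fun k => pieceE true 0 (phi.2 k)).
apply: filterS2 (ae_good R) h => y gy + /andP[yN1 y1]; rewrite /Gu => ->.
rewrite !affE addr0; have [y0|y0|y0] := ltgtP y 0; last first.
- by have := good_neq0 gy; rewrite y0 eqxx.
- rewrite Uf_pos ?y0// !mxE patchE mem_set/= ?in_itv/= ?y0//.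
  rewrite !big1 ?addr0// => j _; rewrite patchE memNset ?mulr0//= in_itv/=.
  + by rewrite sub0r oppr_gt0; apply/negP; rewrite andbT -leNgt ltW.
  + by apply/negP; rewrite negb_and -!leNgt lerDr (ltW y0) orbT.
- rewrite Uf_neg// Uf_pos; last by apply/andP; split; lra.
  rewrite patchE memNset ?add0r//=; last by rewrite in_itv/= ltNge (ltW y0).
  rewrite !mxE; congr (_ + _); apply: eq_bigr => j _; rewrite !mxE patchE mem_set//=.
  + by rewrite in_itv/=; apply/andP; split; lra.
  + by rewrite in_itv/= oppr_gt0 y0.
Qed.

Lemma GvE phi i : {ae mu, forall y, -1 < y ->
  Gv phi i y = Vf B (uval phi) (vval phi) (wval phi) y i 0}.
Proof.
have h := sum3E (dlsubmx B i) (drsubmx B i) (pieceE false 0 (phi.1.2 i))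
  (fun j => pieceE false 1 (phi.1.1 j)) (fun k => pieceE true 0 (phi.2 k)).
apply: filterS2 (ae_good R) h => y gy + yN1; rewrite /Gv => ->.
rewrite !affE addr0 /Vf; have [y0|y0|y0] := ltgtP y 0; last first.
- by have := good_neq0 gy; rewrite y0 eqxx.
- rewrite !mxE patchE mem_set/= ?in_itv/= ?y0//.
  rewrite !big1 ?addr0// => j _; rewrite patchE memNset ?mulr0//= in_itv/=.
  + by rewrite sub0r oppr_gt0; apply/negP; rewrite andbT -leNgt ltW.
  + by apply/negP; rewrite negb_and -!leNgt lerDr (ltW y0) orbT.
- rewrite Uf_pos; last by apply/andP; split; lra.
  rewrite patchE memNset ?add0r//=; last by rewrite in_itv/= ltNge (ltW y0).
  rewrite !mxE; congr (_ + _); apply: eq_bigr => j _; rewrite !mxE patchE mem_set//=.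
  + by rewrite in_itv/=; apply/andP; split; lra.
  + by rewrite in_itv/= oppr_gt0 y0.
Qed.

Lemma GwE phi i : {ae mu, forall y, 0 < y -> Gw phi i y = phi.2 i y}.
Proof.
apply: filterS (pieceE false 0 (phi.2 i)) => y + y0; rewrite /Gw => -> //.
by rewrite affE addr0 patchE mem_set//= in_itv/= y0.
Qed.

(** This is T(h) phi for [0 <= h <= 1] only. For other [h] it is some element of the space, subject
    to the same norm bound. *)
Definition Th phi (h : R) : X :=
  ([ffun i => cls p1 D01 (fun x => Gu phi i (x - (-1) ^+ false * h))],
   [ffun i => cls p1 D0y (fun x => Gv phi i (x - (-1) ^+ false * h))],
   [ffun i => cls p1 D0y (fun x => Gw phi i (x - (-1) ^+ true * h))]).

Let cls_GE D (mD : measurable D) s h (G : LpT p1) : {ae mu, forall x, D x ->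
  cls p1 mD (fun x => G (x - (-1) ^+ s * h)) x = G (x - (-1) ^+ s * h)}.
Proof.
apply: (@inLp_clsE _ _ p1 _ mD (fun x => G (x - (-1) ^+ s * h))).
have := inLp_aff false (- ((-1) ^+ s * h)) (inLp_LpT G); congr inLp.
by apply/funext => x; rewrite /= affE.
Qed.

Lemma is_Tp_Th phi h : 0 <= h <= 1 -> is_Tp B h phi (Th phi h).
Proof.
case/andP => h0 h1; split.
- have hi (i : 'I_m) : {ae mu, forall x, 0 < x < 1 ->
      uval (Th phi h) x i 0 = Tu B h phi x i 0}.
    apply: filterS2 (cls_GE D01 false h (Gu phi i)) (ae_shift (- h) (GuE phi i)) => x e1 e2 x01.
    have xD : `]0, 1[%classic x by rewrite /= in_itv.
    have xh : -1 < x - h < 1 by case/andP : x01 => x0 x1; apply/andP; split; lra.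
    by rewrite TuE [LHS]mxE ffunE (e1 xD) expr0 mul1r (e2 xh).
  have := @filter_forall _ _ _ _ (ae_lebesgue_filter R) hi.
  by apply: filterS => x hx x01; apply/colP => i; exact: hx.
- have hi (i : 'I_q) : {ae mu, forall x, 0 < x ->
      vval (Th phi h) x i 0 = Tv B h phi x i 0}.
    apply: filterS2 (cls_GE D0y false h (Gv phi i)) (ae_shift (- h) (GvE phi i)) => x e1 e2 x0.
    have xD : `]0, +oo[%classic x by rewrite /= in_itv/= x0.
    have xh : -1 < x - h by lra.
    by rewrite TvE [LHS]mxE ffunE (e1 xD) expr0 mul1r (e2 xh).
  have := @filter_forall _ _ _ _ (ae_lebesgue_filter R) hi.
  by apply: filterS => x hx x01; apply/colP => i; exact: hx.
- have hi (i : 'I_r) : {ae mu, forall x, 0 < x ->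
      wval (Th phi h) x i 0 = Tw h phi x i 0}.
    apply: filterS2 (cls_GE D0y true h (Gw phi i)) (ae_shift h (GwE phi i)) => x e1 e2 x0.
    have xD : `]0, +oo[%classic x by rewrite /= in_itv/= x0.
    have xh : 0 < x + h by lra.
    by rewrite !mxE ffunE (e1 xD) expr1 mulN1r opprK (e2 xh).
  have := @filter_forall _ _ _ _ (ae_lebesgue_filter R) hi.
  by apply: filterS => x hx x01; apply/colP => i; exact: hx.
Qed.

(** Extension by zero, affine substitution and restriction do not increase the norm, so sums of the
    absolute values of the entries of [B] bound the components. *)
Lemma norm_Th : exists2 M : R, 1 <= M & forall phi h, `|Th phi h| <= M * `|phi|.
Proof.
pose Ku i := 1 + (\sum_j `|ulsubmx B i j| + \sum_k `|ursubmx B i k|).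
pose Kv i := 1 + (\sum_j `|dlsubmx B i j| + \sum_k `|drsubmx B i k|).
have cls_le D (mD : measurable D) s h (G : LpT p1) :
    `|cls p1 mD (fun x => G (x - (-1) ^+ s * h))| <= `|G|.
  rewrite (_ : (fun x => _) = (G : R -> R) \o aff false (- ((-1) ^+ s * h))).
    exact: cls_LpT_norm.
  by apply/funext => x; rewrite /= affE.
have sum_le n (a : 'I_n -> R) (F : 'I_n -> LpT p1) (N : R) : (forall i, `|F i| <= N) ->
    `|\sum_i a i *: F i| <= (\sum_i `|a i|) * N.
  move=> FN; rewrite (le_trans (ler_norm_sum _ _ _))// mulr_suml.
  by apply: ler_sum => i _; rewrite normrZ ler_wpM2l.
have Gu_le phi i : `|Gu phi i| <= Ku i * `|phi|.
  rewrite /Gu (le_trans (ler_normD _ _))// mulrDl mul1r lerD//.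
    by rewrite (le_trans (norm_piece _ _ _))// norm_u_le.
  rewrite (le_trans (ler_normD _ _))// mulrDl lerD//; apply: sum_le => k.
    by rewrite (le_trans (norm_piece _ _ _))// norm_u_le.
  by rewrite (le_trans (norm_piece _ _ _))// norm_w_le.
have Gv_le phi i : `|Gv phi i| <= Kv i * `|phi|.
  rewrite /Gv (le_trans (ler_normD _ _))// mulrDl mul1r lerD//.
    by rewrite (le_trans (norm_piece _ _ _))// norm_v_le.
  rewrite (le_trans (ler_normD _ _))// mulrDl lerD//; apply: sum_le => k.
    by rewrite (le_trans (norm_piece _ _ _))// norm_u_le.
  by rewrite (le_trans (norm_piece _ _ _))// norm_w_le.
have Gw_le phi i : `|Gw phi i| <= 1 * `|phi|.
  by rewrite mul1r (le_trans (norm_piece _ _ _))// norm_w_le.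
have Ku0 i : 0 <= Ku i by rewrite !addr_ge0// sumr_ge0.
have Kv0 i : 0 <= Kv i by rewrite !addr_ge0// sumr_ge0.
(* The summand 1 makes the constant at least 1, so that its powers increase. *)
exists (1 + (\sum_i Ku i + \sum_i Kv i + \sum_(i < r) 1)).
  by rewrite lerDl !addr_ge0 ?sumr_ge0.
move=> phi h; rewrite (le_trans (norm_Xp_le _))// mulrDl mul1r.
rewrite (@le_trans _ _ ((\sum_i Ku i + \sum_i Kv i + \sum_(i < r) 1) * `|phi|)) ?lerDr//.
rewrite !mulrDl !mulr_suml; apply: lerD; [apply: lerD|]; apply: ler_sum => i _;
  rewrite ffunE (le_trans (cls_le _ _ _ _ _))//.
Qed.

Lemma cls_Gu phi i : cls p1 D01 (Gu phi i : R -> R) = phi.1.1 i.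
Proof.
apply/LpP; apply: filterS2 (inLp_clsE p1 D01 (inLp_LpT (Gu phi i))) (GuE phi i).
move=> x e1 e2 xD; rewrite (e1 xD); move: (xD); rewrite /= in_itv/= => x01.
have xh : -1 < x < 1 by case/andP : x01 => x0 x1; apply/andP; split; lra.
by rewrite (e2 xh) Uf_pos// mxE.
Qed.

Lemma cls_Gv phi i : cls p1 D0y (Gv phi i : R -> R) = phi.1.2 i.
Proof.
apply/LpP; apply: filterS2 (inLp_clsE p1 D0y (inLp_LpT (Gv phi i))) (GvE phi i).
move=> x e1 e2 xD; rewrite (e1 xD); move: (xD); rewrite /= in_itv/= andbT => x0.
have xh : -1 < x by lra.
by rewrite (e2 xh) /Vf x0 mxE.
Qed.

Lemma cls_Gw phi i : cls p1 D0y (Gw phi i : R -> R) = phi.2 i.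
Proof.
apply/LpP; apply: filterS2 (inLp_clsE p1 D0y (inLp_LpT (Gw phi i))) (GwE phi i).
move=> x e1 e2 xD; rewrite (e1 xD); move: (xD); rewrite /= in_itv/= andbT => x0.
by rewrite (e2 x0).
Qed.

Lemma cvg_Th phi : Th phi h @[h --> 0^'+] --> phi.
Proof.
apply: cvg_XpP => i.
- rewrite -[phi.1.1 i]cls_Gu (_ : (fun t => _) = (fun h => cls p1 D01
      (fun x => Gu phi i (x - (-1) ^+ false * h)))); last by apply/funext => h; rewrite ffunE.
  by apply: cvg_cls_translate; exact: inLp_LpT.
- rewrite -[phi.1.2 i]cls_Gv (_ : (fun t => _) = (fun h => cls p1 D0y
      (fun x => Gv phi i (x - (-1) ^+ false * h)))); last by apply/funext => h; rewrite ffunE.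
  by apply: cvg_cls_translate; exact: inLp_LpT.
- rewrite -[phi.2 i]cls_Gw (_ : (fun t => _) = (fun h => cls p1 D0y
      (fun x => Gw phi i (x - (-1) ^+ true * h)))); last by apply/funext => h; rewrite ffunE.
  by apply: cvg_cls_translate; exact: inLp_LpT.
Qed.

End Tp_small.

(** * The C0-semigroup property *)

Lemma bounded_linear_continuous (R : realType) (V W : normedModType R) (f : V -> W) (K : R) :
  linear f -> (forall x, `|f x| <= K * `|x|) -> continuous f.
Proof.
move=> lf fK x; apply/cvgrPdist_le => e e0.
have fB y : f x - f y = f (x - y).
  have := lf (-1) y x; rewrite !scaleN1r [- y + x]addrC => ->.
  by rewrite addrC.
near=> y; rewrite fB (le_trans (fK _))//.
apply: (@le_trans _ _ ((`|K| + 1) * `|x - y|)).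
  by rewrite ler_wpM2r// (le_trans (ler_norm _))// lerDl.
rewrite -ler_pdivlMl ?ltr_wpDl//.
by near: y; apply: cvgr_dist_le => //; rewrite mulr_gt0 ?invr_gt0// ltr_wpDl.
Unshelve. all: by end_near. Qed.

Section semigroup.
Context (R : realType) (m q r : nat) (p : R) (p1 : (1 <= p%:E)%E).
Context (B : 'M[R]_(m + q, m + r)).
Local Notation X := (Xp m q r p1).
Implicit Types phi psi : X.

(** Existence of T(t) phi and the exponential bound are obtained together, by composing time steps
    of length at most 1. *)
Lemma is_Tp_bounded : exists2 M : R, 1 <= M & forall n t phi, 0 <= t <= n%:R ->
  exists2 psi, is_Tp B t phi psi & `|psi| <= M ^+ n * `|phi|.
Proof.
have [M M1 TM] := norm_Th p1 B; exists M => //.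
elim=> [|n IH] t phi /andP[t0 tn].
  exists phi; last by rewrite mul1r.
  have -> : t = 0 by apply/eqP; rewrite eq_le t0 tn.
  exact: is_Tp0.
(* The time covered by the induction hypothesis; the rest [t - t'] lies in [[0, 1]]. *)
pose t' := Num.max 0 (t - 1).
have [t'0 t'n] : 0 <= t' /\ t' <= n%:R.
  rewrite /t' le_max lexx ge_max ler0n; split => //=.
  by rewrite lerBlDr natr1.
have tt' : 0 <= t - t' <= 1.
  rewrite /t'; have [h|h] := leP 0 (t - 1).
    by rewrite opprB addrCA subrr addr0 ler01 lexx.
  by rewrite subr0 t0 -subr_le0 ltW.
have t'0n : 0 <= t' <= n%:R by rewrite t'0.
have [psi h1 h2] := IH t' phi t'0n.
exists (Th B psi (t - t')).
  rewrite -[t in is_Tp _ t](subrKC t').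
  by apply: is_Tp_comp h1 _ => //; [by case/andP: tt'|exact: is_Tp_Th].
rewrite (le_trans (TM _ _))// exprS -mulrA ler_wpM2l//.
exact: le_trans M1.
Qed.

Lemma TpP t phi : 0 <= t -> is_Tp B t phi (Tp p1 B t phi).
Proof.
move=> t0; have [M _ h] := is_Tp_bounded.
have [] := h (Num.truncn t).+1 t phi; first by rewrite t0 ltW// truncnS_gt.
by move=> psi /[dup] /is_Tp_TpE ->.
Qed.

Lemma Tp_ThE h phi : 0 <= h <= 1 -> Tp p1 B h phi = Th B phi h.
Proof. by move=> h01; apply: is_Tp_TpE; exact: is_Tp_Th. Qed.

Lemma Tp_linear t : 0 <= t -> linear (Tp p1 B t).
Proof.
by move=> t0 a phi psi; apply: is_Tp_TpE; apply: is_Tp_linear => //; exact: TpP.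
Qed.

Lemma C0_semigroup_Tp : C0_semigroup (Tp p1 B).
Proof.
have [M _ TM] := is_Tp_bounded.
split.
- move=> t t0; split; first exact: Tp_linear.
  apply: (@bounded_linear_continuous _ _ _ _ (M ^+ (Num.truncn t).+1)); first exact: Tp_linear.
  move=> phi; have tn : 0 <= t <= (Num.truncn t).+1%:R by rewrite t0 ltW// truncnS_gt.
  by have [psi /is_Tp_TpE ->] := TM _ _ phi tn.
- by move=> phi; apply: is_Tp_TpE; exact: is_Tp0.
- move=> s t phi s0 t0; apply: is_Tp_TpE; rewrite addrC.
  by apply: is_Tp_comp (TpP _ t0) (TpP _ s0).
- move=> phi; apply: cvg_trans (@cvg_Th R m q r p p1 B phi); apply: near_eq_cvg.
  near=> h; apply/esym; rewrite Tp_ThE//; apply/andP; split.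
    by near: h; exact: nbhs_right_ge.
  by near: h; exact: nbhs_right_le.
Unshelve. all: by end_near. Qed.

End semigroup.

(** * Products of integrable functions and primitives *)

Section integral_products.
Context (R : realType).
Local Notation mu := (@lebesgue_measure R).
Implicit Types f g : R -> R.

Lemma integrable_measurable (D : set (measurableTypeR R)) f : mu.-integrable D (EFin \o f) -> measurable_fun D f.
Proof. by move=> /(measurable_int mu)/measurable_EFinP. Qed.

Section integrable_EFin.
Variables (D : set (measurableTypeR R)) (mD : measurable D).

Lemma integrable_EFinD f g : mu.-integrable D (EFin \o f) -> mu.-integrable D (EFin \o g) ->
  mu.-integrable D (EFin \o (fun x => f x + g x)).
Proof. by move=> hf hg; exact: (integrableD mD hf hg). Qed.

Lemma integrable_EFinB f g : mu.-integrable D (EFin \o f) -> mu.-integrable D (EFin \o g) ->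
  mu.-integrable D (EFin \o (fun x => f x - g x)).
Proof. by move=> hf hg; exact: (integrableB mD hf hg). Qed.

Lemma integrable_EFinZ (c : R) f : mu.-integrable D (EFin \o f) ->
  mu.-integrable D (EFin \o (fun x => c * f x)).
Proof. by move=> hf; exact: (integrableZl mD c hf). Qed.

Lemma integrable_EFinM (K : R) f g : mu.-integrable D (EFin \o f) ->
  measurable_fun D g -> (forall x, D x -> `|g x| <= K) ->
  mu.-integrable D (EFin \o (fun x => f x * g x)).
Proof.
move=> hf mg gK; have mf := integrable_measurable hf.
apply/integrableP; split; first by apply: measurable_EFin_comp; exact: measurable_funM.
have /integrableP[mf' hf'] := integrable_EFinZ K hf.
apply: le_lt_trans hf'; apply: ge0_le_integral => //.
- by apply: (measurableT_comp (f := abse)) => //; apply: measurable_EFin_comp; exact: measurable_funM.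
- by apply: (measurableT_comp (f := abse)).
- move=> x Dx; rewrite /= lee_fin !normrM mulrC ler_wpM2r//.
  by rewrite (le_trans (gK x Dx))// ler_norm.
Qed.

End integrable_EFin.

(** Sections are integrable only for almost every point, and elsewhere the inner real integral may
    be a default value; hence the detour through almost everywhere equality with the extended
    integrals. *)
Lemma Rintegral_Fubini (H : R * R -> R) :
  (mu \x mu)%E.-integrable setT (EFin \o H) ->
  \int[mu]_x \int[mu]_y H (x, y) = \int[mu]_y \int[mu]_x H (x, y).
Proof.
move=> iH.
have mH : measurable_fun setT H.
  by have /(measurable_int _)/measurable_EFinP := iH.
have E1 : (\int[mu]_x (\int[mu]_y H (x, y))%:E = \int[mu]_x \int[mu]_y (H (x, y))%:E)%E.
  apply: ae_eq_integral => //.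
  - by apply: measurable_EFin_comp; exact: measurable_Rintegral.
  - exact: (measurable_fubini_F iH).
  - apply: filterS (ae_integrable1 iH) => x ix _.
    by rewrite fineK//; exact: integrable_fin_num ix.
have E2 : (\int[mu]_y (\int[mu]_x H (x, y))%:E = \int[mu]_y \int[mu]_x (H (x, y))%:E)%E.
  apply: ae_eq_integral => //.
  - apply: measurable_EFin_comp; apply: (@measurable_Rintegral _ (fun z => H (z.2, z.1))).
    by apply: (measurableT_comp mH); exact: measurable_fun_pair.
  - exact: (measurable_fubini_G iH).
  - apply: filterS (ae_integrable2 iH) => x ix _.
    by rewrite fineK//; exact: integrable_fin_num ix.
rewrite /Rintegral; congr fine; rewrite [LHS]E1 [RHS]E2.
exact: (Fubini iH).
Qed.

Definition prim f (s : R) : R := \int[mu]_(t in `]-oo, s]) f t.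

Lemma prim_indic f s : prim f s = \int[mu]_t (f t * (t <= s)%R%:R).
Proof.
rewrite /prim Rintegral_mkcond; apply: eq_Rintegral => t _.
rewrite patchE; case: ifPn; rewrite ?inE ?notin_setE/= in_itv/=.
  by move=> ->; rewrite mulr1.
by move=> /negP/negbTE ->; rewrite mulr0.
Qed.

Lemma measurable_prim f : measurable_fun setT f -> measurable_fun setT (prim f).
Proof.
move=> mf; rewrite (_ : prim f = (fun s => \int[mu]_t (f t * (t <= s)%R%:R))); last first.
  by apply/funext => s; exact: prim_indic.
apply: (@measurable_Rintegral _ (fun z => f z.2 * (z.2 <= z.1)%R%:R)).
apply: measurable_funM; first exact: (measurableT_comp mf).
have mle : measurable_fun setT (fun z : R * R => z.2 <= z.1) by exact: measurable_fun_ler.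
by apply: (measurableT_comp (f := fun b : bool => b%:R : R)) mle.
Qed.

Lemma prim_bounded f s : mu.-integrable setT (EFin \o f) ->
  `|prim f s| <= \int[mu]_t `|f t|.
Proof.
move=> intf; have mf := integrable_measurable intf.
have intfD : mu.-integrable `]-oo, s] (EFin \o f) by exact: integrableS intf.
have iabs : mu.-integrable setT (EFin \o (fun x => `|f x|)) by exact: integrable_abse intf.
rewrite (le_trans (le_normr_Rintegral _ _))//.
rewrite Rintegral_mkcond; apply: le_Rintegral => //.
- rewrite -restrict_EFin; apply/(integrable_restrict mu (measurable_itv _) measurableT).
  by rewrite setTI; exact: integrableS iabs.
- by move=> x _; rewrite patchE; case: ifP => _ /=; rewrite ?normr0 ?normr_ge0 ?lexx.
Qed.

Lemma integrable_mul_prim f g : mu.-integrable setT (EFin \o f) ->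
  mu.-integrable setT (EFin \o g) ->
  mu.-integrable setT (EFin \o (fun s => f s * prim g s)).
Proof.
move=> intf intg; have mf := integrable_measurable intf.
have mg := integrable_measurable intg.
pose K := \int[mu]_t `|g t|.
apply: (@le_integrable _ _ _ mu setT measurableT _ (fun s => (K%:E * (f s)%:E)%E)).
- by apply: measurable_EFin_comp; apply: measurable_funM => //; exact: measurable_prim.
- move=> s _; rewrite /= lee_fin !normrM mulrC ler_wpM2r//.
  by rewrite (le_trans (prim_bounded s intg))// ler_norm.
- exact: (@integrableZl _ _ _ mu setT measurableT K (EFin \o f) intf).
Qed.

(* Integration by parts for primitives: split the square into two triangles. *)
Lemma Rintegral_mul_prim f g : mu.-integrable setT (EFin \o f) ->
  mu.-integrable setT (EFin \o g) ->
  (\int[mu]_s f s) * (\int[mu]_s g s) = \int[mu]_s (f s * prim g s + prim f s * g s).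
Proof.
move=> intf intg; have mf := integrable_measurable intf.
have mg := integrable_measurable intg.
pose H (z : R * R) := f z.1 * (g z.2 * (z.1 < z.2)%R%:R).
have mlt : measurable_fun setT (fun z : R * R => (z.1 < z.2)%R%:R : R).
  have mlt : measurable_fun setT (fun z : R * R => z.1 < z.2) by exact: measurable_fun_ltr.
  by apply: (measurableT_comp (f := fun b : bool => b%:R : R)) mlt.
have mH : measurable_fun setT H.
  apply: measurable_funM; first exact: (measurableT_comp mf).
  by apply: measurable_funM => //; exact: (measurableT_comp mg).
pose AH (z : measurableTypeR R * measurableTypeR R) := `|(H z)%:E|%E.
have mAH : measurable_fun setT AH.
  by apply: (measurableT_comp (f := abse)) => //; exact/measurable_EFinP.
have mA (h : R -> R) : measurable_fun setT h -> measurable_fun setT (fun x => `|(h x)%:E|%E).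
  by move=> mh; apply: (measurableT_comp (f := abse)) => //; exact/measurable_EFinP.
have fin_abs (h : R -> R) : mu.-integrable setT (EFin \o h) ->
    (\int[mu]_x `|(h x)%:E| < +oo)%E by case/integrableP.
have iH : (mu \x mu)%E.-integrable setT (EFin \o H).
  apply/integrable12ltyP; first exact: measurable_EFin_comp.
  apply: (@le_lt_trans _ _ (\int[mu]_x (`|(f x)%:E| * (\int[mu]_y `|(g y)%:E|)))%E).
    apply: (@ge0_le_integral _ _ _ mu setT measurableT).
    - by move=> x _; apply: integral_ge0.
    - exact: (@measurable_fun_fubini_tonelli_F _ _ _ _ R mu AH mAH (fun z => abse_ge0 _)).
    - by apply: emeasurable_funM; [exact: mA|exact: measurable_cst].
    - move=> x _; rewrite -ge0_integralZl//; last exact: mA.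
      apply: (@ge0_le_integral _ _ _ mu setT measurableT) => //.
      + by apply: mA; exact: (measurableT_comp mH).
      + by apply: emeasurable_funM; [exact: measurable_cst|exact: mA].
      + move=> y _; rewrite /H /= -EFinM lee_fin !normrM ler_wpM2l//.
        by case: (_ < _); rewrite ?normr1 ?mulr1 ?normr0 ?mulr0.
  rewrite ge0_integralZr//; last 2 first.
  - exact: mA.
  - exact: integral_ge0.
  by rewrite lte_mul_pinfty ?integral_ge0 ?fin_abs// ge0_fin_numE ?integral_ge0 ?fin_abs.
have ig x : mu.-integrable setT (EFin \o (fun y => g y * (x < y)%R%:R)).
  apply: (@le_integrable _ _ _ mu setT measurableT _ (EFin \o g)) => //.
  - apply: measurable_EFin_comp; apply: measurable_funM => //.
    have mlt' : measurable_fun setT (fun y : R => x < y) by exact: measurable_fun_ltr.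
    by apply: (measurableT_comp (f := fun b : bool => b%:R : R)) mlt'.
  - move=> y _; rewrite /= lee_fin normrM.
    by case: (_ < _); rewrite ?normr1 ?mulr1 ?normr0 ?mulr0.
have ig' x : mu.-integrable setT (EFin \o (fun y => g y * (y <= x)%R%:R)).
  apply: (@le_integrable _ _ _ mu setT measurableT _ (EFin \o g)) => //.
  - apply: measurable_EFin_comp; apply: measurable_funM => //.
    have mle : measurable_fun setT (fun y : R => y <= x) by exact: measurable_fun_ler.
    by apply: (measurableT_comp (f := fun b : bool => b%:R : R)) mle.
  - move=> y _; rewrite /= lee_fin normrM.
    by case: (y <= x); rewrite ?normr1 ?mulr1 ?normr0 ?mulr0.
have gE x : \int[mu]_y g y = prim g x + \int[mu]_y (g y * (x < y)%R%:R).
  rewrite prim_indic -RintegralD//; apply: eq_Rintegral => y _.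
  by rewrite -mulrDr; case: leP; rewrite ?addr0 ?add0r mulr1.
have i1 := integrable_mul_prim intf intg.
have i2 := integrable_mul_prim intg intf.
have i2' : mu.-integrable setT (EFin \o (fun s => prim f s * g s)).
  by apply: eq_integrable i2 => // x _; rewrite /= mulrC.
have iF : mu.-integrable setT (EFin \o (fun s => f s * \int[mu]_y (g y * (s < y)%R%:R))).
  have : mu.-integrable setT (EFin \o (fun s => f s * (\int[mu]_y g y) - f s * prim g s)).
    apply: (integrable_EFinB measurableT) i1.
    by apply: eq_integrable (integrable_EFinZ measurableT (\int[mu]_y g y) intf) => // x _; rewrite /= mulrC.
  by apply: eq_integrable => // x _; rewrite /= -mulrBr (gE x) addrAC subrr add0r.
rewrite -RintegralZr//.
under [LHS]eq_Rintegral => s _ do rewrite (gE s) mulrDr.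
rewrite RintegralD// [in RHS]RintegralD//; congr (_ + _).
transitivity (\int[mu]_x \int[mu]_y H (x, y)).
  by apply: eq_Rintegral => x _; rewrite -RintegralZl.
rewrite Rintegral_Fubini//; apply: eq_Rintegral => y _; rewrite /H /=.
have if' : mu.-integrable setT (EFin \o (fun x => f x * (x < y)%R%:R)).
  apply: (@le_integrable _ _ _ mu setT measurableT _ (EFin \o f)) => //.
  - apply: measurable_EFin_comp; apply: measurable_funM => //.
    have mle : measurable_fun setT (fun x : R => x < y) by exact: measurable_fun_ltr.
    by apply: (measurableT_comp (f := fun b : bool => b%:R : R)) mle.
  - move=> x _; rewrite /= lee_fin normrM.
    by case: (_ < _); rewrite ?normr1 ?mulr1 ?normr0 ?mulr0.
transitivity ((\int[mu]_x (f x * (x < y)%R%:R)) * g y).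
  by rewrite -RintegralZr//; apply: eq_Rintegral => x _; ring.
(* The diagonal was put into one of the two triangles only; adding it to the other changes nothing,
   a point being negligible. *)
congr (_ * _); rewrite /prim -Rintegral_itv_bndo_bndc; last exact: integrableS intf.
rewrite [RHS]Rintegral_mkcond; apply: eq_Rintegral => x _.
rewrite patchE; case: ifPn; rewrite ?inE ?notin_setE/= in_itv/=.
  by move=> ->; rewrite mulr1.
by move=> /negP/negbTE ->; rewrite mulr0.
Qed.

End integral_products.

(** * Absolutely continuous functions *)

Section absolutely_continuous.
Context (R : realType).
Local Notation mu := (@lebesgue_measure R).
Implicit Types (F G f g : R -> R) (a b c x y : R).

(** Absolute continuity in the form of the fundamental theorem, with the derivative carried as a
    datum, determined almost everywhere. *)
Definition AC a b F f :=
  mu.-integrable `[a, b] (EFin \o f) /\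
  forall x, a <= x <= b -> F x = F a + \int[mu]_(t in `[a, x]) f t.

Lemma integrable_sub_itv a b c d f : mu.-integrable `[a, b] (EFin \o f) ->
  a <= c -> d <= b -> mu.-integrable `[c, d] (EFin \o f).
Proof.
move=> h ac db; apply: integrableS h => //.
by apply: subset_itvScc; rewrite bnd_simp.
Qed.

Lemma AC_itv a b F f x y : AC a b F f -> a <= x -> x <= y -> y <= b ->
  F y = F x + \int[mu]_(t in `[x, y]) f t.
Proof.
move=> [intf Ff] ax xy yb.
have iay := integrable_sub_itv intf (lexx a) yb.
rewrite (Ff x) ?ax ?(le_trans xy)// (Ff y) ?yb ?(le_trans ax)// -addrA; congr (_ + _).
have := @Rintegral_itvB _ f (BLeft a) (BRight y) x iay.
rewrite !bnd_simp ax xy => /(_ erefl erefl).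
rewrite Rintegral_itv_obnd_cbnd; last first.
  by apply: integrableS iay => //; apply: subset_itvScc; rewrite bnd_simp.
by move=> /eqP; rewrite subr_eq addrC => /eqP.
Qed.

Lemma AC_linear a b c F f G g : AC a b F f -> AC a b G g ->
  AC a b (fun x => c * F x + G x) (fun x => c * f x + g x).
Proof.
move=> [intf Ff] [intg Gg]; split.
  apply: (integrable_EFinD (measurable_itv _)) => //.
  exact: (integrable_EFinZ (measurable_itv _)).
move=> x /[dup] /andP[ax xb] axb; rewrite Ff// Gg//.
have iF := integrable_sub_itv intf (lexx a) xb.
have iG := integrable_sub_itv intg (lexx a) xb.
rewrite RintegralD//; last exact: (integrable_EFinZ (measurable_itv _)).
by rewrite RintegralZl//; ring.
Qed.

Lemma AC_cst a b c : AC a b (fun=> c) (fun=> 0).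
Proof.
split; last by move=> x _; rewrite Rintegral_cst//= mul0r addr0.
apply/integrableP; split; first exact: measurable_cst.
by under eq_integral do rewrite /= normr0; rewrite integral0.
Qed.

Lemma AC_eq a b F f G g : AC a b F f -> (forall x, a <= x <= b -> G x = F x) ->
  (forall x, a <= x <= b -> g x = f x) -> AC a b G g.
Proof.
move=> [intf Ff] GF gf; split.
  apply: eq_integrable intf => // x; rewrite inE/= in_itv/= => axb.
  by rewrite gf.
move=> x axb; have /andP[ax xb] := axb; rewrite !GF ?lexx ?(le_trans ax)// Ff//; congr (_ + _).
apply: eq_Rintegral => t; rewrite inE/= in_itv/= => /andP[at' tx].
by rewrite gf// at' (le_trans tx).
Qed.

Lemma AC_ae a b F f g : AC a b F f -> measurable_fun `[a, b] g ->
  {ae mu, forall x, a <= x <= b -> g x = f x} -> AC a b F g.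
Proof.
move=> [intf Ff] mg gf; have mf := integrable_measurable intf.
have Ig D : measurable D -> D `<=` `[a, b] ->
    (\int[mu]_(x in D) (f x)%:E = \int[mu]_(x in D) (g x)%:E)%E.
  move=> mD Dab; apply: ae_eq_integral => //.
  - by apply: measurable_EFin_comp; exact: measurable_funS mf.
  - by apply: measurable_EFin_comp; exact: measurable_funS mg.
  - by apply: filterS gf => x gfx Dx; rewrite gfx//; have := Dab x Dx; rewrite /= in_itv.
split.
  apply/integrableP; split; first exact/measurable_EFinP.
  have /integrableP[_] := intf; congr (_ < _)%E; apply: ae_eq_integral => //.
  - by apply: (measurableT_comp (f := abse)) => //; exact: measurable_EFin_comp.
  - by apply: (measurableT_comp (f := abse)) => //; exact: measurable_EFin_comp.
  - by apply: filterS gf => x gfx Dx; rewrite /= gfx//; move: Dx; rewrite /= in_itv.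
move=> x /[dup] /andP[ax xb] axb; rewrite Ff// /Rintegral Ig//.
by apply: subset_itvScc; rewrite bnd_simp.
Qed.

Lemma AC_prim a b c f : mu.-integrable `[a, b] (EFin \o f) ->
  AC a b (fun x => c + \int[mu]_(t in `[a, x]) f t) f.
Proof.
move=> intf; split=> // x _.
by rewrite set_itv1 Rintegral_set1 addr0.
Qed.

Lemma AC_continuous a b F f : a <= b -> AC a b F f -> {within `[a, b], continuous F}.
Proof.
move=> ab [intf Ff]; have c := parameterized_integral_continuous ab intf.
have : {within `[a, b], continuous (fun x => F a + \int[mu]_(t in `[a, x]) f t)}.
  by move=> x; apply: cvgD; [exact: cvg_cst|exact: c].
apply: subspace_eq_continuous => x xab /=.
by rewrite [RHS]Ff//; move: xab; rewrite inE/= in_itv.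
Qed.

Lemma AC_C1 a b F : (forall x, derivable F x 1) -> continuous (derive1 F) -> AC a b F (derive1 F).
Proof.
move=> dF cF; have cF' : continuous F.
  by move=> x; apply/differentiable_continuous/derivable1_diffP.
split.
  apply: continuous_compact_integrable; first exact: segment_compact.
  exact: continuous_subspaceT.
move=> x /andP[ax _]; move: ax; rewrite le_eqVlt => /orP[/eqP->|ax].
  by rewrite set_itv1 Rintegral_set1 addr0.
have := @continuous_FTC2 R (derive1 F) F a x ax (continuous_subspaceT cF).
rewrite /Rintegral => -> //=; first by rewrite addrCA subrr addr0.
split.
- by move=> y _.
- exact/cvg_at_right_filter/cF'.
- exact/cvg_at_left_filter/cF'.
Qed.

Let prim_patch a x s g : a <= s <= x -> prim (g \_ `[a, x]) s = \int[mu]_(t in `[a, s]) g t.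
Proof.
move=> /andP[as' sx]; rewrite /prim -Rintegral_mkcondr; congr (Rintegral _ _ _).
apply/seteqP; split=> t /=; rewrite !in_itv/=.
  by move=> [ts /andP[at' _]]; rewrite at'.
by move=> /andP[at' ts]; rewrite at' ts (le_trans ts).
Qed.

(** On [[a, x]] the primitives of [f] and [g], cut to that interval, are [F - F a] and [G - G a];
    [Rintegral_mul_prim] is then integration by parts up to the constants [F a] and [G a]. *)
Lemma AC_mul a b F f G g : AC a b F f -> AC a b G g ->
  AC a b (fun x => F x * G x) (fun x => f x * G x + F x * g x).
Proof.
move=> [intf Ff] [intg Gg].
have patch_int x h : mu.-integrable `[a, b] (EFin \o h) -> x <= b ->
    mu.-integrable setT (EFin \o (h \_ `[a, x])).
  move=> ih xb; rewrite -restrict_EFin.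
  apply/(integrable_restrict mu (measurable_itv _) measurableT); rewrite setTI.
  exact: integrable_sub_itv ih (lexx a) xb.
(* [K] is a constant plus a primitive, and [integrable_mul_prim] handles the product of an
   integrable function with a primitive. *)
have int_mul h H k K : mu.-integrable `[a, b] (EFin \o h) -> mu.-integrable `[a, b] (EFin \o k) ->
    (forall x, a <= x <= b -> K x = K a + \int[mu]_(t in `[a, x]) k t) -> H = K ->
    mu.-integrable `[a, b] (EFin \o (fun x => h x * H x)).
  move=> ih ik Kk ->.
  have i1 : mu.-integrable `[a, b] (EFin \o (fun x => h x * (K x - K a))).
    have i0 := integrable_mul_prim (patch_int b h ih (lexx b)) (patch_int b k ik (lexx b)).
    have {}i0 : mu.-integrable `[a, b]
        (EFin \o (fun s => (h \_ `[a, b]) s * prim (k \_ `[a, b]) s)).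
      exact: integrableS i0.
    apply: eq_integrable i0 => // x /[dup]; rewrite {1}inE/= in_itv/= => axb xab.
    by rewrite /= patchE xab prim_patch// (Kk x axb) addrAC subrr add0r.
  have i2 := integrable_EFinZ (measurable_itv _) (K a) ih.
  apply: eq_integrable (integrable_EFinD (measurable_itv _) i1 i2) => // x _ /=.
  by congr EFin; ring.
have ifG := int_mul f G g G intf intg Gg erefl.
have iFg : mu.-integrable `[a, b] (EFin \o (fun x => F x * g x)).
  apply: eq_integrable (int_mul g F f F intg intf Ff erefl) => // x _ /=.
  by rewrite mulrC.
split; first exact: integrable_EFinD.
move=> x /[dup] /andP[ax xb] axb.
have := Rintegral_mul_prim (patch_int x f intf xb) (patch_int x g intg xb).
rewrite -!Rintegral_mkcond => E.
have Fx : \int[mu]_(t in `[a, x]) f t = F x - F a by rewrite (Ff x)// addrAC subrr add0r.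
have Gx : \int[mu]_(t in `[a, x]) g t = G x - G a by rewrite (Gg x)// addrAC subrr add0r.
have E2 : \int[mu]_s ((f \_ `[a, x]) s * prim (g \_ `[a, x]) s +
    prim (f \_ `[a, x]) s * (g \_ `[a, x]) s) =
    \int[mu]_(s in `[a, x]) ((f s * G s + F s * g s) - (G a * f s + F a * g s)).
  rewrite [RHS]Rintegral_mkcond; apply: eq_Rintegral => s _; rewrite !patchE.
  case: ifPn => sx; last by rewrite mul0r mulr0 addr0.
  have {sx} asx : a <= s <= x by move: sx; rewrite inE/= in_itv.
  have asb : a <= s <= b by case/andP: asx => -> /le_trans ->.
  rewrite !prim_patch// (Ff s asb) (Gg s asb); ring.
have jfG := integrable_sub_itv ifG (lexx a) xb.
have jFg := integrable_sub_itv iFg (lexx a) xb.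
have jf := integrable_sub_itv intf (lexx a) xb.
have jg := integrable_sub_itv intg (lexx a) xb.
have mI := measurable_itv (`[a, x] : interval R).
have E3 : \int[mu]_(s in `[a, x]) (G a * f s + F a * g s) =
    G a * (F x - F a) + F a * (G x - G a).
  by rewrite RintegralD ?RintegralZl ?Fx ?Gx//; exact: integrable_EFinZ.
move: E; rewrite E2 Fx Gx RintegralB//; last 2 first.
- exact: integrable_EFinD.
- by apply: integrable_EFinD => //; exact: integrable_EFinZ.
rewrite E3 => /eqP; rewrite eq_sym subr_eq => /eqP ->.
ring.
Qed.

End absolutely_continuous.

(** * Functions with vanishing weak derivative *)

Section dubois_reymond.
Context (R : realType).
Local Notation mu := (@lebesgue_measure R).
Implicit Types (f g h phi eta : R -> R) (s t x : R).

Lemma integrable_compact_support phi s t : continuous phi ->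
  (forall x, ~ (s <= x <= t) -> phi x = 0) -> mu.-integrable setT (EFin \o phi).
Proof.
move=> cphi phi0.
have -> : phi = phi \_ `[s, t].
  apply/funext => x; rewrite patchE; case: ifPn => //.
  by rewrite notin_setE /= in_itv /= => /phi0.
rewrite -restrict_EFin; apply/(integrable_restrict mu (measurable_itv _) measurableT).
rewrite setTI; apply: continuous_compact_integrable; first exact: segment_compact.
exact: continuous_subspaceT.
Qed.

(** The mean value 0 makes the primitive vanish to the right of the support as well. *)
Lemma test_function_prim (D : set R) phi s t : continuous phi ->
  (forall x, ~ (s <= x <= t) -> phi x = 0) -> `[s, t] `<=` D ->
  \int[mu]_x phi x = 0 ->
  test_function D (prim phi) /\ forall x, derive1 (prim phi) x = phi x.
Proof.
move=> cphi phi0 stD int0.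
have intphi := integrable_compact_support cphi phi0.
have dphi x : derivable (prim phi) x 1 /\ derive1 (prim phi) x = phi x.
  apply: (@continuous_FTC1 R phi -oo%O x (x + 1)); [by rewrite ltrDl| |by rewrite ltNyr|exact: cphi].
  exact: integrableS intphi.
split; last by move=> x; have [] := dphi x.
split.
- by move=> x; have [] := dphi x.
- suff -> : derive1 (prim phi) = phi by [].
  by apply/funext => x; have [] := dphi x.
- exists `[s, t]%classic; split => //; first exact: segment_compact.
  move=> x /=; rewrite in_itv/= => nx; rewrite prim_indic.
  have [xs|sx] := ltP x s.
    transitivity (\int[mu]_(y in setT) (0 : R)); last by rewrite Rintegral_cst//= mul0r.
    apply: eq_Rintegral => y _; case: leP => yx; rewrite ?mulr0// mulr1 phi0//.
    by move=> /andP[/le_lt_trans/(_ (le_lt_trans yx xs))]; rewrite ltxx.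
  rewrite -int0; apply: eq_Rintegral => y _; case: leP => xy; rewrite ?mulr1// mulr0 phi0//.
  by move=> /andP[_ yt]; apply: nx; rewrite sx (le_trans (ltW xy)).
Qed.

(** A trapezoid of height at most 1 on [[s, t]] with sides of slope [n], a continuous approximation
    of the indicator of []s, t[]. *)
Definition trap s t (n : nat) x : R :=
  Num.max 0 (Num.min 1 (Num.min (n%:R * (x - s)) (n%:R * (t - x)))).

Lemma trap_continuous s t n : continuous (trap s t n).
Proof.
move=> x; pose l (y : R) : R^o := n%:R * (y - s); pose k (y : R) : R^o := n%:R * (t - y).
have cl : {for x, continuous l}.
  by apply: cvgM; [exact: cvg_cst|apply: cvgB; [exact: cvg_id|exact: cvg_cst]].
have ck : {for x, continuous k}.
  by apply: cvgM; [exact: cvg_cst|apply: cvgB; [exact: cvg_cst|exact: cvg_id]].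
have c0 (a : R^o) : {for x, continuous (cst a : R -> R^o)} by exact: cst_continuous.
exact: (continuous_max (c0 0) (continuous_min (c0 1) (continuous_min cl ck))).
Qed.

Lemma trap_out s t n x : ~ (s <= x <= t) -> trap s t n x = 0.
Proof.
move=> nx; apply/max_idPl; rewrite !ge_min.
have [xs|sx] := ltP x s.
  have h : n%:R * (x - s) <= 0 by rewrite mulr_ge0_le0// subr_le0 ltW.
  by rewrite h /= orbT.
have [tx|xt] := ltP t x.
  have h : n%:R * (t - x) <= 0 by rewrite mulr_ge0_le0// subr_le0 ltW.
  by rewrite h !orbT.
by exfalso; apply: nx; rewrite sx xt.
Qed.

Lemma trap_bounded s t n x : 0 <= trap s t n x <= 1.
Proof. by rewrite /trap le_max lexx ge_max ler01 ge_min lexx. Qed.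

Lemma trap_cvg s t x : s < x < t -> trap s t n x @[n --> \oo] --> (1 : R).
Proof.
move=> /andP[sx xt]; apply: cvg_near_cst; near=> n.
have h1 : 1 <= n%:R * (x - s).
  by rewrite -ler_pdivrMr ?subr_gt0// mul1r; near: n; exact: nbhs_infty_ger.
have h2 : 1 <= n%:R * (t - x).
  by rewrite -ler_pdivrMr ?subr_gt0// mul1r; near: n; exact: nbhs_infty_ger.
rewrite /trap; have -> : Num.min 1 (Num.min (n%:R * (x - s)) (n%:R * (t - x))) = 1.
  by apply/min_idPl; rewrite le_min h1 h2.
by apply/max_idPr.
Unshelve. all: by end_near. Qed.

Lemma trap_Rintegral_cvg s t h : mu.-integrable `[s, t] (EFin \o h) ->
  \int[mu]_x ((h \_ `[s, t]) x * trap s t n x) @[n --> \oo] --> \int[mu]_(x in `[s, t]) h x.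
Proof.
move=> ih; rewrite Rintegral_mkcond; set H := h \_ `[s, t].
have iH : mu.-integrable setT (EFin \o H).
  rewrite -restrict_EFin; apply/(integrable_restrict mu (measurable_itv _) measurableT).
  by rewrite setTI.
have mH := integrable_measurable iH.
have mtrap n : measurable_fun setT (trap s t n).
  by apply: continuous_measurable_fun; exact: trap_continuous.
have [] := @dominated_convergence _ _ _ mu setT measurableT
  (fun n x => (H x * trap s t n x)%:E) (EFin \o H) (fun x => `|(H x)%:E|%E).
- by move=> n; apply: measurable_EFin_comp; apply: measurable_funM => //; exact: mtrap.
- exact: measurable_EFin_comp.
- have hs : {ae mu, forall x, x != s}.
    exists [set s]; split; [exact: measurable_set1|exact: lebesgue_measure_set1|].
    by move=> x /= /negP; rewrite negbK => /eqP.
  have ht : {ae mu, forall x, x != t}.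
    exists [set t]; split; [exact: measurable_set1|exact: lebesgue_measure_set1|].
    by move=> x /= /negP; rewrite negbK => /eqP.
  apply: filterS2 hs ht => x xs xt _; rewrite /H /= patchE.
  case: ifPn => [|_]; last by apply: cvg_near_cst; apply: nearW => n; rewrite mul0r.
  rewrite inE/= in_itv/= => /andP[sx tx]; apply: cvg_EFin; first by apply: nearW.
  rewrite /= -[X in _ --> X]mulr1; apply: cvgM; first exact: cvg_cst.
  by apply: trap_cvg; rewrite !lt_neqAle sx tx xt eq_sym xs.
- exact: integrable_abse.
- apply: aeW => x n _ /=; rewrite lee_fin normrM ler_piMr//.
  by have /andP[? ?] := trap_bounded s t n x; rewrite ger0_norm.
by move=> _ _; rewrite -(fineK (integrable_fin_num measurableT iH)) => /fine_cvgP[_].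
Qed.

(* du Bois-Reymond: testing against a primitive of the difference of two
   trapezoids of equal mass shows that the means of h over subintervals agree. *)
Lemma weak_derivative0_cst (b : itv_bound R) h : measurable_fun setT h ->
  (forall t, (BRight t < b)%O -> mu.-integrable `[0, t] (EFin \o h)) ->
  (forall eta, test_function [set` Interval (BRight 0) b] eta ->
     \int[mu]_(x in [set` Interval (BRight 0) b]) (h x * derive1 eta x) = 0) ->
  exists c, {ae mu, forall x, 0 < x -> (BRight x < b)%O -> h x = c}.
Proof.
move=> mh ih h0; set D := [set` _] in h0.
have [[t0 [t0_gt0 t0b]]|nD] := pselect (exists t0, 0 < t0 /\ (BRight t0 < b)%O); last first.
  by exists 0; apply: aeW => x x0 xb; exfalso; apply: nD; exists x.
(* [[s0, t0]] is the reference interval with which all others are compared; the constant will be the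
   mean of [h] over it. *)
pose s0 := t0 / 2.
have s0_gt0 : 0 < s0 by rewrite divr_gt0.
have s0t0 : s0 < t0 by rewrite /s0 ltr_pdivrMr// mulr2n mulrDr mulr1 ltrDr.
have stD s t : 0 < s -> (BRight t < b)%O -> `[s, t] `<=` D.
  by move=> s_gt0 tb; rewrite /D; apply: subset_itv; [rewrite bnd_simp|exact: ltW].
have ist s t : 0 < s -> (BRight t < b)%O -> mu.-integrable `[s, t] (EFin \o h).
  move=> s_gt0 tb; apply: integrableS (ih t tb) => //.
  by apply: subset_itvr; rewrite bnd_simp ltW.
have intD s t n : 0 < s -> (BRight t < b)%O ->
    \int[mu]_(x in D) (h x * trap s t n x) = \int[mu]_x ((h \_ `[s, t]) x * trap s t n x).
  move=> s_gt0 tb; rewrite Rintegral_mkcond; apply: eq_Rintegral => x _; rewrite !patchE.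
  case: ifPn => [_|xD]; case: ifPn => //.
  - by rewrite notin_setE/= in_itv/= => /trap_out ->; rewrite !mulr0.
  - by rewrite inE => /(stD s t s_gt0 tb) xD'; move: xD; rewrite notin_setE.
  - by rewrite mul0r.
have mD : measurable (D : set (measurableTypeR R)) by exact: measurable_itv.
pose T s t n := \int[mu]_x trap s t n x.
pose I s t n := \int[mu]_x ((h \_ `[s, t]) x * trap s t n x).
have itrap s t n : mu.-integrable setT (EFin \o trap s t n).
  by apply: (@integrable_compact_support _ s t); [exact: trap_continuous|move=> x; exact: trap_out].
have ihtrap s t n : 0 < s -> (BRight t < b)%O ->
    mu.-integrable D (EFin \o (fun x => h x * trap s t n x)).
  move=> s_gt0 tb; apply: (@integrableS _ _ _ mu setT) => //.
  have ip : mu.-integrable setT (EFin \o (fun x => (h \_ `[s, t]) x * trap s t n x)).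
    apply: (@integrable_EFinM _ _ measurableT 1).
    - rewrite -restrict_EFin; apply/(integrable_restrict mu (measurable_itv _) measurableT).
      by rewrite setTI; exact: ist.
    - by apply: continuous_measurable_fun; exact: trap_continuous.
    - by move=> x _; have /andP[? ?] := trap_bounded s t n x; rewrite ger0_norm.
  apply: eq_integrable ip => // x _; rewrite /= patchE; case: ifPn => //.
  by rewrite notin_setE/= in_itv/= => /trap_out ->; rewrite !mulr0.
have key s t n : 0 < s -> s < t -> (BRight t < b)%O -> T s0 t0 n * I s t n = T s t n * I s0 t0 n.
  move=> s_gt0 st tb.
  pose phi x := T s0 t0 n * trap s t n x - T s t n * trap s0 t0 n x.
  have cphi : continuous phi.
    by move=> x; apply: cvgB; (apply: cvgM; [exact: cvg_cst|exact: trap_continuous]).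
  have phi0 x : ~ (Num.min s s0 <= x <= Num.max t t0) -> phi x = 0.
    move=> nx; rewrite /phi !trap_out ?mulr0 ?subr0//.
      by move=> /andP[a1 a2]; apply: nx; rewrite ge_min le_max a1 a2 !orbT.
    by move=> /andP[a1 a2]; apply: nx; rewrite ge_min le_max a1 a2.
  have int0 : \int[mu]_x phi x = 0.
    rewrite RintegralB//; [|exact: integrable_EFinZ..].
    by rewrite !RintegralZl// -/(T s t n) -/(T s0 t0 n) mulrC subrr.
  have msD : `[Num.min s s0, Num.max t t0] `<=` D.
    apply: stD; first by rewrite lt_min s_gt0.
    by rewrite /Num.max; case: ifP.
  have [tphi dphi] := test_function_prim cphi phi0 msD int0.
  have := h0 _ tphi.
  rewrite (_ : Rintegral _ _ _ = \int[mu]_(x in D) (T s0 t0 n * (h x * trap s t n x) -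
     T s t n * (h x * trap s0 t0 n x))); last first.
    by apply: eq_Rintegral => x _; rewrite dphi /phi; ring.
  rewrite RintegralB//; last 2 first.
  - by apply: (integrable_EFinZ mD); exact: ihtrap.
  - by apply: (integrable_EFinZ mD); exact: ihtrap.
  rewrite !RintegralZl//; last 2 first.
  - exact: ihtrap.
  - exact: ihtrap.
  by rewrite !intD// => /eqP; rewrite subr_eq0 => /eqP.
have T_cvg s t : 0 < s -> s < t -> T s t n @[n --> \oo] --> t - s.
  move=> s_gt0 st.
  have i1 : mu.-integrable `[s, t] (EFin \o (fun=> 1 : R)).
    apply: continuous_compact_integrable; first exact: segment_compact.
    by apply: continuous_subspaceT => x; exact: cvg_cst.
  have := trap_Rintegral_cvg i1.
  rewrite Rintegral_cst// mul1r.
  rewrite (_ : fine _ = t - s); last first.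
    by have := @lebesgue_measure_itv R `[s, t]; rewrite /= lte_fin st => ->.
  rewrite (_ : (fun n => _) = T s t)//; apply/funext => n; apply: eq_Rintegral => x _.
  rewrite patchE; case: ifPn; first by rewrite mul1r.
  by rewrite notin_setE/= in_itv/= => /trap_out ->; rewrite mul0r.
pose c := \int[mu]_(x in `[s0, t0]) h x / (t0 - s0).
have mean s t : 0 < s -> s < t -> (BRight t < b)%O -> \int[mu]_(x in `[s, t]) h x = c * (t - s).
  move=> s_gt0 st tb.
  have c1 : T s0 t0 n * I s t n @[n --> \oo] --> (t0 - s0) * \int[mu]_(x in `[s, t]) h x.
    by apply: cvgM; [exact: T_cvg|apply: trap_Rintegral_cvg; exact: ist].
  have c2 : T s0 t0 n * I s t n @[n --> \oo] --> (t - s) * \int[mu]_(x in `[s0, t0]) h x.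
    rewrite (_ : (fun n => _) = (fun n => T s t n * I s0 t0 n)); last first.
      by apply/funext => n; exact: key.
    by apply: cvgM; [exact: T_cvg|apply: trap_Rintegral_cvg; exact: ist].
  have E := etrans (esym (cvg_lim (@Rhausdorff R) c1)) (cvg_lim (@Rhausdorff R) c2).
  have t0s0 : t0 - s0 != 0 by rewrite subr_eq0 gt_eqF.
  by apply: (mulfI t0s0); rewrite E /c; field.
exists c.
(* As [h] has mean [c] on all subintervals, the primitive of [h - c] vanishes on [[s, t]]; Lebesgue
   differentiation gives [h = c] almost everywhere there. *)
have local_eq s t : 0 < s -> s < t -> (BRight t < b)%O ->
    {ae mu, forall x, s < x < t -> h x = c}.
  move=> s_gt0 st tb; pose k := (fun x => h x - c) \_ `[s, t].
  have icst : mu.-integrable `[s, t] (EFin \o (fun=> c)).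
    apply: continuous_compact_integrable; first exact: segment_compact.
    by apply: continuous_subspaceT => x; exact: cvg_cst.
  have ik : mu.-integrable setT (EFin \o k).
    rewrite -restrict_EFin; apply/(integrable_restrict mu (measurable_itv _) measurableT).
    by rewrite setTI; apply: (integrable_EFinB (measurable_itv _)) => //; exact: ist.
  have : {ae mu, forall x, derivable (prim k) x 1 /\ derive1 (prim k) x = k x}.
    apply: FTC1Ny; first by move=> y; exact: integrableS ik.
    by apply: open_integrable_locally => //; exact: openT.
  apply: filterS => x [_ dk] /andP[sx xt].
  suff : derive1 (prim k) x = 0.
    rewrite dk /k patchE mem_set/=; last by rewrite in_itv/= !ltW.
    by move=> /eqP; rewrite subr_eq0 => /eqP.
  rewrite derive1E (@near_eq_derive _ _ _ (prim k) (cst 0)); first by rewrite derive_cst.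
  near=> y; have sy : s < y by near: y; exact: lt_nbhsr.
  have yt : y < t by near: y; exact: lt_nbhsl.
  rewrite /prim /k -Rintegral_mkcondr.
  have -> : `]-oo, y]%classic `&` `[s, t] = `[s, y]%classic.
    apply/seteqP; split=> z /=; rewrite !in_itv/=.
      by move=> [zy /andP[sz _]]; rewrite sz.
    by move=> /andP[sz zy]; rewrite sz zy (le_trans zy (ltW yt)).
  have sub : `[s, y] `<=` `[s, t].
    by apply: subset_itvl; rewrite bnd_simp ltW.
  rewrite RintegralB//; last 2 first.
  - by apply: integrableS (ist s t _ _) => //.
  - exact: integrableS icst.
  rewrite mean//; last by rewrite (le_lt_trans _ tb)// bnd_simp ltW.
  rewrite Rintegral_cst//; have := @lebesgue_measure_itv R `[s, y].
  by rewrite /= lte_fin sy => ->; rewrite subrr.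
(* Right endpoints exhausting the interval, for finite and infinite [b] alike; the left endpoints
   are [1 / (n + 1)]. *)
pose t_ (n : nat) := if b is BSide _ B then B - n.+1%:R^-1 else n.+1%:R.
have tb n : (BRight (t_ n) < b)%O.
  rewrite /t_; case: (b) t0b => [bb B|bb] t0b; last by case: bb t0b.
  by rewrite bnd_simp; case: bb t0b; rewrite !bnd_simp => _; rewrite ?lteif_lt ltrBlDr ltrDl invr_gt0.
have t_cvg x : (BRight x < b)%O -> exists n, x < t_ n.
  rewrite /t_; case: (b) => [bb B|bb] xb; last first.
    by exists (Num.truncn x); exact: truncnS_gt.
  have xB : x < B by case: bb xb; rewrite bnd_simp.
  have [n] := ltr_add_invr xB.
  by rewrite -ltrBrDr => ?; exists n.
have all n k : {ae mu, forall x, n.+1%:R^-1 < x < t_ k -> h x = c}.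
  have [nk|kn] := ltP n.+1%:R^-1 (t_ k); first by apply: local_eq; rewrite ?invr_gt0.
  by apply: aeW => x /andP[nx xk]; have := lt_le_trans (lt_trans nx xk) kn; rewrite ltxx.
have all' := ae_foralln (fun n => ae_foralln (all n)).
apply: filterS all' => x hx x0 xb.
have [k xk] := t_cvg x xb.
have [n] := ltr_add_invr x0; rewrite add0r => nx.
by apply: (hx n k); rewrite nx.
Unshelve. all: by end_near. Qed.

End dubois_reymond.

(** * Weak derivatives and absolutely continuous representatives *)

Section weak_derivatives.
Context (R : realType).
Local Notation mu := (@lebesgue_measure R).
Implicit Types (f g F tau u : R -> R) (T x : R) (D : set (measurableTypeR R)).

Lemma continuous_bounded_itv u T : continuous u ->
  exists K, forall x, `[0, T]%classic x -> `|u x| <= K.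
Proof.
move=> cu; have : compact (u @` `[0, T]).
  apply: continuous_compact; last exact: segment_compact.
  exact: continuous_subspaceT.
move=> /compact_bounded[K [_ hK]]; exists (K + 1) => x xT.
by apply: (hK (K + 1)); [rewrite ltrDl|exists x].
Qed.

(* T bounds the support of the test function tau within D. *)
Definition test_bound D tau T :=
  [/\ 0 < T, forall x, D x -> 0 < x, forall x, 0 < x < T -> D x,
      forall x, D x -> T <= x -> tau x = 0 /\ derive1 tau x = 0 &
      tau 0 = 0 /\ tau T = 0].

Lemma test_bound01 tau : test_function `]0, 1[ tau -> test_bound `]0, 1[ tau 1.
Proof.
move=> [_ _ [K [_ KD tau0]]]; split.
- by [].
- by move=> x /=; rewrite in_itv/= => /andP[].
- by move=> x x01 /=; rewrite in_itv.
- by move=> x /=; rewrite in_itv/= => /andP[_ /lt_le_trans h] /h; rewrite ltxx.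
- by split; apply: tau0 => /KD /=; rewrite in_itv/= ltxx ?andbF.
Qed.

Lemma test_bound0y tau : test_function `]0, +oo[ tau ->
  exists T, test_bound `]0, +oo[ tau T.
Proof.
move=> [_ _ [K [cK KD tau0]]]; have [M [_ hM]] := compact_bounded cK.
pose N := Num.max 0 M + 1.
have N0 : 0 < N by rewrite ltr_wpDl// le_max lexx.
have KN x : K x -> x <= N.
  move=> Kx; apply: le_trans (ler_norm _) _; apply: hM Kx.
  by rewrite (@le_lt_trans _ _ (Num.max 0 M)) ?le_max ?lexx ?orbT// ltrDl.
have tauN x : N < x -> tau x = 0.
  by move=> Nx; apply: tau0 => /KN; rewrite leNgt Nx.
(* One unit beyond a bound of the support: near any [x >= N + 1] the function is zero, hence so is
   its derivative. *)
exists (N + 1); split.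
- by rewrite addr_gt0.
- by move=> x /=; rewrite in_itv/= andbT.
- by move=> x /andP[x0 _] /=; rewrite in_itv/= x0.
- move=> x _ Nx; have Nx' : N < x by rewrite (lt_le_trans _ Nx)// ltrDl.
  split; first exact: tauN.
  rewrite derive1E (@near_eq_derive _ _ _ tau (cst 0)); first by rewrite derive_cst.
  near=> y; apply: tauN; near: y; exact: lt_nbhsr.
- split; last by apply: tauN; rewrite ltrDl.
  by apply: tau0 => /KD /=; rewrite in_itv/= ltxx.
Unshelve. all: by end_near. Qed.

(** Reduces integrals over [D] to the compact interval [[0, T]], so that the bounded and the
    unbounded domain are treated at once. *)
Lemma test_integral D tau T f u : measurable D -> test_bound D tau T ->
  (forall x, D x -> T <= x -> u x = 0) -> continuous u ->
  mu.-integrable `[0, T] (EFin \o f) ->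
  [/\ mu.-integrable `[0, T] (EFin \o (fun x => f x * u x)),
      mu.-integrable D (EFin \o (fun x => f x * u x)) &
      \int[mu]_(x in D) (f x * u x) = \int[mu]_(x in `[0, T]) (f x * u x)].
Proof.
move=> mD [T0 D0 DT _ _] uT cu intf.
have [K uK] := continuous_bounded_itv T cu.
have i1 : mu.-integrable `[0, T] (EFin \o (fun x => f x * u x)).
  apply: (@integrable_EFinM _ _ (measurable_itv _) K) => //.
  by apply: measurable_funTS; exact: continuous_measurable_fun.
have E : (fun x => f x * u x) \_ D = (fun x => f x * u x) \_ `]0, T[.
  apply/funext => x; rewrite !patchE; case: ifPn; case: ifPn => //.
    rewrite notin_setE inE/= in_itv/= => xT Dx.
    rewrite uT ?mulr0// leNgt; apply/negP => xT'; apply: xT.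
    by rewrite D0.
  by rewrite inE notin_setE/= in_itv/= => /DT.
have i2 : mu.-integrable `]0, T[ (EFin \o (fun x => f x * u x)).
  by apply: integrableS i1 => //; exact: subset_itv_oo_cc.
have i3 : mu.-integrable setT (EFin \o ((fun x => f x * u x) \_ D)).
  rewrite E -restrict_EFin; apply/(integrable_restrict mu (measurable_itv _) measurableT).
  by rewrite setTI.
split => //.
- have := i3; rewrite -restrict_EFin => /(integrable_restrict mu mD measurableT).
  by rewrite setTI.
- rewrite Rintegral_mkcond E -Rintegral_mkcond.
  rewrite Rintegral_itv_bndo_bndc// Rintegral_itv_obnd_cbnd//.
  by apply: integrableS i1 => //; exact: subset_itv_oc_cc.
Qed.

(** The product of [F] with a test function is absolutely continuous and zero at 0 and [T], so the
    integral of its derivative is 0. *)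
Lemma AC_weak D f F g : measurable D -> measurable_fun setT f ->
  (forall tau, test_function D tau -> exists2 T, test_bound D tau T & AC 0 T F g) ->
  (forall x, D x -> 0 < x) ->
  {ae mu, forall x, D x -> f x = F x} -> weak_derivative D f g.
Proof.
move=> mD mf AF D0 fF tau ttau; have [T tb AF'] := AF tau ttau.
have [dtau ctau' _] := ttau; have [T0 _ DT tauT [tau0 tauT']] := tb.
have ctau : continuous tau.
  by move=> x; apply/differentiable_continuous/derivable1_diffP.
have ACtau := AC_C1 0 T dtau ctau'.
have [AM1 AM2] := AC_mul AF' ACtau.
have intg := AF'.1.
have cF := AC_continuous (ltW T0) AF'.
have intF : mu.-integrable `[0, T] (EFin \o F).
  by apply: continuous_compact_integrable => //; exact: segment_compact.
have uT x (Dx : D x) (Tx : T <= x) := (tauT x Dx Tx).1.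
have uT' x (Dx : D x) (Tx : T <= x) := (tauT x Dx Tx).2.
have [g1 g2 g3] := test_integral mD tb uT ctau intg.
have [F1 F2 F3] := test_integral mD tb uT' ctau' intF.
have -> : \int[mu]_(x in D) (f x * derive1 tau x) = \int[mu]_(x in D) (F x * derive1 tau x).
  congr fine; apply: ae_eq_integral => //.
  - apply: measurable_EFin_comp; apply: measurable_funM; first exact: measurable_funTS.
    by apply: measurable_funTS; exact: continuous_measurable_fun.
  - exact: (measurable_int mu F2).
  - by apply: filterS fF => x fx Dx; rewrite fx.
rewrite F3 g3; have := AM2 T; rewrite ltW// lexx => /(_ erefl).
rewrite tau0 tauT' !mulr0 add0r RintegralD// => /esym/eqP.
by rewrite addrC addr_eq0 => /eqP.
Qed.

Lemma AC_weak01 f F g : measurable_fun setT f -> AC 0 1 F g ->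
  {ae mu, forall x, 0 < x < 1 -> f x = F x} -> weak_derivative `]0, 1[ f g.
Proof.
move=> mf AF fF; apply: (AC_weak (F := F)) => //.
- by move=> tau /test_bound01 tb; exists 1.
- by move=> x /=; rewrite in_itv/= => /andP[].
Qed.

Lemma AC_weak0y f F g : measurable_fun setT f -> (forall T, 0 < T -> AC 0 T F g) ->
  {ae mu, forall x, 0 < x -> f x = F x} -> weak_derivative `]0, +oo[ f g.
Proof.
move=> mf AF fF; apply: (AC_weak (F := F)) => //.
- move=> tau /test_bound0y [T tb]; exists T => //; apply: AF.
  by case: tb.
- by move=> x /=; rewrite in_itv/= andbT.
- by apply: filterS fF => x + Dx; apply; move: Dx; rewrite /= in_itv/= andbT.
Qed.

Lemma measurable_primitive g : measurable_fun setT g ->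
  measurable_fun setT (fun x => \int[mu]_(t in `[0, x]) g t).
Proof.
move=> mg; rewrite (_ : (fun x => _) = (fun x => \int[mu]_t (g t * (0 <= t <= x)%R%:R))); last first.
  apply/funext => x; rewrite Rintegral_mkcond; apply: eq_Rintegral => t _.
  rewrite patchE; case: ifPn; rewrite ?inE ?notin_setE/= in_itv/=.
    by move=> ->; rewrite mulr1.
  by move=> /negP/negbTE ->; rewrite mulr0.
apply: (@measurable_Rintegral _ (fun z => g z.2 * (0 <= z.2 <= z.1)%R%:R)).
apply: measurable_funM; first exact: (measurableT_comp mg).
have mle : measurable_fun setT (fun z : R * R => 0 <= z.2 <= z.1).
  by apply: measurable_and; exact: measurable_fun_ler.
by apply: (measurableT_comp (f := fun b : bool => b%:R : R)) mle.
Qed.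

(** The primitive of [g] also has weak derivative [g], so its difference with [f] is constant by du
    Bois-Reymond. The bound [b] stands for 1 or [+oo]. *)
Lemma weak_AC (b : itv_bound R) f g : measurable_fun setT f -> measurable_fun setT g ->
  (forall t, (BRight t < b)%O -> mu.-integrable `[0, t] (EFin \o f)) ->
  (forall tau, test_function [set` Interval (BRight 0) b] tau -> exists2 T,
     test_bound [set` Interval (BRight 0) b] tau T & mu.-integrable `[0, T] (EFin \o f)) ->
  (forall t, (BRight t < b)%O -> mu.-integrable `[0, t] (EFin \o g)) ->
  (forall tau, test_function [set` Interval (BRight 0) b] tau -> exists2 T,
     test_bound [set` Interval (BRight 0) b] tau T & mu.-integrable `[0, T] (EFin \o g)) ->
  weak_derivative [set` Interval (BRight 0) b] f g ->
  exists c, {ae mu, forall x, 0 < x -> (BRight x < b)%O ->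
    f x = c + \int[mu]_(t in `[0, x]) g t}.
Proof.
move=> mf mg itf tbf itg tbg wfg.
pose F x := \int[mu]_(t in `[0, x]) g t.
have mF : measurable_fun setT F by exact: measurable_primitive.
set D := [set` _] in tbf tbg wfg.
have mD : measurable (D : set (measurableTypeR R)) by exact: measurable_itv.
have D0 x : D x -> 0 < x by rewrite /D/= itv_boundlr bnd_simp => /andP[].
have ACF t : mu.-integrable `[0, t] (EFin \o g) -> AC 0 t F g.
  by move=> ig; apply: (AC_eq (AC_prim 0 ig)) => x _ //; rewrite add0r.
have intF t : mu.-integrable `[0, t] (EFin \o g) -> mu.-integrable `[0, t] (EFin \o F).
  move=> ig; have [t0|t0] := leP 0 t; last first.
    rewrite (_ : `[0, t]%classic = set0); first exact: integrable_set0.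
    apply/seteqP; split=> z //=; rewrite in_itv/= => /andP[z0 /le_lt_trans/(_ t0)].
    by rewrite ltNge z0.
  apply: continuous_compact_integrable; first exact: segment_compact.
  by apply: AC_continuous => //; exact: ACF.
have wF : weak_derivative D F g.
  apply: (AC_weak (F := F)) => //.
  - by move=> tau /tbg[T tb ig]; exists T => //; exact: ACF.
  - exact: aeW.
have [c hc] : exists c, {ae mu, forall x, 0 < x -> (BRight x < b)%O -> f x - F x = c}.
  apply: weak_derivative0_cst; first exact: measurable_funB.
    by move=> t tb; apply: (integrable_EFinB (measurable_itv _)); [exact: itf|exact/intF/itg].
  move=> tau ttau; have [T tb ifT] := tbf tau ttau; have [T' tb' igT] := tbg tau ttau.
  have [_ ctau' _] := ttau.
  have uT x (Dx : D x) (Tx : T <= x) : derive1 tau x = 0 by case: tb => _ _ _ /(_ x Dx Tx)[].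
  have uT' x (Dx : D x) (Tx : T' <= x) : derive1 tau x = 0 by case: tb' => _ _ _ /(_ x Dx Tx)[].
  have [_ f2 _] := test_integral mD tb uT ctau' ifT.
  have [_ F2 _] := test_integral mD tb' uT' ctau' (intF _ igT).
  under eq_Rintegral do rewrite mulrBl.
  by rewrite RintegralB// wfg// wF// subrr.
exists c; apply: filterS hc => x hx x0 xb; apply/eqP; rewrite -subr_eq; apply/eqP.
exact: hx.
Qed.

End weak_derivatives.

(** * Substitution, gluing and one-sided limits *)

Section affine_integrals.
Context (R : realType).
Local Notation mu := (@lebesgue_measure R).
Implicit Types (F f : R -> R) (a b c x : R) (D : set (measurableTypeR R)).

Lemma measurable_aff_preimage s c D : measurable D ->
  measurable (aff s c @^-1` D : set (measurableTypeR R)).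
Proof. by move=> mD; rewrite -[X in measurable X]setTI; exact: measurable_aff. Qed.

Lemma integrable_restrictT D f : measurable D -> mu.-integrable D (EFin \o f) <->
  mu.-integrable setT (EFin \o (f \_ D)).
Proof.
move=> mD; rewrite -restrict_EFin.
by split=> [h|/(integrable_restrict mu mD measurableT)]; rewrite ?setTI//;
  apply/(integrable_restrict mu mD measurableT); rewrite setTI.
Qed.

Lemma integrable_aff_preimage s c D f : measurable D -> mu.-integrable D (EFin \o f) ->
  mu.-integrable (aff s c @^-1` D) (EFin \o (f \o aff s c)).
Proof.
move=> mD /(integrable_restrictT f mD)/(integrable_aff s c) h.
apply/integrable_restrictT; first exact: measurable_aff_preimage.
exact: eq_integrable h.
Qed.

Lemma Rintegral_aff_preimage s c D f : measurable D -> mu.-integrable D (EFin \o f) ->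
  \int[mu]_(x in aff s c @^-1` D) f (aff s c x) = \int[mu]_(x in D) f x.
Proof.
move=> mD /(integrable_restrictT f mD) h.
rewrite [RHS]Rintegral_mkcond [LHS]Rintegral_mkcond /Rintegral.
by rewrite -(integral_aff s c h).
Qed.

Lemma AC_shift a b F f c : AC a b F f ->
  AC (a - c) (b - c) (fun x => F (x + c)) (fun x => f (x + c)).
Proof.
move=> [intf Ff].
have pre y : aff false c @^-1` `[a, y] = `[a - c, y - c]%classic.
  by apply/seteqP; split=> x /=; rewrite affE !in_itv/= lerBlDr lerBrDr.
split.
  have := integrable_aff_preimage false c (measurable_itv _) intf; rewrite pre.
  by apply: eq_integrable => // x _ /=; rewrite affE.
move=> x /andP[ax xb]; have xab : a <= x + c <= b by rewrite -lerBlDr ax -lerBrDr.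
have /andP[_ xcb] := xab.
rewrite Ff// subrK; congr (_ + _).
rewrite -(Rintegral_aff_preimage false c (measurable_itv _)); last first.
  exact: integrable_sub_itv intf (lexx a) _.
by rewrite pre addrK; apply: eq_Rintegral => t _; rewrite affE.
Qed.

Lemma AC_reflect a b F f : a <= b -> AC a b F f ->
  AC (- b) (- a) (fun x => F (- x)) (fun x => - f (- x)).
Proof.
move=> ab AF; have [intf Ff] := AF.
have pre x y : aff true 0 @^-1` `[x, y] = `[- y, - x]%classic.
  by apply/seteqP; split=> z /=; rewrite affE !in_itv/= sub0r lerNr lerNl andbC.
have i1 : mu.-integrable `[- b, - a] (EFin \o (fun x => f (- x))).
  have := integrable_aff_preimage true 0 (measurable_itv _) intf; rewrite pre.
  by apply: eq_integrable => // x _ /=; rewrite affE sub0r.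
split.
  have := integrable_EFinZ (measurable_itv _) (-1) i1.
  by apply: eq_integrable => // x _ /=; rewrite mulN1r.
move=> x /andP[bx xa]; rewrite opprK.
rewrite (AC_itv AF (x := - x) (y := b)) ?lexx//; last 2 first.
- by rewrite lerNr.
- by rewrite lerNl.
have i2 : mu.-integrable `[- x, b] (EFin \o f).
  by apply: integrable_sub_itv intf _ _ => //; rewrite lerNr.
rewrite -(Rintegral_aff_preimage true 0 (measurable_itv _) i2) pre opprK.
rewrite (_ : \int[mu]_(t in `[- b, x]) - f (- t) = \int[mu]_(t in `[- b, x]) (-1 * f (- t))); last first.
  by apply: eq_Rintegral => t _; rewrite mulN1r.
rewrite RintegralZl//; last exact: integrable_sub_itv i1 (lexx _) xa.
rewrite mulN1r [X in _ - X](_ : _ = \int[mu]_(x0 in `[- b, x]) f (aff true 0 x0)); first by rewrite addrK.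
by apply: eq_Rintegral => t _; rewrite affE sub0r.
Qed.

Lemma AC_glue a b c F f : a <= b -> b <= c -> AC a b F f -> AC b c F f -> AC a c F f.
Proof.
move=> ab bc AF1 AF2; have [i1 F1] := AF1; have [i2 F2] := AF2.
have E : `[a, b]%classic `|` `[b, c]%classic = `[a, c]%classic :> set R.
  apply/seteqP; split=> x /=; rewrite !in_itv/=.
    by case=> /andP[h1 h2]; rewrite ?h1 ?h2 ?(le_trans h2)// (le_trans ab).
  by move=> /andP[-> ->]; case: (leP x b) => [_|/ltW ->]; [left|right].
have iac : mu.-integrable `[a, c] (EFin \o f).
  apply/integrableP; split.
    rewrite -E; apply/measurable_funU => //; split; first exact: (measurable_int mu i1).
    exact: (measurable_int mu i2).
  rewrite -E; apply: (@le_lt_trans _ _ (\int[mu]_(x in `[a, b]) `|(f x)%:E| +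
      \int[mu]_(x in `[b, c]) `|(f x)%:E|)%E).
    have m12 : measurable_fun (`[a, b]%classic `|` `[b, c]%classic : set (measurableTypeR R)) (EFin \o f).
      apply/measurable_funU => //; split; first exact: (measurable_int mu i1).
      exact: (measurable_int mu i2).
    have E2 : `[a, b]%classic `|` `[b, c]%classic = `[a, b]%classic `|` (`]b, c]%classic) :> set R.
      apply/seteqP; split=> x /=; rewrite !in_itv/=.
        case=> [h|/andP[]]; first by left.
        rewrite le_eqVlt => /orP[/eqP<- _|h1 h2]; last by right; rewrite h1.
        by left; rewrite lexx ab.
      by case=> [h|/andP[h1 h2]]; [left|right; rewrite (ltW h1)].
    rewrite E2 in m12 *.
    rewrite ge0_integral_setU//; last 2 first.
    - by apply: (measurableT_comp (f := abse)).
    - apply/disj_setPLR => x /=; rewrite !in_itv/= => /andP[_ xb].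
      by move=> /andP[/lt_le_trans/(_ xb)]; rewrite ltxx.
    apply: leeD2l; apply: ge0_subset_integral => //.
      by apply: (measurableT_comp (f := abse)) => //; exact: (measurable_int mu i2).
    by apply: subset_itvr; rewrite bnd_simp.
  by case/integrableP: i1 => _ h1; case/integrableP: i2 => _ h2; rewrite lte_add_pinfty.
split=> // x /andP[ax xc].
have [xb|/ltW bx] := leP x b; first by apply: F1; rewrite ax.
rewrite (AC_itv AF2 (x := b) (y := x))// (AC_itv AF1 (x := a) (y := b))// -addrA; congr (_ + _).
have iax : mu.-integrable `[a, x] (EFin \o f) by exact: integrable_sub_itv iac (lexx _) xc.
have := @Rintegral_itvB _ f (BLeft a) (BRight x) b iax.
rewrite !bnd_simp ab bx => /(_ erefl erefl).
rewrite Rintegral_itv_obnd_cbnd; last first.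
  by apply: integrableS iax => //; apply: subset_itvScc; rewrite bnd_simp.
by move=> /eqP; rewrite subr_eq addrC => /eqP.
Qed.

Lemma ae_exists_itv a b (P : R -> Prop) : a < b -> {ae mu, forall x, P x} ->
  exists x, a < x < b /\ P x.
Proof.
move=> ab [A [mA A0 PA]]; apply: contrapT => h.
have sub : `]a, b[ `<=` A.
  move=> x /=; rewrite in_itv/= => xab; apply: PA => /= Px; apply: h.
  by exists x.
have : (mu `]a, b[%classic <= mu A)%E by apply: le_measure => //; rewrite inE.
by rewrite A0 lebesgue_measure_itv/= lte_fin ab -EFinB lee_fin subr_le0 leNgt ab.
Qed.

(** A set of full measure meets every right neighbourhood of [a]. Applied to differences of
    representatives, this makes boundary values unique. *)
Lemma right_limit_ae0 F a d (l : R) : a < d -> F x @[x --> a^'+] --> l ->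
  {ae mu, forall x, a < x < d -> F x = 0} -> l = 0.
Proof.
move=> ad Fl F0; apply/eqP; apply: contrapT => /negP l0.
have : \forall x \near a^'+, F x != 0 by exact: (cvgr_neq0 l Fl l0).
case=> e /= e0 He.
have [] := @ae_exists_itv a (Num.min d (a + e)) _ _ F0.
  by rewrite lt_min ad ltrDl.
move=> x [/andP[ax]]; rewrite lt_min => /andP[xd xe] /(_ _)/eqP h.
have Bx : ball_ (fun x => `|x|) a e x by rewrite /= distrC gtr0_norm ?subr_gt0// ltrBlDl.
by have := He x Bx ax; rewrite h ?ax// eqxx.
Qed.

Lemma left_limit_ae0 F a d (l : R) : d < a -> F x @[x --> a^'-] --> l ->
  {ae mu, forall x, d < x < a -> F x = 0} -> l = 0.
Proof.
move=> ad Fl F0; apply/eqP; apply: contrapT => /negP l0.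
have : \forall x \near a^'-, F x != 0 by exact: (cvgr_neq0 l Fl l0).
case=> e /= e0 He.
have [] := @ae_exists_itv (Num.max d (a - e)) a _ _ F0.
  by rewrite gt_max ad gtrBl.
move=> x [/andP[]]; rewrite gt_max => /andP[dx ex] xa /(_ _)/eqP h.
have Bx : ball_ (fun x => `|x|) a e x.
  by rewrite /= gtr0_norm ?subr_gt0// ltrBlDr -ltrBlDl.
by have := He x Bx xa; rewrite h ?xa ?dx// eqxx.
Qed.

End affine_integrals.

(** * The graph of A_p through absolutely continuous representatives *)

Section operator_graph.
Context (R : realType) (m q r : nat) (p : R) (p1 : (1 <= p%:E)%E).
Context (B : 'M[R]_(m + q, m + r)).
Local Notation mu := (@lebesgue_measure R).
Local Notation X := (Xp m q r p1).
Implicit Types (phi psi : X) (f g z : R -> R) (T : R).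

Lemma ae_neq (a : R) : {ae mu, forall x, x != a}.
Proof.
exists [set a]; split; [exact: measurable_set1|exact: lebesgue_measure_set1|].
by move=> x /= /negP; rewrite negbK => /eqP.
Qed.

Lemma integrable_ae_eq (D : set (measurableTypeR R)) f g : measurable D ->
  mu.-integrable D (EFin \o f) -> measurable_fun D g ->
  {ae mu, forall x, D x -> g x = f x} -> mu.-integrable D (EFin \o g).
Proof.
move=> mD intf mg gf; apply/integrableP; split; first exact: measurable_EFin_comp.
have /integrableP[mf] := intf; congr (_ < _)%E; apply: ae_eq_integral => //.
- exact: (measurableT_comp (f := abse)).
- by apply: (measurableT_comp (f := abse)) => //; exact: measurable_EFin_comp.
- by apply: filterS gf => x gfx Dx; rewrite /= gfx.
Qed.

(** L^p functions are integrable on bounded intervals. The class determines [F] only inside []0,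
    1[], whence [T <= 1]; the endpoints are negligible. *)
Lemma Lp01_integrable (F : Lp01 p1) T : T <= 1 -> mu.-integrable `[0, T] (EFin \o F).
Proof.
move=> T1; have h : mu.-integrable `[0, T] (EFin \o ((F : R -> R) \_ `]0, 1[)).
  apply: (inLp_integrable p1 (inLp_patch F)) => //.
  by rewrite lebesgue_measure_itv; case: ifP => _; rewrite ltry.
apply: integrable_ae_eq h _ _ => //; first by apply: measurable_funTS; exact: measurable_Lp.
apply: filterS2 (ae_neq 0) (ae_neq 1) => x x0 x1 /=; rewrite in_itv/= => /andP[x0' xT].
rewrite patchE mem_set//= in_itv/= !lt_neqAle eq_sym x0 x0' x1/=.
exact: le_trans T1.
Qed.

Lemma Lp0y_integrable (F : Lp0y p1) T : mu.-integrable `[0, T] (EFin \o F).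
Proof.
have h : mu.-integrable `[0, T] (EFin \o ((F : R -> R) \_ `]0, +oo[)).
  apply: (inLp_integrable p1 (inLp_patch F)) => //.
  by rewrite lebesgue_measure_itv; case: ifP => _; rewrite ltry.
apply: integrable_ae_eq h _ _ => //; first by apply: measurable_funTS; exact: measurable_Lp.
apply: filterS (ae_neq 0) => x x0 /=; rewrite in_itv/= => /andP[x0' xT].
by rewrite patchE mem_set//= in_itv/= andbT lt_neqAle eq_sym x0 x0'.
Qed.

Lemma weak_AC01 (f g : Lp01 p1) : weak_derivative `]0, 1[ f g ->
  exists z, AC 0 1 z g /\ {ae mu, forall x, 0 < x < 1 -> f x = z x}.
Proof.
move=> /(weak_AC (b := BLeft 1)) [].
- exact: measurable_Lp.
- exact: measurable_Lp.
- by move=> t; rewrite bnd_simp => /ltW/(Lp01_integrable f).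
- by move=> tau /test_bound01 tb; exists 1 => //; exact: Lp01_integrable.
- by move=> t; rewrite bnd_simp => /ltW/(Lp01_integrable g).
- by move=> tau /test_bound01 tb; exists 1 => //; exact: Lp01_integrable.
move=> c fc; exists (fun x => c + \int[mu]_(t in `[0, x]) g t); split.
  by apply: AC_prim; exact: Lp01_integrable.
by apply: filterS fc => x fx /andP[x0 x1]; apply: fx; rewrite ?bnd_simp.
Qed.

Lemma weak_AC0y (f g : Lp0y p1) : weak_derivative `]0, +oo[ f g ->
  exists z, (forall T, AC 0 T z g) /\ {ae mu, forall x, 0 < x -> f x = z x}.
Proof.
move=> /(weak_AC (b := +oo%O)) [].
- exact: measurable_Lp.
- exact: measurable_Lp.
- by move=> t _; exact: Lp0y_integrable.
- by move=> tau /test_bound0y[T tb]; exists T => //; exact: Lp0y_integrable.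
- by move=> t _; exact: Lp0y_integrable.
- by move=> tau /test_bound0y[T tb]; exists T => //; exact: Lp0y_integrable.
move=> c fc; exists (fun x => c + \int[mu]_(t in `[0, x]) g t); split.
  by move=> T; apply: AC_prim; exact: Lp0y_integrable.
by apply: filterS fc => x fx x0; apply: fx.
Qed.

Lemma boundary_value01 z g f (a0 a1 : R) : AC 0 1 z g ->
  {ae mu, forall x, 0 < x < 1 -> f x = z x} ->
  (boundary_value `[0, 1] f 0 a0 /\ boundary_value `[0, 1] f 1 a1) <->
  (z 0 = a0 /\ z 1 = a1).
Proof.
move=> ACz fz; have /continuous_within_itvP-/(_ ltr01)[_ z0 z1] := AC_continuous ler01 ACz.
have cz := AC_continuous ler01 ACz.
split=> [[[h [ch hf h0]] [k [ck kf k1]]]|[z0' z1']].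
  have /continuous_within_itvP-/(_ ltr01)[_ h0' _] := ch.
  have /continuous_within_itvP-/(_ ltr01)[_ _ k1'] := ck.
  split; apply/eqP; rewrite -subr_eq0; apply/eqP.
    apply: (right_limit_ae0 (F := fun x => z x - h x) (a := 0) (d := 1)) => //.
      by rewrite -h0; exact: cvgB.
    apply: filterS2 fz hf => x zx hx x01.
    by rewrite hx -?zx ?subrr//= in_itv/=; case/andP: x01 => /ltW-> /ltW->.
  apply: (left_limit_ae0 (F := fun x => z x - k x) (a := 1) (d := 0)) => //.
    by rewrite -k1; exact: cvgB.
  apply: filterS2 fz kf => x zx hx x01.
  by rewrite hx -?zx ?subrr//= in_itv/=; case/andP: x01 => /ltW-> /ltW->.
have zf : {ae mu, forall y, `[0, 1]%classic y -> z y = f y}.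
  apply: filterS (filterI fz (filterI (ae_neq 0) (ae_neq 1))) => x [fx [x0 x1]] /=.
  rewrite in_itv/= => /andP[x0' x1'].
  by rewrite fx// !lt_neqAle x0' x1' x1 eq_sym x0.
by split; exists z; split.
Qed.

Lemma boundary_value0y z g f (a : R) : (forall T, AC 0 T z g) ->
  {ae mu, forall x, 0 < x -> f x = z x} ->
  boundary_value `[0, +oo[ f 0 a <-> z 0 = a.
Proof.
move=> ACz fz.
have cz : {within `[0, +oo[, continuous z}.
  apply/continuous_within_itvcyP.
  have c T : 0 < T -> {in `]0, T[%R, continuous z} /\ z x @[x --> 0^'+] --> z 0.
    move=> T0; have := AC_continuous (ltW T0) (ACz T).
    by move=> /continuous_within_itvP-/(_ T0)[].
  split; last by have [] := c 1 ltr01.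
  move=> x; rewrite in_itv/= andbT => x0.
  have x10 : 0 < x + 1 by rewrite addr_gt0.
  by have [cz _] := c _ x10; apply: cz; rewrite in_itv/= x0 ltrDl ltr01.
have /continuous_within_itvcyP[_ z0] := cz.
split=> [[h [ch hf h0]]|z0'].
  have /continuous_within_itvcyP[_ h0'] := ch.
  apply/eqP; rewrite -subr_eq0; apply/eqP.
  apply: (right_limit_ae0 (F := fun x => z x - h x) (a := 0) (d := 1)) => //.
    by rewrite -h0; exact: cvgB.
  apply: filterS2 fz hf => x zx hx /andP[x0 _].
  by rewrite hx -?zx ?subrr//= in_itv/= ltW.
exists z; split => //; apply: filterS2 fz (ae_neq 0) => x fx x0 /=.
by rewrite in_itv/= andbT => x0'; rewrite fx// lt_neqAle x0' eq_sym x0.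
Qed.

(* U, V, W are the continuous representatives of the components of phi. *)
Definition Ap_form phi psi (U : R -> 'cV[R]_m) (V : R -> 'cV[R]_q) (W : R -> 'cV[R]_r) :=
  [/\ forall i, AC 0 1 (fun x => U x i 0) (fun x => - psi.1.1 i x),
      forall i T, AC 0 T (fun x => V x i 0) (fun x => - psi.1.2 i x),
      forall i T, AC 0 T (fun x => W x i 0) (psi.2 i),
      [/\ {ae mu, forall x, 0 < x < 1 -> uval phi x = U x},
          {ae mu, forall x, 0 < x -> vval phi x = V x} &
          {ae mu, forall x, 0 < x -> wval phi x = W x}] &
      col_mx (U 0) (V 0) = B *m col_mx (U 1) (W 0)].

Lemma ae_col n (P : R -> bool) (F G : R -> 'cV[R]_n) :
  (forall i, {ae mu, forall x, P x -> F x i 0 = G x i 0}) ->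
  {ae mu, forall x, P x -> F x = G x}.
Proof.
move=> /(@filter_forall _ _ _ _ (ae_lebesgue_filter R)).
by apply: filterS => x hx Px; apply/colP => i; exact: hx.
Qed.

Lemma ae_coord n (P : R -> bool) (F G : R -> 'cV[R]_n) i :
  {ae mu, forall x, P x -> F x = G x} ->
  {ae mu, forall x, P x -> F x i 0 = G x i 0}.
Proof. by apply: filterS => x h /h ->. Qed.

(** Du Bois-Reymond from left to right, integration by parts against test functions from right to
    left. *)
Lemma Ap_formP phi psi : Ap p1 B (phi, psi) <-> exists U V W, Ap_form phi psi U V W.
Proof.
split.
  move=> [[dphi [hu hv hw] /= ->] [u0 [u1 [v0 [w0 [bu bv bw bc]]]]]].
  have /choice[U hU] := fun i => weak_AC01 (hu i).
  have /choice[V hV] := fun i => weak_AC0y (hv i).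
  have /choice[W hW] := fun i => weak_AC0y (hw i).
  exists (fun x => \col_i U i x), (fun x => \col_i V i x), (fun x => \col_i W i x).
  split.
  - move=> i; apply: (AC_ae (f := dphi.1.1 i)).
    + by apply: AC_eq (hU i).1 _ _ => // x _; rewrite mxE.
    + by apply: measurable_funTS; apply: measurableT_comp => //; exact: measurable_Lp.
    + have := Lp_oppE (dphi.1.1 i) => h.
      apply: filterS (filterI h (filterI (ae_neq 0) (ae_neq 1))) => x [hx [x0 x1]] /andP[x0' x1'].
      rewrite /= !ffunE hx ?opprK//= in_itv/=.
      by rewrite !lt_neqAle x0' x1' x1 eq_sym x0.
  - move=> i T; apply: (AC_ae (f := dphi.1.2 i)).
    + by apply: AC_eq ((hV i).1 T) _ _ => // x _; rewrite mxE.
    + by apply: measurable_funTS; apply: measurableT_comp => //; exact: measurable_Lp.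
    + have := Lp_oppE (dphi.1.2 i) => h.
      apply: filterS2 h (ae_neq 0) => x hx x0 /andP[x0' x1'].
      rewrite /= !ffunE hx ?opprK//= in_itv/= andbT.
      by rewrite lt_neqAle x0' eq_sym x0.
  - by move=> i T; apply: AC_eq ((hW i).1 T) _ _ => // x _; rewrite mxE.
  - split; apply: ae_col => i.
    + by apply: filterS (hU i).2 => x h /h; rewrite !mxE.
    + by apply: filterS (hV i).2 => x h /h; rewrite !mxE.
    + by apply: filterS (hW i).2 => x h /h; rewrite !mxE.
  - have bU i := (boundary_value01 _ _ (hU i).1 (hU i).2).1 (bu i).
    have bV i := (boundary_value0y _ (hV i).1 (hV i).2).1 (bv i).
    have bW i := (boundary_value0y _ (hW i).1 (hW i).2).1 (bw i).
    have -> : \col_i U i 0 = u0 by apply/colP => i; rewrite mxE (bU i).1.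
    have -> : \col_i U i 1 = u1 by apply/colP => i; rewrite mxE (bU i).2.
    have -> : \col_i V i 0 = v0 by apply/colP => i; rewrite mxE bV.
    by have -> : \col_i W i 0 = w0 by apply/colP => i; rewrite mxE bW.
move=> [U [V [W [hU hV hW [eU eV eW] bc]]]].
have eU' i : {ae mu, forall x, 0 < x < 1 -> phi.1.1 i x = U x i 0}.
  by apply: filterS (ae_coord i eU) => x h /h; rewrite mxE.
have eV' i : {ae mu, forall x, 0 < x -> phi.1.2 i x = V x i 0}.
  by apply: filterS (ae_coord i eV) => x h /h; rewrite mxE.
have eW' i : {ae mu, forall x, 0 < x -> phi.2 i x = W x i 0}.
  by apply: filterS (ae_coord i eW) => x h /h; rewrite mxE.
split.
  exists (- psi.1.1, - psi.1.2, psi.2); split; last first.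
  - by rewrite /= !opprK; case: psi {hU hV hW} => [[? ?] ?].
  - move=> i; apply: AC_weak0y (eW' i); first exact: measurable_Lp.
    by move=> T _; exact: hW.
  - move=> i; apply: AC_weak0y (eV' i); first exact: measurable_Lp.
    move=> T _; apply: AC_ae (hV i T) _ _; first by apply: measurable_funTS; exact: measurable_Lp.
    have := Lp_oppE (psi.1.2 i) => h.
    apply: filterS2 h (ae_neq 0) => x hx x0 /andP[x0' x1'].
    rewrite /= !ffunE hx//= in_itv/= andbT.
    by rewrite lt_neqAle x0' eq_sym x0.
  - move=> i; apply: AC_weak01 (eU' i); first exact: measurable_Lp.
    apply: AC_ae (hU i) _ _; first by apply: measurable_funTS; exact: measurable_Lp.
    have := Lp_oppE (psi.1.1 i) => h.
    apply: filterS (filterI h (filterI (ae_neq 0) (ae_neq 1))) => x [hx [x0 x1]] /andP[x0' x1'].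
    rewrite /= !ffunE hx//= in_itv/=.
    by rewrite !lt_neqAle x0' x1' x1 eq_sym x0.
exists (U 0), (U 1), (V 0), (W 0); split => // i.
- exact/(boundary_value01 _ _ (hU i) (eU' i)).
- exact/(boundary_value0y _ (hV i) (eV' i)).
- exact/(boundary_value0y _ (hW i) (eW' i)).
Qed.

End operator_graph.

(** * Difference quotients on the domain of A_p *)

Section difference_quotients.
Context (R : realType) (m q r : nat) (p : R) (p1 : (1 <= p%:E)%E).
Context (B : 'M[R]_(m + q, m + r)).
Local Notation mu := (@lebesgue_measure R).
Local Notation X := (Xp m q r p1).
Local Notation D01 := (measurable_itv (Interval (BRight (0:R)) (BLeft (1:R)))).
Local Notation D0y := (measurable_itv (Interval (BRight (0:R)) (BInfty R false))).
Implicit Types (phi psi : X) (F G : R -> R).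

Lemma AC_sum a b n (c : 'I_n -> R) (F f : 'I_n -> R -> R) :
  (forall j, AC a b (F j) (f j)) ->
  AC a b (fun x => \sum_j c j * F j x) (fun x => \sum_j c j * f j x).
Proof.
move=> AF; elim: (index_enum _) => [|j s IH].
  by apply: AC_eq (AC_cst a b 0) _ _ => x _; rewrite big_nil.
by apply: AC_eq (AC_linear (c j) (AF j) IH) _ _ => x _; rewrite big_cons.
Qed.

Lemma AC_avg_left a b F G h x : AC a b F (fun y => - G y) -> 0 < h ->
  a <= x - h -> x <= b -> F (x - h) - F x = h * avg_sign false h G x.
Proof.
move=> AF h0 ax xb; have xh : x - h <= x by rewrite gerBl ltW.
rewrite (AC_itv AF ax xh xb) opprD addNKr /avg_sign mulrA divff ?gt_eqF// mul1r.
have iG : mu.-integrable `[x - h, x] (EFin \o G).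
  have := integrable_EFinZ (measurable_itv _) (-1) (integrable_sub_itv AF.1 ax xb).
  by apply: eq_integrable => // y _ /=; rewrite mulrN mulNr mul1r opprK.
have pre : aff true x @^-1` `[x - h, x] = `[0, h]%classic.
  apply/seteqP; split=> y /=; rewrite affE !in_itv/=.
    by rewrite lerD2l lerN2 gerBl => /andP[-> ->].
  by rewrite lerD2l lerN2 gerBl => /andP[-> ->].
rewrite (_ : \int[mu]_(t in `[x - h, x]) - G t = -1 * \int[mu]_(t in `[x - h, x]) G t); last first.
  by rewrite -RintegralZl//; apply: eq_Rintegral => t _; rewrite mulN1r.
rewrite -(Rintegral_aff_preimage true x (measurable_itv _) iG) pre.
by rewrite mulN1r opprK; apply: eq_Rintegral => t _; rewrite affE expr0 mul1r.
Qed.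

Lemma AC_avg_right a b F G h x : AC a b F G -> 0 < h ->
  a <= x -> x + h <= b -> F (x + h) - F x = h * avg_sign true h G x.
Proof.
move=> AF h0 ax xb; have xh : x <= x + h by rewrite lerDl ltW.
rewrite (AC_itv AF ax xh xb) addrAC subrr add0r /avg_sign mulrA divff ?gt_eqF// mul1r.
have iG := integrable_sub_itv AF.1 ax xb.
have pre : aff false x @^-1` `[x, x + h] = `[0, h]%classic.
  by apply/seteqP; split=> y /=; rewrite affE !in_itv/= lerDr [_ + x]addrC lerD2l.
rewrite -(Rintegral_aff_preimage false x (measurable_itv _) iG) pre.
by apply: eq_Rintegral => t _; rewrite affE expr1 mulN1r opprK addrC.
Qed.

Section representatives.
Variables (phi psi : X) (U : R -> 'cV[R]_m) (V : R -> 'cV[R]_q) (W : R -> 'cV[R]_r).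
Hypothesis UVW : Ap_form B phi psi U V W.

(** One step of the recursion applied to the continuous representatives. The sign is the same in
    both terms: [U] already has derivative [- psi], and reflection gives [W] the missing sign. *)
Let AC_inflow n (M : 'M[R]_(n, m)) (N : 'M[R]_(n, r)) i :
  AC (-1) 0 (fun y => (M *m U (y + 1) + N *m W (- y)) i 0)
    (fun y => - (M *m uval psi (y + 1) + N *m wval psi (- y)) i 0).
Proof.
case: UVW => hU _ hW _ _.
have h1 : AC (-1) 0 (fun y => \sum_j M i j * U (y + 1) j 0)
    (fun y => \sum_j M i j * - psi.1.1 j (y + 1)).
  apply: AC_sum => j; have := AC_shift 1 (hU j).
  by rewrite sub0r subrr.
have h2 : AC (-1) 0 (fun y => \sum_k N i k * W (- y) k 0)
    (fun y => \sum_k N i k * - psi.2 k (- y)).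
  apply: AC_sum => k; have := AC_reflect ler01 (hW k 1).
  by rewrite oppr0.
apply: AC_eq (AC_linear 1 h1 h2) _ _ => y _; rewrite mul1r; first by rewrite !mxE.
rewrite !mxE opprD -!sumrN; congr (_ + _); apply: eq_bigr => j _;
  by rewrite !mxE mulrN.
Qed.

(** Here the boundary condition enters: its first block row makes the representatives on both sides
    of 0 match, so that the extension of [phi] is absolutely continuous across 0. Its derivative is,
    up to sign, the extension of [psi]. *)
Lemma representative_u i : exists F, AC (-1) 1 F (fun y => - Gu B psi i y) /\
  {ae mu, forall y, -1 < y < 1 -> Gu B phi i y = F y}.
Proof.
have [hU _ _ [eU eV eW] bc] := UVW.
have bu : U 0 = ulsubmx B *m U 1 + ursubmx B *m W 0.
  have := congr1 usubmx bc; rewrite col_mxKu => ->.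
  by rewrite -[B in LHS]submxK mul_block_col col_mxKu.
exists (fun y => if y < 0 then (ulsubmx B *m U (y + 1) + ursubmx B *m W (- y)) i 0 else U y i 0).
split.
  apply: (AC_glue (b := 0)) => //.
    have h := AC_inflow (ulsubmx B) (ursubmx B) i.
    apply: AC_ae (AC_eq h _ (fun y _ => erefl)) _ _.
    - move=> y /andP[_]; rewrite le_eqVlt => /orP[/eqP ->|->//].
      by rewrite ltxx add0r oppr0 -bu.
    - by apply: measurable_funTS; apply: measurableT_comp => //; exact: measurable_Lp.
    - apply: filterS (filterI (ae_neq 0) (filterI (ae_neq (-1)) (filterI (GuE B psi i) (ae_good R)))).
      move=> y [y0 [y1 [Gy gy]]] /andP[y1' y0'].
      have yl : -1 < y by rewrite lt_neqAle y1' eq_sym y1.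
      have yr : y < 0 by rewrite lt_neqAle y0' y0.
      have y11 : -1 < y < 1 by rewrite yl (lt_trans yr).
      have y01 : 0 < y + 1 < 1 by rewrite -ltrBlDr sub0r yl gtrDr yr.
      by rewrite (Gy y11) (Uf_neg _ _ _ gy yr) (Uf_pos _ _ _ y01).
  apply: AC_ae (AC_eq (hU i) _ (fun y _ => erefl)) _ _.
  - by move=> y /andP[y0 _]; rewrite ltNge y0.
  - by apply: measurable_funTS; apply: measurableT_comp => //; exact: measurable_Lp.
  - apply: filterS (filterI (ae_neq 0) (filterI (ae_neq 1) (GuE B psi i))).
    move=> y [y0 [y1 Gy]] /andP[y0' y1'].
    have yl : 0 < y by rewrite lt_neqAle y0' eq_sym y0.
    have yr : y < 1 by rewrite lt_neqAle y1' y1.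
    have y11 : -1 < y < 1 by rewrite yr (lt_trans _ yl).
    have y01 : 0 < y < 1 by rewrite yl yr.
    by rewrite (Gy y11) (Uf_pos _ _ _ y01) mxE.
apply: filterS (filterI (ae_good R) (filterI (Uf_congr B eU eW) (GuE B phi i))).
move=> y [gy [Uy Gy]] /[dup] y11 /andP[yl yr]; rewrite (Gy y11) (Uy yr).
case: ltP => [y0|].
  have y01 : 0 < y + 1 < 1 by rewrite -ltrBlDr sub0r yl gtrDr y0.
  by rewrite (Uf_neg _ _ _ gy y0) (Uf_pos _ _ _ y01).
rewrite le_eqVlt eq_sym (negbTE (good_neq0 gy)) orFb => y0.
have y01 : 0 < y < 1 by rewrite y0.
by rewrite (Uf_pos _ _ _ y01).
Qed.

(** The same gluing at 0, by the second block row of the boundary condition. *)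
Lemma representative_v i : exists F, (forall T, 0 <= T -> AC (-1) T F (fun y => - Gv B psi i y)) /\
  {ae mu, forall y, -1 < y -> Gv B phi i y = F y}.
Proof.
have [hU hV _ [eU eV eW] bc] := UVW.
have bu : V 0 = dlsubmx B *m U 1 + drsubmx B *m W 0.
  have := congr1 dsubmx bc; rewrite col_mxKd => ->.
  by rewrite -[B in LHS]submxK mul_block_col col_mxKd.
exists (fun y => if y < 0 then (dlsubmx B *m U (y + 1) + drsubmx B *m W (- y)) i 0 else V y i 0).
split=> [T T0|].
  apply: (AC_glue (b := 0)) => //.
    have h := AC_inflow (dlsubmx B) (drsubmx B) i.
    apply: AC_ae (AC_eq h _ (fun y _ => erefl)) _ _.
    - move=> y /andP[_]; rewrite le_eqVlt => /orP[/eqP ->|->//].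
      by rewrite ltxx add0r oppr0 -bu.
    - by apply: measurable_funTS; apply: measurableT_comp => //; exact: measurable_Lp.
    - apply: filterS (filterI (ae_neq 0) (filterI (ae_neq (-1)) (GvE B psi i))).
      move=> y [y0 [y1 Gy]] /andP[y1' y0'].
      have yl : -1 < y by rewrite lt_neqAle y1' eq_sym y1.
      have yr : y < 0 by rewrite lt_neqAle y0' y0.
      have y01 : 0 < y + 1 < 1 by rewrite -ltrBlDr sub0r yl gtrDr yr.
      by rewrite (Gy yl) /Vf ltNge (ltW yr) (Uf_pos _ _ _ y01).
  apply: AC_ae (AC_eq (hV i T) _ (fun y _ => erefl)) _ _.
  - by move=> y /andP[y0 _]; rewrite ltNge y0.
  - by apply: measurable_funTS; apply: measurableT_comp => //; exact: measurable_Lp.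
  - apply: filterS2 (ae_neq 0) (GvE B psi i) => y y0 Gy /andP[y0' y1'].
    have yl : 0 < y by rewrite lt_neqAle y0' eq_sym y0.
    have y1 : -1 < y by rewrite (lt_trans _ yl).
    by rewrite (Gy y1) /Vf yl mxE.
apply: filterS (filterI (ae_good R) (filterI (Vf_congr B eU eV eW) (GvE B phi i))).
move=> y [gy [Vy Gy]] yl; rewrite (Gy yl) Vy /Vf.
case: ltgtP => // y0; last by have := good_neq0 gy; rewrite -y0 eqxx.
have y01 : 0 < y + 1 < 1 by rewrite -ltrBlDr sub0r yl gtrDr y0.
by rewrite (Uf_pos _ _ _ y01).
Qed.

Lemma representative_w i : exists F, (forall T, AC 0 T F (Gw psi i)) /\
  {ae mu, forall y, 0 < y -> Gw phi i y = F y}.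
Proof.
have [_ _ hW [_ _ eW] _] := UVW.
exists (fun y => W y i 0); split=> [T|].
  apply: AC_ae (hW i T) _ _; first by apply: measurable_funTS; exact: measurable_Lp.
  apply: filterS2 (ae_neq 0) (GwE psi i) => y y0 Gy /andP[y0' _].
  by rewrite Gy// lt_neqAle y0' eq_sym y0.
by apply: filterS2 (GwE phi i) eW => y Gy Wy y0; rewrite Gy// -Wy// mxE.
Qed.

End representatives.

Lemma cvg_quotient_cls (D : set (measurableTypeR R)) (mD : measurable D) (s : bool)
    (G H : LpT p1) (F : LspaceType (mrestr mu mD) p1) :
  cls p1 mD G = F ->
  (forall h, 0 < h <= 1 -> {ae mu, forall x, D x ->
     G (x - (-1) ^+ s * h) - G x = h * avg_sign s h H x}) ->
  h^-1 *: (cls p1 mD (fun x => G (x - (-1) ^+ s * h)) - F) @[h --> 0^'+] --> cls p1 mD H.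
Proof.
move=> <- GH; have c0 := @cvg_cls_avg R p p1 D mD s H (inLp_LpT H).
apply: (cvg_trans _ c0).
apply: near_eq_cvg; near=> h; apply/esym/LpP.
have h0 : 0 < h by near: h; exact: nbhs_right_gt.
have h1 : h <= 1 by near: h; exact: nbhs_right_le.
have L1 : inLp p (avg_sign s h H) by near: h; exact: near_inLp_avg_sign (inLp_LpT H).
have L2 : inLp p (fun x => G (x - (-1) ^+ s * h)).
  have := inLp_aff false (- ((-1) ^+ s * h)) (inLp_LpT G); congr inLp.
  by apply/funext => x; rewrite /= affE.
have h01 : 0 < h <= 1 by rewrite h0.
set C := cls p1 mD _; set E := cls p1 mD _.
have e1 := Lp_scaleE h^-1 (C - E); have e2 := Lp_addE C (- E); have e3 := Lp_oppE E.
have e4 := inLp_clsE p1 mD L1; have e5 := inLp_clsE p1 mD L2.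
have e6 := inLp_clsE p1 mD (inLp_LpT G).
apply: filterS (filterI e1 (filterI e2 (filterI e3 (filterI e4 (filterI e5 (filterI e6 (GH h h01))))))).
move=> x [d1 [d2 [d3 [d4 [d5 [d6 d7]]]]]] Dx.
by rewrite d1// d2// d3// d4// d5// d6// d7// mulrA mulVf ?gt_eqF// mul1r.
Unshelve. all: by end_near. Qed.

Lemma cvg_Th_quotient phi psi : Ap p1 B (phi, psi) ->
  h^-1 *: (Th B phi h - phi) @[h --> 0^'+] --> psi.
Proof.
move=> /Ap_formP[U [V [W UVW]]]; apply: cvg_XpP => i.
- rewrite -[psi.1.1 i](cls_Gu B) (_ : (fun h => _) = (fun h => h^-1 *: (cls p1 D01
      (fun x => Gu B phi i (x - (-1) ^+ false * h)) - phi.1.1 i))); last first.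
    by apply/funext => h; rewrite !ffunE.
  apply: cvg_quotient_cls; first exact: cls_Gu.
  move=> h /andP[h0 h1]; have [F [AF GF]] := representative_u UVW i.
  apply: filterS2 GF (ae_shift (- h) GF) => x e1 e2; rewrite /= in_itv/= => /andP[x0 x1].
  rewrite expr0 mul1r e2; last by apply/andP; split; lra.
  rewrite e1; last by apply/andP; split; lra.
  by apply: (AC_avg_left AF) => //; lra.
- rewrite -[psi.1.2 i](cls_Gv B) (_ : (fun h => _) = (fun h => h^-1 *: (cls p1 D0y
      (fun x => Gv B phi i (x - (-1) ^+ false * h)) - phi.1.2 i))); last first.
    by apply/funext => h; rewrite !ffunE.
  apply: cvg_quotient_cls; first exact: cls_Gv.
  move=> h /andP[h0 h1]; have [F [AF GF]] := representative_v UVW i.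
  apply: filterS2 GF (ae_shift (- h) GF) => x e1 e2; rewrite /= in_itv/= andbT => x0.
  rewrite expr0 mul1r e2; last lra.
  rewrite e1; last lra.
  by apply: (AC_avg_left (AF x (ltW x0))) => //; lra.
- rewrite -[psi.2 i]cls_Gw (_ : (fun h => _) = (fun h => h^-1 *: (cls p1 D0y
      (fun x => Gw phi i (x - (-1) ^+ true * h)) - phi.2 i))); last first.
    by apply/funext => h; rewrite !ffunE.
  apply: cvg_quotient_cls; first exact: cls_Gw.
  move=> h /andP[h0 h1]; have [F [AF GF]] := representative_w UVW i.
  apply: filterS2 GF (ae_shift h GF) => x e1 e2; rewrite /= in_itv/= andbT => x0.
  rewrite expr1 mulN1r opprK e2; last lra.
  rewrite e1//.
  by apply: (AC_avg_right (AF (x + h))) => //; exact: ltW.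
Qed.

Lemma Ap_sub_generator : Ap p1 B `<=` generator (Tp p1 B).
Proof.
move=> [phi psi] /cvg_Th_quotient; apply: cvg_trans; apply: near_eq_cvg.
near=> h; rewrite Tp_ThE//; apply/andP; split.
  by near: h; exact: nbhs_right_ge.
by near: h; exact: nbhs_right_le.
Unshelve. all: by end_near. Qed.

End difference_quotients.

(** * Eigenvectors of a generator *)

Section eigenvectors.
Context (R : realType).

Lemma generator_linear (V : normedModType R) (S : R -> V -> V) (a : R) x y x' y' :
  (forall t, 0 <= t -> linear (S t)) -> generator S (x, y) -> generator S (x', y') ->
  generator S (a *: x + x', a *: y + y').
Proof.
move=> lS Sx Sx'; rewrite /generator /=.
have c : a *: (h^-1 *: (S h x - x)) + h^-1 *: (S h x' - x') @[h --> 0^'+] --> a *: y + y'.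
  by apply: cvgD => //; apply: cvgZr.
apply: cvg_trans c; apply: near_eq_cvg; near=> h.
have h0 : 0 <= h by near: h; exact: nbhs_right_ge.
rewrite lS// scalerA mulrC -scalerA -scalerDr; congr (_ *: _).
by rewrite scalerBr opprD addrACA.
Unshelve. all: by end_near. Qed.

(* The norms y_j of S (j h) x satisfy y_(j+1) >= (1 + l h) y_j - M e h. *)
Lemma eigenvector_eq0 (V : normedModType R) (S : R -> V -> V) (M l : R) x :
  (forall t, 0 <= t -> linear (S t)) -> (forall y, S 0 y = y) ->
  (forall s t y, 0 <= s -> 0 <= t -> S (s + t) y = S s (S t y)) ->
  (forall t y, 0 <= t <= 1 -> `|S t y| <= M * `|y|) ->
  0 < l -> 1 <= M -> M < 1 + l -> generator S (x, l *: x) -> x = 0.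
Proof.
move=> lS S0 SD SM l0 M1 Ml Gx; apply/eqP; rewrite -normr_le0 leNgt; apply/negP => x0.
have M0 : 0 < M by apply: lt_le_trans M1.
(* Chosen so that the accumulated error [M * e] is half of the gap [(1 + l - M) * |x|] between the
   growth of an eigenvector and the bound at time 1. *)
pose e := (1 + l - M) * `|x| / (2 * M).
have e0 : 0 < e by rewrite divr_gt0 ?mulr_gt0// subr_gt0.
move/cvgrPdist_le : Gx => /(_ e e0) [d /= d0 dS].
(* The time step is the inverse of an integer, so that [n.+1] steps end exactly at time 1. *)
have [n nd] : exists n : nat, n.+1%:R^-1 < d.
  by have [n] := ltr_add_invr d0; rewrite add0r => h; exists n.
pose h : R := n.+1%:R^-1.
have h0 : 0 < h by rewrite invr_gt0.
have Sh : `|S h x - (1 + l * h) *: x| <= e * h.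
  have Bh : ball_ (fun x => `|x|) 0 d h by rewrite /= sub0r normrN gtr0_norm.
  have := dS h Bh h0; rewrite -(ler_pM2r h0); congr (_ <= _).
  rewrite -[X in _ * X = _](gtr0_norm h0) mulrC -normrZ.
  rewrite scalerBr !scalerA mulfV ?gt_eqF// scale1r distrC [h * l]mulrC.
  by rewrite scalerDl scale1r opprD addrA.
(* The fixed point of [y |-> (1 + l h) y - M e h]. *)
pose c := M * e / l.
have lc : l * c = M * e by rewrite /c mulrCA mulfV ?gt_eqF// mulr1.
have cx : 0 <= `|x| - c.
  rewrite subr_ge0 -(ler_pM2l l0) lc /e.
  rewrite (_ : M * _ = (1 + l - M) / 2 * `|x|); last by field; rewrite gt_eqF.
  by rewrite ler_pM2r//; lra.
(* The recursion centred at [c], with [(1 + l h) ^ j] replaced by Bernoulli's lower bound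
   [1 + l h j]. *)
have step : forall j : nat, (j <= n.+1)%N ->
    (1 + l * h * j%:R) * (`|x| - c) + c <= `|S (h * j%:R) x|.
  elim=> [|j IH] ij; first by rewrite !mulr0 addr0 S0 mul1r subrK.
  have j1 : 0 <= h * j%:R <= 1.
    by rewrite mulr_ge0 ?(ltW h0)//= mulrC /h ler_pdivrMr// mul1r ler_nat ltnW.
  have /andP[j0 _] := j1.
  have E : S (h * j.+1%:R) x = (1 + l * h) *: S (h * j%:R) x +
      S (h * j%:R) (S h x - (1 + l * h) *: x).
    rewrite -natr1 mulrDr mulr1 SD// ?(ltW h0)//.
    have := lS _ j0 (1 + l * h) x (S h x - (1 + l * h) *: x).
    by rewrite subrKC.
  have lh0 : 0 <= 1 + l * h by rewrite addr_ge0// mulr_ge0// ltW.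
  have n1 : (1 + l * h) * `|S (h * j%:R) x| - M * (e * h) <= `|S (h * j.+1%:R) x|.
    rewrite E (le_trans _ (lerB_normD _ _))// normrZ ger0_norm// lerD2l lerN2.
    by rewrite (le_trans (SM _ _ j1))// ler_wpM2l// ltW.
  apply: le_trans n1; have IH' := ler_wpM2l lh0 (IH (ltnW ij)).
  rewrite lerBrDr (le_trans _ IH')// mulrA -lc -natr1.
  rewrite -subr_ge0 [X in 0 <= X](_ : _ = (l * h) ^+ 2 * j%:R * (`|x| - c)); last by ring.
  by rewrite mulr_ge0// mulr_ge0// sqr_ge0.
have := step n.+1 (leqnn _); rewrite -mulrA [h * _]mulVf// !mulr1 => h1.
have := SM 1 x; rewrite ler01 lexx => /(_ erefl) /(le_trans h1).
rewrite leNgt => /negP; apply; rewrite -subr_gt0.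
rewrite [X in 0 < X](_ : _ = (1 + l - M) * `|x| - l * c); last by ring.
rewrite lc [X in 0 < X](_ : _ = (1 + l - M) * `|x| / 2); last by rewrite /e; field; rewrite gt_eqF.
by rewrite divr_gt0// mulr_gt0// subr_gt0.
Qed.

Lemma cvg_right_quotient (f : R -> R) (df : R) : is_derive (0 : R) (1 : R) f df ->
  h^-1 * (f h - f 0) @[h --> 0^'+] --> df.
Proof.
move=> [dfx <-].
have sub : (0 : R)^'+ `=>` (0 : R)^' by apply: within_subset => x /= /gt_eqF ->.
apply: cvg_trans (cvg_trans (cvg_app _ sub) dfx).
apply: near_eq_cvg; near=> h; rewrite /= addr0.
by rewrite [h *: 1]mulr1.
Unshelve. all: by end_near. Qed.

Lemma is_derive_scaled_cos (b x : R) :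
  is_derive x (1:R) (fun t => cos (b * t)) (- (b * sin (b * x))).
Proof. by apply: is_derive_eq; rewrite [b *: 1]mulr1 mulNr mulrC. Qed.

Lemma is_derive_scaled_sin (b x : R) :
  is_derive x (1:R) (fun t => sin (b * t)) (b * cos (b * x)).
Proof. by apply: is_derive_eq; rewrite [b *: 1]mulr1 mulrC. Qed.

Lemma normr_cos_le1 (x : R) : `|cos x| <= 1.
Proof. by rewrite ler_norml cos_geN1 cos_le1. Qed.

Lemma normr_sin_le1 (x : R) : `|sin x| <= 1.
Proof. by rewrite ler_norml sin_geN1 sin_le1. Qed.

(** * Reduction of complex eigenvalues to real ones *)

Section rotation.
Variables (V : normedModType R) (S : R -> V -> V) (M : R).
Hypothesis cS : C0_semigroup S.
Hypothesis SM : forall t y, 0 <= t <= 1 -> `|S t y| <= M * `|y|.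
Hypothesis M1 : 1 <= M.

(* The semigroup e^(- i b t) S t on the complexification, which moves the
   eigenvalue a + i b to a. *)
Definition rotated (b t : R) (x : V * V) : V * V :=
  (cos (b * t) *: S t x.1 + sin (b * t) *: S t x.2,
   cos (b * t) *: S t x.2 - sin (b * t) *: S t x.1).

Let lS t : 0 <= t -> linear (S t).
Proof. by case: cS => h _ _ _ /h[]. Qed.

Let SC t (a c : R) x y : 0 <= t -> S t (a *: x + c *: y) = a *: S t x + c *: S t y.
Proof.
move=> t0; rewrite lS//; congr (_ + _).
have S00 : S t 0 = 0.
  have := lS t0 1 0 0; rewrite !scale1r addr0 => /esym/eqP.
  by rewrite -subr_eq0 addrK => /eqP.
by have := lS t0 c y 0; rewrite !addr0 S00 addr0.
Qed.

Lemma rotated_linear b t : 0 <= t -> linear (rotated b t).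
Proof.
move=> t0 a [x1 x2] [y1 y2]; rewrite /rotated /=; congr (_, _) => /=.
  by rewrite !lS// !scalerDr !scalerA addrACA ![a * _]mulrC.
by rewrite !lS// !scalerDr !scalerA ![a * _]mulrC opprD scalerN scalerA [a * _]mulrC addrACA.
Qed.

Lemma rotatedD b s t x : 0 <= s -> 0 <= t -> rotated b (s + t) x = rotated b s (rotated b t x).
Proof.
move=> s0 t0; have [_ _ SD _] := cS; rewrite /rotated /= !SD// -!scaleNr !SC//.
set y := S s (S t x.1); set z := S s (S t x.2).
by congr (_, _); rewrite !scalerDr !scalerA [X in _ = _ + X]addrC addrACA -!scalerDl
  mulrDr cosD sinD; congr (_ *: _ + _ *: _); ring.
Qed.

(** The rotated semigroup has [z] as eigenvector for the real part of [l]. Each of its components is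
    a sum of two terms bounded by [M], which explains [2 * M]. *)
Lemma complex_eigenvector_eq0 (l : R[i]) (z : V * V) :
  0 < complex.Re l -> 2 * M < 1 + complex.Re l ->
  complexify (generator S) (z, Defs.cscale l z) -> z = 0.
Proof.
case: l => a b /= a0 Ma [/= G1 G2]; have [_ S0 SD Sc] := cS.
have C0 : h^-1 * (cos (b * h) - 1) @[h --> 0^'+] --> (0 : R).
  have := cvg_right_quotient (is_derive_scaled_cos b 0).
  by rewrite !mulr0 sin0 mulr0 oppr0 cos0.
have D0 : h^-1 * sin (b * h) @[h --> 0^'+] --> b.
  have := cvg_right_quotient (is_derive_scaled_sin b 0).
  by rewrite !mulr0 cos0 mulr1 sin0; under eq_fun do rewrite subr0.
have C1 : cos (b * h) @[h --> 0^'+] --> (1 : R).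
  rewrite -[X in _ --> X]cos0 -[X in cos X](mulr0 b); apply: cvg_at_right_filter.
  have cb : b * h @[h --> 0] --> b * 0 by apply: cvgM; [exact: cvg_cst|exact: cvg_id].
  exact: (cvg_comp _ _ cb (@continuous_cos R (b * 0))).
(* The product rule at 0 for one component of the rotated orbit; [c] is the sign of the sine
   term. *)
have half (x y : V) (c : R) (w : V) : generator S (x, w) -> 
    h^-1 *: (cos (b * h) *: S h x + (c * sin (b * h)) *: S h y - x) @[h --> 0^'+]
    --> w + (c * b) *: y.
  rewrite /generator /= => Gx.
  have : cos (b * h) *: (h^-1 *: (S h x - x)) + (h^-1 * (cos (b * h) - 1)) *: x +
      (c * (h^-1 * sin (b * h))) *: S h y @[h --> 0^'+] --> 1 *: w + 0 *: x + (c * b) *: y.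
    apply: cvgD; last by apply: cvgZ => //; apply: cvgMr.
    by apply: cvgD; [exact: cvgZ|exact: cvgZl].
  rewrite scale1r scale0r addr0; apply: cvg_trans; apply: near_eq_cvg; near=> h.
  rewrite (mulrCA c) -[(h^-1 * (_ - _)) *: x]scalerA -[(h^-1 * (c * _)) *: _]scalerA.
  have -> : cos (b * h) *: (h^-1 *: (S h x - x)) = h^-1 *: (cos (b * h) *: (S h x - x)).
    by rewrite !scalerA mulrC.
  rewrite -!scalerDr; congr (_ *: _).
  by rewrite scalerBr scalerBl scale1r addrA subrK addrAC.
apply: (@eigenvector_eq0 _ (rotated b) (2 * M) a) => //.
- by move=> t; exact: rotated_linear.
- by move=> [x y]; rewrite /rotated mulr0 cos0 sin0 !S0 /= !scale1r !scale0r addr0 subr0.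
- by move=> s t y; exact: rotatedD.
- move=> t [x y] /[dup] t01 /andP[t0 t1].
  have M0 : 0 <= M by rewrite (le_trans ler01).
  have bnd (c d : R) (u v : V) : `|c| <= 1 -> `|d| <= 1 -> `|u| <= `|(x, y)| -> `|v| <= `|(x, y)| ->
      `|c *: S t u + d *: S t v| <= 2 * M * `|(x, y)|.
    move=> c1 d1 ux vx; rewrite -mulrA mulr_natl mulr2n (le_trans (ler_normD _ _))// !normrZ.
    have e (k : R) w : `|k| <= 1 -> `|w| <= `|(x, y)| -> `|k| * `|S t w| <= M * `|(x, y)|.
      move=> k1 wx; rewrite (@le_trans _ _ `|S t w|)//; first by rewrite ler_piMl.
      by rewrite (le_trans (SM _ t01))// ler_wpM2l.
    by apply: lerD; exact: e.
  have xl : `|x| <= `|(x, y)| by rewrite prod_normE le_max lexx.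
  have yl : `|y| <= `|(x, y)| by rewrite prod_normE le_max lexx orbT.
  rewrite [leLHS]prod_normE ge_max /rotated /=; apply/andP; split.
    by apply: bnd => //; [exact: normr_cos_le1|exact: normr_sin_le1].
  rewrite -scaleNr; apply: bnd => //; rewrite ?normrN; [exact: normr_cos_le1|exact: normr_sin_le1].
- by rewrite (le_trans M1)// ler_peMl ?(le_trans ler01)// ler1n.
- have h1 := half z.1 z.2 1 _ G1; have h2 := half z.2 z.1 (-1) _ G2.
  rewrite /generator /=.
  have E1 : a *: z.1 = a *: z.1 - b *: z.2 + (1 * b) *: z.2 by rewrite mul1r subrK.
  have E2 : a *: z.2 = b *: z.1 + a *: z.2 + (-1 * b) *: z.1.
    by rewrite mulN1r scaleNr addrAC subrr add0r.
  have -> : a *: z = (a *: z.1, a *: z.2) by [].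
  rewrite E1 E2; apply: cvg_trans (cvg_pair h1 h2).
  apply: near_eq_cvg; near=> h.
  rewrite /rotated; congr (_, _) => /=; congr (_ *: _); first by rewrite mul1r.
  by rewrite mulN1r scaleNr.
Unshelve. all: by end_near. Qed.

End rotation.
End eigenvectors.

(** * Causal convolution with exponential kernels *)

Section exponential_convolution.
Context (R : realType) (a b : R).
Local Notation mu := (@lebesgue_measure R).
Implicit Types (f g : R -> R) (al be s t x T : R).

(** For [(al, be) = (1, 0)] and [(0, 1)] these are the real part and minus the imaginary part of
    [e^(- (a + i b) t)]. Differentiation stays in the family: it gives [- a] times the kernel plus
    [b] times the kernel with parameters [(be, - al)]. *)
Definition kern al be t : R := expR (- (a * t)) * (al * cos (b * t) + be * sin (b * t)).

(* The causal convolution, i.e. the Laplace integral of t |-> f (x - t). *)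
Definition conv al be f x : R :=
  \int[mu]_(s in `]-oo, x]) (kern al be (x - s) * f s).

Definition exp_integrable f T :=
  mu.-integrable `]-oo, T] (EFin \o (fun s => expR (a * s) * f s)).

Lemma measurable_kern al be : measurable_fun setT (kern al be).
Proof.
apply: continuous_measurable_fun => x.
have lin (c : R) : c * t @[t --> x] --> c * x by apply: cvgM; [exact: cvg_cst|exact: cvg_id].
apply: cvgM.
  apply: (cvg_comp (F := nbhs x) (fun t => - (a * t)) expR); last exact: continuous_expR.
  by apply: cvgN.
apply: cvgD; (apply: cvgM; first exact: cvg_cst).
  exact: (cvg_comp (fun t => b * t) cos (lin b) (@continuous_cos R _)).
exact: (cvg_comp (fun t => b * t) sin (lin b) (@continuous_sin R _)).
Qed.

Lemma normr_kern_le al be t : `|kern al be t| <= (`|al| + `|be|) * expR (- (a * t)).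
Proof.
rewrite /kern normrM ger0_norm ?expR_ge0// mulrC ler_wpM2r ?expR_ge0//.
rewrite (le_trans (ler_normD _ _))// !normrM lerD// ler_piMr// ?normr_cos_le1//.
exact: normr_sin_le1.
Qed.

(** The addition theorems separate [x] from [s] in the kernel at [x - s]; [conv] then is a
    combination of primitives of such functions, with coefficients smooth in [x]. *)
Let part al be f s := expR (a * s) * f s * (al * cos (b * s) - be * sin (b * s)).

Lemma measurable_scaled (h : R -> R) (c : R) : measurable_fun setT h ->
  measurable_fun setT (fun s => h (c * s)).
Proof. by move=> mh; apply: measurableT_comp => //; exact: measurable_funM. Qed.

Let measurable_cs al be : measurable_fun setT (fun s => al * cos (b * s) - be * sin (b * s)).
Proof.
apply: measurable_funB; apply: measurable_funM => //; apply: measurable_scaled;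
  apply: continuous_measurable_fun; [exact: continuous_cos|exact: continuous_sin].
Qed.

Lemma exp_integrableS f T T' : T' <= T -> exp_integrable f T -> exp_integrable f T'.
Proof. by move=> TT; apply: integrableS => //; apply: subset_itvl; rewrite bnd_simp. Qed.

Let part_integrable al be f T : exp_integrable f T ->
  mu.-integrable `]-oo, T] (EFin \o part al be f).
Proof.
move=> h; apply: (integrable_EFinM (measurable_itv _) (K := `|al| + `|be|)) => //.
  by apply: measurable_funTS; exact: measurable_cs.
move=> x _; rewrite (le_trans (ler_normB _ _))// !normrM lerD// ler_piMr//.
  exact: normr_cos_le1.
exact: normr_sin_le1.
Qed.

Let kern_part al be f x s : kern al be (x - s) * f s =
  expR (- (a * x)) * cos (b * x) * part al be f s +
  expR (- (a * x)) * sin (b * x) * part be (- al) f s.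
Proof.
rewrite /kern /part (_ : - (a * (x - s)) = - (a * x) + a * s); last by ring.
by rewrite expRD mulrBr cosB sinB; ring.
Qed.

Lemma kern_integrable al be f x : exp_integrable f x ->
  mu.-integrable `]-oo, x] (EFin \o (fun s => kern al be (x - s) * f s)).
Proof.
move=> h; have i1 := integrable_EFinZ (measurable_itv _) (expR (- (a * x)) * cos (b * x)) (part_integrable al be h).
have i2 := integrable_EFinZ (measurable_itv _) (expR (- (a * x)) * sin (b * x)) (part_integrable be (- al) h).
apply: eq_integrable (integrable_EFinD (measurable_itv _) i1 i2) => // s _ /=.
by rewrite kern_part.
Qed.

Let conv_part al be f x : exp_integrable f x -> conv al be f x =
  expR (- (a * x)) * cos (b * x) * prim (part al be f) x +
  expR (- (a * x)) * sin (b * x) * prim (part be (- al) f) x.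
Proof.
move=> h; rewrite /prim -!RintegralZl//; last 2 first.
- exact: part_integrable.
- exact: part_integrable.
rewrite -RintegralD//; last 2 first.
- by apply: integrable_EFinZ => //; exact: part_integrable.
- by apply: integrable_EFinZ => //; exact: part_integrable.
by apply: eq_Rintegral => s _; exact: kern_part.
Qed.

Lemma AC_prim_infty A T f : mu.-integrable `]-oo, T] (EFin \o f) -> AC A T (prim f) f.
Proof.
move=> intf; split=> [|x /andP[Ax xT]].
  by apply: integrableS intf => //; apply: subset_itvr.
have ix : mu.-integrable `]-oo, x] (EFin \o f).
  by apply: integrableS intf => //; apply: subset_itvl; rewrite bnd_simp.
have := @Rintegral_itvB _ f -oo%O (BRight x) A ix.
rewrite !bnd_simp => /(_ erefl Ax).
rewrite Rintegral_itv_obnd_cbnd; last first.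
  by apply: integrableS ix => //; apply: subset_itvr.
by move=> /eqP; rewrite subr_eq addrC => /eqP.
Qed.

Lemma is_derive_exp_decay x :
  is_derive x (1:R) (fun t => expR (- (a * t))) (- (a * expR (- (a * x)))).
Proof.
have d1 : is_derive x (1:R) (fun t => - (a * t)) (- a).
  by apply: is_derive_eq; rewrite [a *: 1]mulr1.
have := @is_derive1_comp R expR (fun t => - (a * t)) x _ _ (is_derive_expR _) d1.
by rewrite mulrN mulrC.
Qed.

Lemma is_derive_exp_cos x : is_derive x (1:R) (fun t => expR (- (a * t)) * cos (b * t))
  (- (a * (expR (- (a * x)) * cos (b * x))) - b * (expR (- (a * x)) * sin (b * x))).
Proof.
have h : is_derive x (1:R) (fun t => expR (- (a * t)) * cos (b * t)) _ :=
  is_deriveM (is_derive_exp_decay x) (is_derive_scaled_cos b x).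
by apply: is_derive_eq h _; rewrite /GRing.scale /=; ring.
Qed.

Lemma is_derive_exp_sin x : is_derive x (1:R) (fun t => expR (- (a * t)) * sin (b * t))
  (- (a * (expR (- (a * x)) * sin (b * x))) + b * (expR (- (a * x)) * cos (b * x))).
Proof.
have h : is_derive x (1:R) (fun t => expR (- (a * t)) * sin (b * t)) _ :=
  is_deriveM (is_derive_exp_decay x) (is_derive_scaled_sin b x).
by apply: is_derive_eq h _; rewrite /GRing.scale /=; ring.
Qed.

Let AC_is_derive A T (F f : R -> R) : (forall x, is_derive x (1:R) F (f x)) ->
  continuous f -> AC A T F f.
Proof.
move=> dF cf; have E : derive1 F = f.
  by apply/funext => x; rewrite derive1E; exact: (@derive_val _ _ _ _ _ _ _ (dF x)).
by rewrite -E; apply: AC_C1; rewrite ?E// => x; exact: (@ex_derive _ _ _ _ _ _ _ (dF x)).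
Qed.

Let is_derive_continuous (F f : R -> R) : (forall x, is_derive x (1:R) F (f x)) -> continuous F.
Proof.
move=> dF x; apply/differentiable_continuous/derivable1_diffP.
exact: (@ex_derive _ _ _ _ _ _ _ (dF x)).
Qed.

(** The product rule for the separated form. The term [al * f x] is the kernel at 0 times [f x], and
    the others come from the derivative of the kernel. *)
Lemma AC_conv al be A T f : exp_integrable f T ->
  AC A T (conv al be f) (fun x => al * f x - a * conv al be f x + b * conv be (- al) f x).
Proof.
move=> h.
have cc := is_derive_continuous is_derive_exp_cos.
have cs := is_derive_continuous is_derive_exp_sin.
have mc (F : R -> R) k : continuous F -> continuous (fun x => k * F x).
  by move=> cF x; apply: cvgM; [exact: cvg_cst|exact: cF].
have c1 : AC A T (fun t => expR (- (a * t)) * cos (b * t))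
    (fun x => - (a * (expR (- (a * x)) * cos (b * x))) - b * (expR (- (a * x)) * sin (b * x))).
  apply: AC_is_derive is_derive_exp_cos _ => x.
  by apply: cvgB; [apply: cvgN; exact: (mc _ a cc x)|exact: (mc _ b cs x)].
have c2 : AC A T (fun t => expR (- (a * t)) * sin (b * t))
    (fun x => - (a * (expR (- (a * x)) * sin (b * x))) + b * (expR (- (a * x)) * cos (b * x))).
  apply: AC_is_derive is_derive_exp_sin _ => x.
  by apply: cvgD; [apply: cvgN; exact: (mc _ a cs x)|exact: (mc _ b cc x)].
have h1 := AC_mul c1 (AC_prim_infty A (part_integrable al be h)).
have h2 := AC_mul c2 (AC_prim_infty A (part_integrable be (- al) h)).
apply: (AC_eq (AC_linear 1 h1 h2)).
- move=> x /andP[_ xT]; have hx := exp_integrableS xT h.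
  by rewrite conv_part// mul1r.
- move=> x /andP[_ xT]; have hx := exp_integrableS xT h.
  rewrite !conv_part//.
  have -> : prim (part (- al) (- be) f) x = - prim (part al be f) x.
    rewrite /prim -[RHS]mulN1r -RintegralZl//; last exact: part_integrable.
    by apply: eq_Rintegral => s _; rewrite /part; ring.
  rewrite /part.
  set E := expR (- (a * x)); set F := expR (a * x).
  have EF : E * F = 1 by rewrite -expRD addNr expR0.
  have CS := cos2Dsin2 (b * x).
  set C := cos _ in CS *; set S := sin _ in CS *.
  set P := prim _ x; set Q := prim _ x.
  transitivity (al * f x * ((E * F) * (C ^+ 2 + S ^+ 2)) - a * (E * C * P + E * S * Q) +
    b * (E * C * Q + E * S * - P)); first by rewrite EF CS; ring.
  ring.
Qed.

End exponential_convolution.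

(** * The mass with weight [e^(a s)] *)

Section exponential_mass.
Context (R : realType) (a : R).
Local Notation mu := (@lebesgue_measure R).
Implicit Types (f g : R -> R) (T : R) (D : set (measurableTypeR R)).

Definition mass D f : \bar R := (\int[mu]_(s in D) (expR (a * s) * `|f s|)%:E)%E.

Lemma mass_ge0 D f : (0 <= mass D f)%E.
Proof. by apply: integral_ge0 => s _; rewrite lee_fin mulr_ge0 ?expR_ge0. Qed.

Lemma measurable_expR_scaled : measurable_fun setT (fun s : R => expR (a * s)).
Proof. by apply: measurable_scaled; exact: measurable_expR. Qed.

Lemma measurable_mass f : measurable_fun setT f ->
  measurable_fun setT (fun s => (expR (a * s) * `|f s|)%:E).
Proof.
move=> mf; apply: measurable_EFin_comp; apply: measurable_funM.
  exact: measurable_expR_scaled.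
exact: measurableT_comp.
Qed.

Lemma exp_integrableP f T : measurable_fun setT f ->
  exp_integrable a f T <-> (mass `]-oo, T] f < +oo)%E.
Proof.
move=> mf; have E : (mass `]-oo, T] f =
    \int[mu]_(s in `]-oo, T]) `|(expR (a * s) * f s)%:E|)%E.
  by apply: eq_integral => s _; rewrite /= normrM ger0_norm ?expR_ge0.
split=> [/integrableP[_]|h]; first by rewrite E.
apply/integrableP; split; last by rewrite -E.
apply: measurable_funTS; apply: measurable_EFin_comp; apply: measurable_funM => //.
exact: measurable_expR_scaled.
Qed.

Lemma le_mass D f g : measurable D -> measurable_fun setT f -> measurable_fun setT g ->
  {ae mu, forall s, D s -> `|f s| <= `|g s|} -> (mass D f <= mass D g)%E.
Proof.
move=> mD mf mg fg; apply: (@ae_ge0_le_integral _ _ _ mu D mD).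
- by move=> s _; rewrite lee_fin mulr_ge0 ?expR_ge0.
- by apply: measurable_funTS; exact: measurable_mass.
- by move=> s _; rewrite lee_fin mulr_ge0 ?expR_ge0.
- by apply: measurable_funTS; exact: measurable_mass.
- by apply: filterS fg => s h Ds; rewrite lee_fin ler_wpM2l ?expR_ge0// h.
Qed.

Lemma mass_subset D D' f : measurable D -> measurable D' -> measurable_fun setT f ->
  D `<=` D' -> (mass D f <= mass D' f)%E.
Proof.
move=> mD mD' mf DD'; apply: ge0_subset_integral => //.
  by apply: measurable_funTS; exact: measurable_mass.
Qed.

Lemma mass_setU D D' f : measurable D -> measurable D' -> measurable_fun setT f ->
  [disjoint D & D'] -> mass (D `|` D') f = (mass D f + mass D' f)%E.
Proof.
move=> mD mD' mf DD'; apply: ge0_integral_setU => //.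
  by apply: measurable_funTS; exact: measurable_mass.
Qed.

Lemma mass_patch D f : mass setT (f \_ D) = mass D f.
Proof.
rewrite /mass [RHS]integral_mkcond; apply: eq_integral => s _; rewrite !patchE.
by case: ifP => // _; rewrite normr0 mulr0.
Qed.

Lemma mass_linear_le D f g (c : R) : measurable D -> measurable_fun setT f -> measurable_fun setT g ->
  (mass D (fun s => c * f s + g s)%R <= `|c|%:E * mass D f + mass D g)%E.
Proof.
move=> mD mf mg; have mfD := @measurable_funTS _ _ _ _ D _ (measurable_mass mf).
have mgD := @measurable_funTS _ _ _ _ D _ (measurable_mass mg).
rewrite /mass -ge0_integralZl// -ge0_integralD//; last by apply: emeasurable_funM.
apply: ge0_le_integral => //.
- apply: measurable_funTS; apply: measurable_mass; apply: measurable_funD => //.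
  exact: measurable_funM.
- by apply: emeasurable_funD => //; apply: emeasurable_funM.
- move=> s _; rewrite -EFinM -EFinD lee_fin mulrCA -mulrDr ler_wpM2l ?expR_ge0//.
  by rewrite (le_trans (ler_normD _ _))// normrM.
Qed.

Lemma mass0 D : mass D (fun=> 0) = 0%E.
Proof. by rewrite /mass; under eq_integral do rewrite normr0 mulr0; rewrite integral0. Qed.

Lemma mass_sum_le D n (c : 'I_n -> R) (f : 'I_n -> R -> R) g : measurable D ->
  (forall i, measurable_fun setT (f i)) -> measurable_fun setT g ->
  (mass D (fun s => \sum_i c i * f i s + g s)%R <= \sum_i `|c i|%:E * mass D (f i) + mass D g)%E.
Proof.
move=> mD mf mg; elim: (index_enum _) => [|i l IH].
  by rewrite big_nil add0e le_eqVlt; apply/orP; left; apply/eqP; congr mass;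
    apply/funext => s; rewrite big_nil add0r.
rewrite big_cons (_ : (fun s => _) =
  (fun s => c i * f i s + (\sum_(j <- l) c j * f j s + g s))); last first.
  by apply/funext => s; rewrite big_cons addrA.
apply: (le_trans (mass_linear_le _ _ _ _)) => //.
  apply: measurable_funD => //; apply: measurable_sum => j.
  exact: measurable_funM.
by rewrite -addeA leeD2l.
Qed.

(** With [c = 1] the factor [e^(- a)] is the source of the contraction in the recursion for U. *)
Lemma mass_shift D f (c : R) : measurable D -> measurable_fun setT f ->
  mass (aff false c @^-1` D) (fun s => f (s + c)) = ((expR (- (a * c)))%:E * mass D f)%E.
Proof.
move=> mD mf; rewrite /mass -ge0_integralZl//; last first.
  by apply: measurable_funTS; exact: measurable_mass.
pose F s := (((expR (- (a * c)))%:E * (expR (a * s) * `|f s|)%:E) * (\1_D s)%:E)%E.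
have mF : measurable_fun setT F.
  apply: emeasurable_funM; last by apply: measurable_EFin_comp; exact: measurable_indic.
  by apply: emeasurable_funM => //; exact: measurable_mass.
have F0 s : (0 <= F s)%E by rewrite lee_fin !mulr_ge0 ?expR_ge0.
transitivity (\int[mu]_s F s)%E; last first.
  rewrite [RHS]integral_mkcond; apply: eq_integral => s _; rewrite patchE /F indicE.
  by case: ifP => _; rewrite ?mule1 ?mule0.
rewrite -(ge0_integral_aff false c mF F0) integral_mkcond; apply: eq_integral => s _.
rewrite patchE /F indicE affE.
have -> : (s \in aff false c @^-1` D) = (s + c \in D).
  by rewrite -(affE false c s); apply/idP/idP; rewrite !inE.
case: ifP => _; rewrite ?mule1 ?mule0// -EFinM; congr EFin.
by rewrite mulrA -expRD; congr (expR _ * _); ring.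
Qed.

End exponential_mass.

(** * Rules and pointwise bounds for the causal convolution *)

Section convolution_bounds.
Context (R : realType) (a b : R).
Local Notation mu := (@lebesgue_measure R).
Local Notation mass := (mass a).
Local Notation L := (conv a b).
Local Notation exp_integrable := (exp_integrable a).
Implicit Types (f g : R -> R) (al be s t x T c : R) (D : set (measurableTypeR R)).

Lemma conv_shift al be f x c : exp_integrable f (x + c) ->
  L al be (fun s => f (s + c)) x = L al be f (x + c).
Proof.
move=> fx; have h := kern_integrable b al be fx.
rewrite /conv -(Rintegral_aff_preimage false c (measurable_itv _) h).
have -> : aff false c @^-1` `]-oo, x + c] = `]-oo, x]%classic.
  by apply/seteqP; split=> s /=; rewrite affE !in_itv/= lerD2r.
by apply: eq_Rintegral => s _; rewrite affE; congr (kern _ _ _ _ _ * _); ring.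
Qed.

Lemma exp_integrable_linear c f g T : exp_integrable f T -> exp_integrable g T ->
  exp_integrable (fun s => c * f s + g s) T.
Proof.
move=> hf hg; have := integrable_EFinD (measurable_itv _) (integrable_EFinZ (measurable_itv _) c hf) hg.
by apply: eq_integrable => // s _ /=; congr EFin; ring.
Qed.

Lemma conv_linear al be c f g x : exp_integrable f x -> exp_integrable g x ->
  L al be (fun s => c * f s + g s) x = c * L al be f x + L al be g x.
Proof.
move=> hf hg; have kf := kern_integrable b al be hf; have kg := kern_integrable b al be hg.
rewrite /conv -RintegralZl// -RintegralD//; last exact: integrable_EFinZ.
by apply: eq_Rintegral => s _; ring.
Qed.

Lemma exp_integrable0 T : exp_integrable (fun=> 0) T.
Proof. by apply/exp_integrableP; rewrite ?mass0 ?ltry//; exact: measurable_cst. Qed.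

Lemma conv_sum al be n (c : 'I_n -> R) (f : 'I_n -> R -> R) g x :
  (forall i, exp_integrable (f i) x) -> exp_integrable g x ->
  exp_integrable (fun s => \sum_i c i * f i s + g s) x /\
  L al be (fun s => \sum_i c i * f i s + g s) x =
    \sum_i c i * L al be (f i) x + L al be g x.
Proof.
move=> hf hg; elim: (index_enum _) => [|i l [IH1 IH2]].
  rewrite (_ : (fun s => _) = g); first by rewrite big_nil add0r.
  by apply/funext => s; rewrite big_nil add0r.
rewrite (_ : (fun s => _) = (fun s => c i * f i s + (\sum_(j <- l) c j * f j s + g s))).
  by rewrite big_cons conv_linear// IH2 addrA; split => //; exact: exp_integrable_linear.
by apply/funext => s; rewrite big_cons addrA.
Qed.

Lemma conv_ae al be f g x : measurable_fun setT f -> measurable_fun setT g ->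
  {ae mu, forall s, s < x -> f s = g s} -> L al be f x = L al be g x.
Proof.
move=> mf mg fg; congr fine; apply: ae_eq_integral => //.
- apply: measurable_funTS; apply: measurable_EFin_comp; apply: measurable_funM => //.
  by apply: (measurableT_comp (measurable_kern _ _ _ _)); exact: measurable_funB.
- apply: measurable_funTS; apply: measurable_EFin_comp; apply: measurable_funM => //.
  by apply: (measurableT_comp (measurable_kern _ _ _ _)); exact: measurable_funB.
- apply: filterS2 fg (ae_neq x) => s h sx /=; rewrite in_itv/= => sx'.
  by rewrite h// lt_neqAle sx.
Qed.

Lemma measurable_conv al be f : measurable_fun setT f -> measurable_fun setT (L al be f).
Proof.
move=> mf; rewrite (_ : L al be f = (fun x => \int[mu]_s (kern a b al be (x - s) * f s * (s <= x)%R%:R))).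
  apply: (@measurable_Rintegral _ (fun z => kern a b al be (z.1 - z.2) * f z.2 * (z.2 <= z.1)%R%:R)).
  apply: measurable_funM; first apply: measurable_funM.
  - by apply: (measurableT_comp (measurable_kern _ _ _ _)); exact: measurable_funB.
  - exact: (measurableT_comp mf).
  - have mle : measurable_fun setT (fun z : R * R => z.2 <= z.1) by exact: measurable_fun_ler.
    by apply: (measurableT_comp (f := fun b : bool => b%:R : R)) mle.
apply/funext => x; rewrite /conv Rintegral_mkcond; apply: eq_Rintegral => s _.
rewrite patchE; case: ifPn; rewrite ?inE ?notin_setE/= in_itv/=.
  by move=> ->; rewrite mulr1.
by move=> /negP/negbTE ->; rewrite mulr0.
Qed.

Lemma normr_conv_le al be f x : measurable_fun setT f -> exp_integrable f x ->
  `|L al be f x| <= (`|al| + `|be|) * expR (- (a * x)) * fine (mass `]-oo, x] f).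
Proof.
move=> mf fx; have h := kern_integrable b al be fx.
rewrite (le_trans (le_normr_Rintegral _ h))//.
have mf0 := (exp_integrableP a x mf).1 fx.
have -> : fine (mass `]-oo, x] f) = \int[mu]_(s in `]-oo, x]) (expR (a * s) * `|f s|) by [].
have i0 : mu.-integrable `]-oo, x] (EFin \o (fun s => expR (a * s) * `|f s|)).
  apply: eq_integrable (integrable_abse fx) => // s _ /=.
  by rewrite normrM ger0_norm ?expR_ge0.
rewrite -RintegralZl//; apply: le_Rintegral => //.
- exact: integrable_abse h.
- exact: integrable_EFinZ.
- move=> s _; rewrite normrM.
  have := normr_kern_le a b al be (x - s).
  move=> /(ler_wpM2r (normr_ge0 (f s))) /le_trans; apply.
  rewrite !mulrA -[_ * _ * expR (a * s)]mulrA -expRD.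
  by rewrite (_ : - (a * x) + a * s = - (a * (x - s)))//; ring.
Qed.

(** Substitute [s = T - t]: the exponential average at [T] is, up to a factor, the mass of the past
    of [T]. *)
Lemma mass_exponential_pdf f T : 0 <= a -> measurable_fun setT f ->
  (\int[mu]_t (exponential_pdf a t * `|f (T - t)|)%:E =
   \int[mu]_(s in `]-oo, T]) (a * expR (- (a * T)) * (expR (a * s) * `|f s|))%:E)%E.
Proof.
move=> a0 mf; pose F s := (exponential_pdf a (T - s) * `|f s|)%:E.
have mF : measurable_fun setT F.
  apply: measurable_EFin_comp; apply: measurable_funM; last exact: measurableT_comp.
  by apply: (measurableT_comp (measurable_exponential_pdf a)); exact: measurable_funB.
rewrite [RHS]integral_mkcond.
transitivity (\int[mu]_s F s)%E; last first.
  apply: eq_integral => s _; rewrite /F patchE /exponential_pdf patchE.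
  have -> : (T - s \in `[0, +oo[%classic) = (s \in `]-oo, T]%classic).
    by apply/idP/idP; rewrite !inE/= !in_itv/= andbT subr_ge0.
  case: ifP => _; last by rewrite mul0r.
  by rewrite -!mulrA; congr (_ * _)%:E; rewrite mulrA -expRD; congr (expR _ * _); ring.
rewrite -(ge0_integral_aff true T mF); last first.
  by move=> s; rewrite lee_fin mulr_ge0// exponential_pdf_ge0.
by apply: eq_integral => t _; rewrite /F affE subKr.
Qed.

Lemma mass_exponential_pdfE f T : measurable_fun setT f -> 0 < a ->
  (\int[mu]_t (exponential_pdf a t * `|f (T - t)|)%:E =
   (a * expR (- (a * T)))%:E * mass `]-oo, T] f)%E.
Proof.
move=> mf a0; rewrite (mass_exponential_pdf _ (ltW a0))// -ge0_integralZl//.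
  by apply: measurable_funTS; exact: measurable_mass.
by rewrite lee_fin mulr_ge0 ?expR_ge0// ltW.
Qed.

(* Jensen for the exponential density. *)
Lemma mass_inLp (p : R) (p1 : (1 <= p%:E)%E) f T (K : R) : 1 <= a -> inLp p f -> 0 <= K ->
  (Np p f <= (K `^ p)%:E)%E -> (mass `]-oo, T] f <= (expR (a * T) * K)%:E)%E.
Proof.
move=> a1 [mf _] K0 fK; have a0 : 0 < a by rewrite (lt_le_trans ltr01).
have p_1 := p_ge1 p1; have p0 := p_gt0 p1.
have E := mass_exponential_pdfE T mf a0.
set J := integral _ _ _ in E.
have mfT : measurable_fun setT (fun t : R => `|f (T - t)|).
  by apply: measurableT_comp => //; apply: (measurableT_comp mf); exact: measurable_funB.
have mfp : measurable_fun setT (fun t : R => `|f (T - t)| `^ p).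
  exact: (measurableT_comp (measurable_powR p)).
have J0 : (0 <= J)%E.
  by apply: integral_ge0 => t _; rewrite lee_fin mulr_ge0// exponential_pdf_ge0// ltW.
(* The density is at most [a]. As [a] and [p] are at least 1, [a <= a ^ p], and the bound becomes
   the p-th power of [a * K]. *)
have jen : (J `^ p <= (a * K `^ p)%:E)%E.
  apply: (le_trans (jensen_powR p_1 (measurable_exponential_pdf a) mfT _ _ _)) => //.
  - by move=> t; rewrite exponential_pdf_ge0// ltW.
  - exact: integral_exponential_pdf.
  apply: (@le_trans _ _ (\int[mu]_t (a * (`|f (T - t)| `^ p))%:E)%E).
    apply: le_integral_EFin.
    - by apply: measurable_funM => //; exact: measurable_exponential_pdf.
    - exact: measurable_funM.
    - by move=> t; rewrite mulr_ge0 ?powR_ge0// exponential_pdf_ge0// ltW.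
    - move=> t; rewrite ler_wpM2r ?powR_ge0// /exponential_pdf patchE.
      case: ifPn => [|_]; last exact: ltW.
      rewrite inE/= in_itv/= andbT => t0; rewrite ler_piMr ?(ltW a0)//.
      by rewrite -expR0 ler_expR mulNr oppr_le0 mulr_ge0// ltW.
  rewrite ge0_integralZ_EFin ?(ltW a0)//.
  rewrite EFinM; apply: lee_wpmul2l; first by rewrite lee_fin ltW.
  apply: le_trans fK.
  rewrite -(Np_aff p true T mf) /Np le_eqVlt; apply/orP; left; apply/eqP.
  by apply: eq_integral => t _; rewrite /= affE.
have {}jen : (J <= (a * K)%:E)%E.
  have aK : a * K `^ p <= (a * K) `^ p.
    rewrite powRM// ?(ltW a0)// ler_wpM2r ?powR_ge0//.
    by rewrite -{1}(powRr1 (ltW a0)) ler_powR.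
  have {jen} : (J `^ p <= ((a * K) `^ p)%:E)%E by apply: le_trans jen _; rewrite lee_fin.
  case: J J0 {E} => [j||] //.
    rewrite poweR_EFin !lee_fin => j0; rewrite leNgt => jK; rewrite leNgt.
    apply: contra jK => jK; rewrite gt0_ltr_powR// nnegrE//.
    by rewrite mulr_ge0// ltW.
  by rewrite poweRyr ?gt_eqF// leye_eq.
move: jen; rewrite E => h.
have a' : 0 < a * expR (- (a * T)) by rewrite mulr_gt0 ?expR_gt0.
rewrite -(@lee_pmul2l _ (a * expR (- (a * T)))%:E)//; apply: le_trans h _.
by rewrite -EFinM lee_fin !mulrA -[a * _ * expR _]mulrA -expRD addNr expR0 mulr1.
Qed.

Lemma normr_conv_le_expconv al be f x : 0 < a -> measurable_fun setT f -> exp_integrable f x ->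
  `|L al be f x| <= (`|al| + `|be|) / a * expconv a f x.
Proof.
move=> a0 mf fx; rewrite (le_trans (normr_conv_le _ _ mf fx))//.
have mfx := (exp_integrableP a x mf).1 fx.
rewrite /expconv /Rintegral mass_exponential_pdfE// fineM//; last first.
  by rewrite ge0_fin_numE// mass_ge0.
by rewrite /= -!mulrA mulKf ?gt_eqF.
Qed.

End convolution_bounds.

(** * Measurability of the extended data *)

Section measurable_extension.
Context (R : realType) (m q r : nat) (B : 'M[R]_(m + q, m + r)).
Local Notation mu := (@lebesgue_measure R).

Definition measurable_cV n (F : R -> 'cV[R]_n) :=
  forall i, measurable_fun setT (fun x => F x i 0).

Lemma measurable_cV_mulmx n1 n2 (M : 'M[R]_(n1, n2)) F :
  measurable_cV F -> measurable_cV (fun x => M *m F x).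
Proof.
move=> mF i; rewrite (_ : (fun x => _) = (fun x => \sum_j M i j * F x j 0)).
  by apply: measurable_sum => j; exact: measurable_funM.
by apply/funext => x; rewrite !mxE.
Qed.

Lemma measurable_cVD n (F G : R -> 'cV[R]_n) : measurable_cV F -> measurable_cV G ->
  measurable_cV (fun x => F x + G x).
Proof.
move=> mF mG i; rewrite (_ : (fun x => _) = (fun x => F x i 0 + G x i 0)).
  exact: measurable_funD.
by apply/funext => x; rewrite !mxE.
Qed.

Lemma measurable_cV_sum n k (F : 'I_k -> R -> 'cV[R]_n) : (forall j, measurable_cV (F j)) ->
  measurable_cV (fun x => \sum_j F j x).
Proof.
move=> mF i; rewrite (_ : (fun x => _) = (fun x => \sum_j F j x i 0)).
  by apply: measurable_sum => j; exact: mF.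
by apply/funext => x; rewrite summxE.
Qed.

Lemma measurable_cV_comp n (F : R -> 'cV[R]_n) (g : R -> R) : measurable_fun setT g ->
  measurable_cV F -> measurable_cV (fun x => F (g x)).
Proof. by move=> mg mF i; exact: (measurableT_comp (mF i)). Qed.

Let A (k : nat) : set (measurableTypeR R) := `]- k%:R, 1 - k%:R[%classic.

Let AE k y : A k y <-> 0 < k%:R + y < 1.
Proof.
rewrite /A /= in_itv/=; split => /andP[h1 h2]; apply/andP; split; lra.
Qed.

(** The level set is the interval [A n]; for [n = 0] it also contains the points in none of the
    intervals, where the default value is taken. *)
Lemma shift_index_measurable n : measurable [set y : measurableTypeR R | shift_index y = n].
Proof.
have mA k : measurable (A k) by exact: measurable_itv.
rewrite (_ : [set y | _] = A n `|` (if n is 0 then ~` \bigcup_k A k else set0)).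
  apply: measurableU => //; case: n => // .
  by apply: measurableC; exact: bigcup_measurable.
apply/seteqP; split => y /=.
  have [[k _ Ak]|nA] := pselect ((\bigcup_k A k) y).
    by move: (Ak) => /AE/shift_index_uniq -> <-; left.
  suff -> : shift_index y = 0%N by move=> <-; right.
  rewrite /shift_index; case: xgetP => // k _ /= /AE Ak.
  by exfalso; apply: nA; exists k.
case=> [/AE/shift_index_uniq //|]; case: n => // nA.
rewrite /shift_index; case: xgetP => // k _ /= /AE Ak.
by exfalso; apply: nA; exists k.
Qed.

(** On each of the countably many level sets of [shift_index] the number of terms is fixed and the
    formula is plainly measurable. *)
Lemma measurable_Uf fu fw : measurable_cV fu -> measurable_cV fw ->
  measurable_cV (Uf B fu fw).
Proof.
move=> mfu mfw i.
pose E n := [set y : measurableTypeR R | shift_index y = n].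
have -> : [set: R] = \bigcup_n E n.
  by apply/seteqP; split => y // _; exists (shift_index y).
apply/measurable_fun_bigcup => n; first exact: shift_index_measurable.
pose G y : 'cV[R]_m := ulsubmx B ^+ n *m fu (n%:R + y) +
  \sum_(k < n) ulsubmx B ^+ k *m ursubmx B *m fw (- y - k%:R).
apply: (@eq_measurable_fun _ _ _ _ _ (fun y => G y i 0)).
  by move=> y; rewrite inE /E/= => yn; rewrite /Uf yn.
apply: measurable_funTS; move: i; apply: measurable_cVD.
  apply: measurable_cV_mulmx; apply: (measurable_cV_comp (g := fun y => n%:R + y)) => //.
  exact: measurable_funD.
apply: measurable_cV_sum => k; apply: measurable_cV_mulmx.
by apply: (measurable_cV_comp (g := fun y => - y - k%:R)) => //; exact: measurable_funB.
Qed.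

Lemma measurable_Vf fu fv fw : measurable_cV fu -> measurable_cV fv -> measurable_cV fw ->
  measurable_cV (Vf B fu fv fw).
Proof.
move=> mfu mfv mfw i; rewrite (_ : (fun x => _) = (fun y => if 0 < y then fv y i 0 else
   (dlsubmx B *m Uf B fu fw (y + 1) + drsubmx B *m fw (- y)) i 0)).
  apply: measurable_fun_ifT.
  - by apply: measurable_fun_ltr.
  - exact: mfv.
  - move: i; apply: measurable_cVD; apply: measurable_cV_mulmx.
      apply: (measurable_cV_comp (g := fun y => y + 1)); first exact: measurable_funD.
      exact: measurable_Uf.
    apply: (measurable_cV_comp (g := fun y => - y)) => //.
    by apply: continuous_measurable_fun => x; exact: opp_continuous.

by apply/funext => y; rewrite /Vf; case: ifP.
Qed.

End measurable_extension.

(** * Weighted mass of the extended data *)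

Section extension_mass.
Context (R : realType) (m q r : nat) (p : R) (p1 : (1 <= p%:E)%E).
Context (B : 'M[R]_(m + q, m + r)) (a : R) (a1 : 1 <= a).
Local Notation mu := (@lebesgue_measure R).
Local Notation X := (Xp m q r p1).
Local Notation mass := (mass a).
Variable phi : X.

Definition Uc i s := Uf B (uval phi) (wval phi) s i 0.
Definition Vc i s := Vf B (uval phi) (vval phi) (wval phi) s i 0.

(* The datum w, reflected so that it lies in the past. *)
Definition wpast k : R -> R := (phi.2 k \_ `]0, +oo[ : R -> R) \o aff true 0.

Lemma measurable_cV_uval : measurable_cV (uval phi).
Proof.
by move=> i; rewrite (_ : (fun x => _) = phi.1.1 i);
  [exact: measurable_Lp|apply/funext => x; rewrite mxE].
Qed.

Lemma measurable_cV_vval : measurable_cV (vval phi).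
Proof.
by move=> i; rewrite (_ : (fun x => _) = phi.1.2 i);
  [exact: measurable_Lp|apply/funext => x; rewrite mxE].
Qed.

Lemma measurable_cV_wval : measurable_cV (wval phi).
Proof.
by move=> i; rewrite (_ : (fun x => _) = phi.2 i);
  [exact: measurable_Lp|apply/funext => x; rewrite mxE].
Qed.

Lemma measurable_Uc i : measurable_fun setT (Uc i).
Proof. exact: (measurable_Uf B measurable_cV_uval measurable_cV_wval). Qed.

Lemma measurable_Vc i : measurable_fun setT (Vc i).
Proof. exact: (measurable_Vf B measurable_cV_uval measurable_cV_vval measurable_cV_wval). Qed.

Lemma inLp_wpast k : inLp p (wpast k).
Proof. by apply: inLp_aff; exact: inLp_patch. Qed.

Lemma measurable_wpast k : measurable_fun setT (wpast k).
Proof. by have [] := inLp_wpast k. Qed.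

Lemma wpastE k s : s < 0 -> wpast k s = wval phi (- s) k 0.
Proof.
by move=> s0; rewrite /wpast /= affE sub0r patchE mem_set/= ?in_itv/= ?oppr_gt0 ?s0// mxE.
Qed.

(** The right-hand side of the recursions for U and V at [s < 0], in scalar form. The trailing [+ 0]
    gives both sums the shape [sum + g] of [mass_sum_le] and [conv_sum]. *)
Definition inflow n (M : 'M[R]_(n, m)) (N : 'M[R]_(n, r)) i s :=
  \sum_j M i j * Uc j (s + 1) + (\sum_k N i k * wpast k s + 0).

Lemma measurable_shift (F : R -> R) (c : R) : measurable_fun setT F ->
  measurable_fun setT (fun s : R => F (s + c)).
Proof. by move=> mF; apply: (measurableT_comp mF); exact: measurable_funD. Qed.

Let measurable_wsum n (N : 'M[R]_(n, r)) i : measurable_fun setT (fun s => \sum_k N i k * wpast k s + 0).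
Proof.
apply: measurable_funD => //; apply: measurable_sum => k.
by apply: measurable_funM => //; exact: measurable_wpast.
Qed.

Lemma measurable_inflow n (M : 'M[R]_(n, m)) (N : 'M[R]_(n, r)) i : measurable_fun setT (inflow M N i).
Proof.
apply: measurable_funD => //; apply: measurable_sum => k.
by apply: measurable_funM => //; apply: measurable_shift; exact: measurable_Uc.
Qed.

Let inflowE n (M : 'M[R]_(n, m)) (N : 'M[R]_(n, r)) i s : s < 0 ->
  (M *m Uf B (uval phi) (wval phi) (s + 1) + N *m wval phi (- s)) i 0 = inflow M N i s.
Proof.
move=> s0; rewrite /inflow addr0 !mxE; congr (_ + _).
by apply: eq_bigr => k _; rewrite wpastE.
Qed.

Lemma Uc_inflow i : {ae mu, forall s, s < 0 -> Uc i s = inflow (ulsubmx B) (ursubmx B) i s}.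
Proof.
apply: filterS (ae_good R) => s gs s0.
by rewrite /Uc (Uf_neg _ _ _ gs s0) (inflowE _ _ _ s0).
Qed.

Lemma Vc_inflow i s : s < 0 -> Vc i s = inflow (dlsubmx B) (drsubmx B) i s.
Proof. by move=> s0; rewrite /Vc /Vf ltNge (ltW s0) (inflowE _ _ _ s0). Qed.

Lemma mass_wpast k : (mass `]-oo, 0%R] (wpast k) <= `|phi|%:E)%E.
Proof.
apply: (le_trans (mass_inLp p1 0 a1 (inLp_wpast k) (normr_ge0 phi) _)).
  rewrite Np_aff; last exact: measurable_patch_Lp.
  by rewrite Np_patch lee_fin ge0_ler_powR ?nnegrE ?norm_w_le// ltW// (p_gt0 p1).
by rewrite mulr0 expR0 mul1r.
Qed.

(** The terms in U live on [D] shifted by 1 and gain the factor [e^(- a)]; those in [w] are bounded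
    by [|phi|] through [mass_wpast]. *)
Lemma mass_inflow n (M : 'M[R]_(n, m)) (N : 'M[R]_(n, r)) i (D : set (measurableTypeR R)) (C : R) : measurable D ->
  D `<=` `]-oo, 0] ->
  (forall j, mass (aff false (-1) @^-1` D) (Uc j) <= (C * `|phi|)%:E)%E ->
  (mass D (inflow M N i) <= ((\sum_j `|M i j|) * expR (- a) * C * `|phi| +
     (\sum_k `|N i k|) * `|phi|)%:E)%E.
Proof.
move=> mD D0 UC.
apply: (le_trans (mass_sum_le _ _ _ _ _)) => //.
  by move=> j; apply: measurable_shift; exact: measurable_Uc.
rewrite EFinD; apply: leeD.
  rewrite -!mulrA mulr_suml -sumEFin; apply: lee_sum => j _.
  rewrite EFinM; apply: lee_wpmul2l => //.
  have -> : D = aff false 1 @^-1` (aff false (-1) @^-1` D).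
    by apply/seteqP; split=> s /=; rewrite !affE addrK.
  rewrite mass_shift; [|exact: measurable_aff_preimage|exact: measurable_Uc].
  by rewrite mulr1 EFinM; apply: lee_wpmul2l; rewrite ?lee_fin ?expR_ge0.
apply: (le_trans (mass_sum_le _ _ _ _ _)) => //; first by move=> k; exact: measurable_wpast.
rewrite mass0 adde0 mulr_suml -sumEFin; apply: lee_sum => k _.
rewrite EFinM; apply: lee_wpmul2l => //.
apply: le_trans (mass_wpast k); apply: mass_subset => //; exact: measurable_wpast.
Qed.

Section small.
Variables (C : R).
Hypothesis hC : expR a <= C.
Hypothesis hC2 : forall i, (\sum_j `|ulsubmx B i j|) * expR (- a) * C + \sum_k `|ursubmx B i k| + expR a <= C.

Let mass_Uc01 i : (mass `[0%R, 1%R] (Uc i) <= (expR a * `|phi|)%:E)%E.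
Proof.
pose f := (phi.1.1 i : R -> R) \_ `]0, 1[.
have Lf : inLp p f by exact: inLp_patch.
have mf : measurable_fun setT f by case: Lf.
apply: (@le_trans _ _ (mass `]-oo, 1%R] f)).
  apply: (@le_trans _ _ (mass `[0%R, 1%R] f)); last first.
    by apply: mass_subset => //; apply: subset_itvr.
  apply: le_mass => //; first exact: measurable_Uc.
  apply: filterS2 (ae_neq 0) (ae_neq 1) => s s0 s1 /=; rewrite in_itv/= => /andP[s0' s1'].
  have s01 : 0 < s < 1 by rewrite !lt_neqAle s0' s1' s1 eq_sym s0.
  by rewrite /Uc (Uf_pos _ _ _ s01) /f patchE mem_set/= ?in_itv//= mxE.
apply: (le_trans (mass_inLp p1 1 a1 Lf (normr_ge0 phi) _)); last by rewrite mulr1.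
by rewrite Np_patch lee_fin ge0_ler_powR ?nnegrE ?norm_u_le// ltW// (p_gt0 p1).
Qed.

(** The recursion sends [[- (n + 1), 0[] into [[- n, 1[], where the induction hypothesis applies.
    Adding the mass on [[0, 1]], the hypothesis [hC2] returns the same constant [C], whatever
    [n]. *)
Let mass_Ucn n i : (mass `[(- n%:R)%R, 1%R] (Uc i) <= (C * `|phi|)%:E)%E.
Proof.
elim: n i => [|n IH] i.
  rewrite oppr0; apply: (le_trans (mass_Uc01 i)).
  by rewrite lee_fin ler_wpM2r.
have -> : `[- n.+1%:R, 1]%classic = `[- n.+1%:R, 0[%classic `|` `[0, 1]%classic :> set R.
  by apply: itv_bndbnd_setU; rewrite bnd_simp// oppr_le0.
rewrite mass_setU//; last 2 first.
- exact: measurable_Uc.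
- apply/disj_setPLR => s /=; rewrite !in_itv/= => /andP[_ s0].
  by rewrite leNgt s0.
have mI := measurable_inflow (ulsubmx B) (ursubmx B) i.
have h1 : (mass `[(- n.+1%:R)%R, 0%R[ (Uc i) <= mass `[(- n.+1%:R)%R, 0%R[ (inflow (ulsubmx B) (ursubmx B) i))%E.
  apply: le_mass => //; first exact: measurable_Uc.
  by apply: filterS (Uc_inflow i) => s h /=; rewrite in_itv/= => /andP[_ s0]; rewrite h.
have h2 : (mass `[(- n.+1%:R)%R, 0%R[ (inflow (ulsubmx B) (ursubmx B) i) <=
    ((\sum_j `|ulsubmx B i j|) * expR (- a) * C * `|phi| + (\sum_k `|ursubmx B i k|) * `|phi|)%:E)%E.
  apply: mass_inflow => //.
    by move=> s /=; rewrite !in_itv/= => /andP[_ /ltW].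
  move=> j; apply: le_trans (IH j); apply: mass_subset => //.
  - exact: measurable_aff_preimage.
  - exact: measurable_Uc.
  - move=> s /=; rewrite affE !in_itv/= -natr1 => /andP[s1 s2]; apply/andP; split; lra.
apply: (le_trans (leeD (le_trans h1 h2) (mass_Uc01 i))).
rewrite -EFinD lee_fin.
apply: le_trans (ler_wpM2r (normr_ge0 phi) (hC2 i)).
by rewrite !mulrDl.
Qed.

Lemma mass_Uc i : (mass `]-oo, 1%R] (Uc i) <= (C * `|phi|)%:E)%E.
Proof.
have E : `]-oo, 1]%classic = \bigcup_n `[- n%:R, 1]%classic :> set R.
  apply/seteqP; split => s /=; last by case=> n _ /=; rewrite !in_itv/= => /andP[].
  rewrite in_itv/= => s1; exists (Num.truncn (- s)).+1 => //=.
  by rewrite in_itv/= s1 andbT lerNl ltW// truncnS_gt.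
have := @ge0_nondecreasing_set_cvg_integral _ _ _
  (fun n => `[- n%:R, 1]%classic : set (measurableTypeR R)) (fun s => (expR (a * s) * `|Uc i s|)%:E) mu.
rewrite -E => h; have {}h := h _ _ _ _.
have -> : mass `]-oo, 1%R] (Uc i) = limn (fun n => mass `[(- n%:R)%R, 1%R] (Uc i)).
  apply/esym/cvg_lim => //; apply: h.
  - move=> n k nk; apply/subsetPset; apply: subset_itvr; rewrite bnd_simp lerN2 ler_nat//.
  - by move=> n; exact: measurable_itv.
  - by move=> n; apply: measurable_funTS; apply: measurable_mass; exact: measurable_Uc.
  - by move=> n s _; rewrite lee_fin mulr_ge0 ?expR_ge0.
apply: lime_le; last by apply: nearW => n; exact: mass_Ucn.
apply/cvg_ex; exists (mass `]-oo, 1%R] (Uc i)); apply: h.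
- move=> n k nk; apply/subsetPset; apply: subset_itvr; rewrite bnd_simp lerN2 ler_nat//.
- by move=> n; exact: measurable_itv.
- by move=> n; apply: measurable_funTS; apply: measurable_mass; exact: measurable_Uc.
- by move=> n s _; rewrite lee_fin mulr_ge0 ?expR_ge0.
Qed.

End small.
End extension_mass.

(** * L^p bounds for the causal convolution *)

Section resolvent_bounds.
Context (R : realType) (p : R) (p1 : (1 <= p%:E)%E) (a b : R) (a1 : 1 <= a).
Local Notation mu := (@lebesgue_measure R).
Local Notation mass := (mass a).
Local Notation exp_integrable := (exp_integrable a).
Implicit Types (f g : R -> R) (al be x T K : R).
Local Notation D0y := (measurable_itv (Interval (BRight (0:R)) (BInfty R false))).

Let a0 : 0 < a. Proof. exact: lt_le_trans a1. Qed.

Lemma exp_integrable_inLp f T K : inLp p f -> 0 <= K -> (Np p f <= (K `^ p)%:E)%E ->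
  exp_integrable f T.
Proof.
move=> Lf K0 fK; apply/exp_integrableP; first by case: Lf.
exact: le_lt_trans (mass_inLp p1 T a1 Lf K0 fK) (ltry _).
Qed.

(** The p-th power is [e^(- a p x)], which is below the exponential density of rate [a p >= 1]. *)
Lemma Np_exp_decay : (Np p ((fun x => expR (- (a * x))) \_ `]0%R, +oo[) <= 1%:E)%E.
Proof.
have p0 := p_gt0 p1; have p_1 := p_ge1 p1; have ap : 0 < a * p by rewrite mulr_gt0.
have ap1 : 1 <= a * p by rewrite mulr_ege1.
rewrite -(integral_exponential_pdf ap).
apply: le_integral_EFin.
- apply: (measurableT_comp (measurable_powR _)); apply: measurableT_comp => //.
  apply/(measurable_restrictT _ (measurable_itv _))/measurable_funTS.
  by apply: measurableT_comp => //; apply: measurableT_comp => //; exact: measurable_funM.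
- exact: measurable_exponential_pdf.
- by move=> x; exact: powR_ge0.
- move=> x; rewrite patchE; case: ifPn => [|_]; last first.
    by rewrite normr0 powR0 ?gt_eqF// exponential_pdf_ge0// ltW.
  rewrite inE/= in_itv/= andbT => x0.
  rewrite ger0_norm ?expR_ge0// /exponential_pdf patchE mem_set/=; last by rewrite in_itv/= ltW.
  rewrite /powR gt_eqF ?expR_gt0// expRK.
  rewrite (_ : p * - (a * x) = - (a * p) * x); last by ring.
  by rewrite ler_peMl ?expR_ge0.
Qed.

Lemma Np_conv01 al be f K : measurable_fun setT f -> 0 <= K ->
  (mass `]-oo, 1%R] f <= K%:E)%E ->
  (Np p (conv a b al be f \_ `]0%R, 1%R[) <= (((`|al| + `|be|) * K) `^ p)%:E)%E.
Proof.
move=> mf K0 fK; have mc := measurable_conv a b al be mf.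
have K0' : 0 <= (`|al| + `|be|) * K by rewrite mulr_ge0 ?addr_ge0.
rewrite (Np_restrict p1).
apply: (@le_trans _ _ (\int[mu]_(x in `]0%R, 1%R[) cst ((((`|al| + `|be|) * K) `^ p)%:E) x)%E).
  apply: ge0_le_integral => //.
  - by apply: measurable_funTS; exact: measurable_powRabs.
  - move=> x /=; rewrite in_itv/= => /andP[x0 x1]; rewrite lee_fin.
    have fx : exp_integrable f 1 by apply/exp_integrableP => //; rewrite (le_lt_trans fK) ?ltry.
    have fx' := exp_integrableS (ltW x1) fx.
    rewrite ge0_ler_powR ?nnegrE ?(ltW (p_gt0 p1))//.
    rewrite (le_trans (normr_conv_le _ _ _ mf fx'))//.
    rewrite -mulrA ler_wpM2l ?addr_ge0// -[leRHS]mul1r.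
    have m0 := mass_ge0 a `]-oo, x] f.
    have mK : (mass `]-oo, x] f <= K%:E)%E.
      apply: le_trans fK; apply: mass_subset => //.
      by apply: subset_itvl; rewrite bnd_simp ltW.
    apply: ler_pM; rewrite ?expR_ge0 ?fine_ge0//.
      by rewrite -expR0 ler_expR oppr_le0 mulr_ge0// ltW.
    rewrite -lee_fin fineK// ge0_fin_numE//; exact: le_lt_trans mK (ltry _).
have mu01 : mu `]0, 1[%classic = 1%E by rewrite lebesgue_measure_itv/= lte_fin ltr01 sube0.
by rewrite integral_cst// [X in (_ * X)%E]mu01 mule1.
Qed.

Lemma Np_expconv_le (c : R) f K : 0 <= c -> inLp p f -> 0 <= K ->
  (Np p f <= (K `^ p)%:E)%E ->
  (Np p (fun x => (c / a * expconv a f x)%R) <= ((c * K) `^ p)%:E)%E.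
Proof.
move=> c0 Lf K0 fK.
have mf : measurable_fun setT f by case: Lf.
rewrite NpZ; last exact: measurable_expconv.
rewrite powRM// EFinM; apply: lee_pmul; [by rewrite lee_fin powR_ge0|exact: Np_ge0| |].
  rewrite lee_fin ge0_ler_powR ?nnegrE ?(ltW (p_gt0 p1))//.
  by rewrite ger0_norm ?divr_ge0 ?(ltW a0)// ler_pdivrMr// ler_peMr.
exact: le_trans (expconv_Lp p1 Lf a0) fK.
Qed.

Lemma Np_conv_past al be f K : inLp p f -> 0 <= K -> (Np p f <= (K `^ p)%:E)%E ->
  (Np p ((fun x => conv a b al be f (- x))%R \_ `]0%R, +oo[) <= (((`|al| + `|be|) * K) `^ p)%:E)%E.
Proof.
move=> Lf K0 fK; have mf : measurable_fun setT f by case: Lf.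
have mc : measurable_fun setT (fun x => conv a b al be f (- x)).
  apply: (measurableT_comp (measurable_conv a b al be mf)).
  by apply: continuous_measurable_fun => x; exact: opp_continuous.
have me : measurable_fun setT (fun x => (`|al| + `|be|) / a * expconv a f x).
  by apply: measurable_funM => //; exact: measurable_expconv.
apply: (le_trans _ (Np_expconv_le _ Lf K0 fK)); last by rewrite addr_ge0.
have le_e (x : R) : `|conv a b al be f x| <= (`|al| + `|be|) / a * expconv a f x.
  exact: (normr_conv_le_expconv b al be a0 mf (exp_integrable_inLp x Lf K0 fK)).
rewrite -(Np_aff p true 0 me); apply: (le_Np p1).
- by apply/(measurable_restrictT _ D0y); exact: measurable_funTS.
- by apply: measurableT_comp => //; exact: measurable_aff.
- apply: aeW => x; rewrite patchE; case: ifP => _; last by rewrite normr0.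
  rewrite /= affE sub0r (le_trans (le_e _))// ler_norm//.
Qed.

(** The L^p part [f] is handled by Jensen, whereas the contribution of the finite mass of [g] decays
    like [e^(- a x)]. *)
Lemma Np_conv0y al be f g K K' : inLp p f -> 0 <= K -> (Np p f <= (K `^ p)%:E)%E ->
  measurable_fun setT g -> 0 <= K' -> (mass setT g <= K'%:E)%E ->
  (Np p (conv a b al be (fun s => 1 * f s + g s)%R \_ `]0%R, +oo[) <=
    ((6 * ((`|al| + `|be|) * (K + K'))) `^ p)%:E)%E.
Proof.
move=> Lf K0 fK mg K'0 gK'; have mf : measurable_fun setT f by case: Lf.
set c := `|al| + `|be|; have c0 : 0 <= c by rewrite addr_ge0.
have mfg : measurable_fun setT (fun s => 1 * f s + g s).
  by apply: measurable_funD => //; exact: measurable_funM.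
have mc := measurable_conv a b al be mfg.
pose h1 x := c / a * expconv a f x.
pose h2 x := c * K' * ((fun x => expR (- (a * x))) \_ `]0, +oo[) x.
have mh1 : measurable_fun setT h1 by apply: measurable_funM => //; exact: measurable_expconv.
have md : measurable_fun setT ((fun x : R => expR (- (a * x))) \_ `]0, +oo[).
  apply/(measurable_restrictT _ (measurable_itv _))/measurable_funTS.
  by apply: measurableT_comp => //; apply: measurableT_comp => //; exact: measurable_funM.
have mh2 : measurable_fun setT h2 by exact: measurable_funM.
have g0 x : exp_integrable g x.
  apply/exp_integrableP => //; apply: le_lt_trans (ltry K'); apply: le_trans gK'.
  exact: mass_subset.
have f0 x := exp_integrable_inLp x Lf K0 fK.
have KK : 0 <= c * (K + K') by rewrite mulr_ge0 ?addr_ge0.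
have pw (u v : R) : 0 <= u -> u <= v -> u `^ p <= v `^ p.
  move=> u0 uv; apply: ge0_ler_powR => //; first exact: ltW (p_gt0 p1).
  by rewrite nnegrE (le_trans u0).
have Nh1 : (Np p h1 <= ((c * (K + K')) `^ p)%:E)%E.
  apply: (le_trans (Np_expconv_le c0 Lf K0 fK)).
  by rewrite lee_fin; apply: pw; rewrite ?mulr_ge0// ler_wpM2l// lerDl.
have Nh2 : (Np p h2 <= ((c * (K + K')) `^ p)%:E)%E.
  rewrite NpZ// -[leRHS]mule1; apply: lee_pmul; [by rewrite lee_fin powR_ge0|exact: Np_ge0| |exact: Np_exp_decay].
  rewrite lee_fin ger0_norm ?mulr_ge0//; apply: pw; rewrite ?mulr_ge0//.
  by rewrite ler_wpM2l// lerDr.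
apply: (@le_trans _ _ (Np p (fun x => h1 x + h2 x + 0)%R)).
  apply: (le_Np p1).
  - by apply/(measurable_restrictT _ D0y); exact: measurable_funTS.
  - by apply: measurable_funD => //; exact: measurable_funD.
  - apply: aeW => x; rewrite patchE; case: ifPn => [|_]; last by rewrite normr0.
    rewrite inE/= in_itv/= andbT => x0; rewrite addr0 conv_linear// mul1r.
    have b1 := normr_conv_le_expconv b al be a0 mf (f0 x).
    have b2 : `|conv a b al be g x| <= h2 x.
      rewrite (le_trans (normr_conv_le _ _ _ mg (g0 x)))//.
      rewrite /h2 patchE mem_set/=; last by rewrite in_itv/= x0.
      rewrite -/c mulrAC ler_wpM2r ?expR_ge0// ler_wpM2l//.
      rewrite -lee_fin fineK; first by apply: le_trans gK'; exact: mass_subset.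
      by rewrite ge0_fin_numE ?mass_ge0//; exact/exp_integrableP.
    rewrite (le_trans (ler_normD _ _))// [leRHS]ger0_norm; first exact: lerD.
    by rewrite addr_ge0 ?(le_trans _ b1) ?(le_trans _ b2).
apply: (le_trans (NpD3 p1 mh1 mh2 (measurable_cst _))).
have -> : Np p (fun=> 0) = 0%E.
  rewrite /Np; under eq_integral do rewrite normr0 powR0 ?gt_eqF ?p_gt0//.
  exact: integral0.
rewrite adde0; apply: (@le_trans _ _ ((3 `^ p)%:E * (((c * (K + K')) `^ p)%:E + ((c * (K + K')) `^ p)%:E))%E).
  by apply: lee_wpmul2l (leeD Nh1 Nh2); rewrite lee_fin powR_ge0.
(* The 6 is 3 times 2: [3 ^ p] comes from [NpD3], and two equal terms are absorbed by
   [2 <= 2 ^ p]. *)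
have -> : (6 * (c * (K + K'))) `^ p = 3 `^ p * (2 `^ p * (c * (K + K')) `^ p).
  rewrite (_ : 6 * _ = 3 * (2 * (c * (K + K')))); last by ring.
  have Y0 : 0 <= 2 * (c * (K + K')) by rewrite mulr_ge0.
  by rewrite (powRM _ _ Y0)// (powRM _ _ KK).
rewrite -EFinD -EFinM lee_fin ler_wpM2l ?powR_ge0//.
set Y := _ `^ p; have -> : Y + Y = 2 * Y by ring.
have h2' : (2 : R) <= 2 `^ p.
  by rewrite -[X in X <= _](@powRr1 _ 2)// ler_powR ?(p_ge1 p1)// ler1n.
by rewrite ler_wpM2r// powR_ge0.
Qed.

End resolvent_bounds.

(** * Cosine and sine transforms of T *)

Section real_resolvent.
Context (R : realType) (m q r : nat) (p : R) (p1 : (1 <= p%:E)%E).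
Context (B : 'M[R]_(m + q, m + r)) (a b : R).
Local Notation mu := (@lebesgue_measure R).
Local Notation X := (Xp m q r p1).
Local Notation D01 := (measurable_itv (Interval (BRight (0:R)) (BLeft (1:R)))).
Local Notation D0y := (measurable_itv (Interval (BRight (0:R)) (BInfty R false))).
Local Notation L := (conv a b).
Local Notation exp_integrable := (exp_integrable a).
Implicit Types (phi : X) (al be x : R).

(* The Laplace transform of T(t) phi against e^(- a t) (al cos b t + be sin b t). *)
Definition Zr al be phi : X :=
  ([ffun i => cls p1 D01 (L al be (Uc B phi i))],
   [ffun i => cls p1 D0y (L al be (Vc B phi i))],
   [ffun k => cls p1 D0y (fun x => L al be (wpast phi k) (- x))]).

(* Beyond this growth rate the reflections at the boundary are contractive. *)
Definition growth : R := 1 + 2 * \sum_i \sum_j `|ulsubmx B i j|.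

Hypothesis ga : growth < a.

Let a1 : 1 <= a.
Proof.
apply: le_trans (ltW ga); rewrite /growth lerDl mulr_ge0//.
by apply: sumr_ge0 => i _; exact: sumr_ge0.
Qed.

Let a0 : 0 < a. Proof. exact: lt_le_trans a1. Qed.

(** Solves [C = C / 2 + (sum of the entries of B12) + e^a], entries in absolute value: the mass
    recursion with contraction factor 1/2. *)
Definition Cu : R := 2 * (expR a + \sum_i \sum_j `|ursubmx B i j|).

Let sum2_ge0 n1 n2 (M : 'M[R]_(n1, n2)) : 0 <= \sum_i \sum_j `|M i j|.
Proof. by apply: sumr_ge0 => i _; exact: sumr_ge0. Qed.

Let row_le n1 n2 (M : 'M[R]_(n1, n2)) i : \sum_j `|M i j| <= \sum_i \sum_j `|M i j|.
Proof. by rewrite [leRHS](bigD1 i)//= lerDl; apply: sumr_ge0 => k _; exact: sumr_ge0. Qed.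

Let Cu_ge : expR a <= Cu.
Proof.
rewrite /Cu mulr_natl mulr2n -addrA lerDl addr_ge0// addr_ge0// expR_ge0//.
Qed.

Let Cu0 : 0 <= Cu. Proof. by rewrite (le_trans _ Cu_ge)// expR_ge0. Qed.

Let Cu_contract i : (\sum_j `|ulsubmx B i j|) * expR (- a) * Cu + \sum_k `|ursubmx B i k| + expR a <= Cu.
Proof.
(* Twice the sum of the entries of [B11] is below [growth B < a], and [a <= 1 + a <= e^a]. *)
have half : (\sum_j `|ulsubmx B i j|) * expR (- a) <= 2^-1.
  rewrite expRN ler_pdivrMr ?expR_gt0// (le_trans (row_le _ i))//.
  rewrite -ler_pdivrMl ?invr_gt0// invrK (le_trans _ (expR_ge1Dx a))//.
  by rewrite (le_trans (ltW (lt_le_trans _ (ltW ga))) _)// ?lerDr// ltrDr.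
have h := ler_wpM2r Cu0 half; have h2 := row_le (ursubmx B) i.
apply: (@le_trans _ _ (2^-1 * Cu + \sum_i \sum_j `|ursubmx B i j| + expR a)).
  by rewrite lerD2r lerD.
rewrite /Cu mulKf ?pnatr_eq0// -addrA [_ + expR a]addrC mulr_natl mulr2n lexx//.
Qed.

Lemma mass_Uc1 phi i : (mass a `]-oo, 1%R] (Uc B phi i) <= (Cu * `|phi|)%:E)%E.
Proof. exact: mass_Uc. Qed.

Lemma exp_integrable_Uc phi i T : T <= 1 -> exp_integrable (Uc B phi i) T.
Proof.
move=> T1; apply: exp_integrableS T1 _; apply/exp_integrableP; first exact: measurable_Uc.
exact: le_lt_trans (mass_Uc1 phi i) (ltry _).
Qed.

Lemma Np_wpast phi k : (Np p (wpast phi k) <= (`|phi| `^ p)%:E)%E.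
Proof.
rewrite Np_aff; last exact: measurable_patch_Lp.
by rewrite Np_patch lee_fin ge0_ler_powR ?nnegrE ?norm_w_le// ltW// (p_gt0 p1).
Qed.

Lemma exp_integrable_wpast phi k T : exp_integrable (wpast phi k) T.
Proof.
exact: (exp_integrable_inLp p1 a1 T (inLp_wpast phi k) (normr_ge0 phi) (Np_wpast phi k)).
Qed.

Lemma exp_integrable_inflow phi n (M : 'M[R]_(n, m)) (N : 'M[R]_(n, r)) al be i :
  exp_integrable (inflow B phi M N i) 0 /\
  L al be (inflow B phi M N i) 0 =
    \sum_j M i j * L al be (Uc B phi j) 1 + \sum_k N i k * L al be (wpast phi k) 0.
Proof.
have [h1 E1] := @conv_sum R a b al be _ (N i) (wpast phi) (fun=> 0) 0
  (fun k => exp_integrable_wpast phi k 0) (exp_integrable0 a 0).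
have hU j : exp_integrable (fun s => Uc B phi j (s + 1)) 0.
  apply/exp_integrableP; first by apply: measurable_shift; exact: measurable_Uc.
  have -> : `]-oo, 0]%classic = aff false 1 @^-1` `]-oo, 1] :> set R.
    by apply/seteqP; split=> s /=; rewrite affE !in_itv/= gerDr.
  rewrite mass_shift//; last exact: measurable_Uc.
  rewrite lte_mul_pinfty ?lee_fin ?expR_ge0//; exact: le_lt_trans (mass_Uc1 phi j) (ltry _).
have [h2 E2] := @conv_sum R a b al be _ (M i) (fun j s => Uc B phi j (s + 1)) _ 0 hU h1.
split; first exact: h2.
rewrite [LHS]E2 E1; congr (_ + _).
  apply: eq_bigr => j _; congr (_ * _); rewrite conv_shift add0r//.
  exact: exp_integrable_Uc.
rewrite (_ : L al be (fun=> 0) 0 = 0) ?addr0// /conv.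
by under eq_Rintegral do rewrite mulr0; rewrite Rintegral_cst// mul0r.
Qed.

(** The recursion integrated against the kernel: the shift by 1 moves the evaluation point of U from
    0 to 1. This is the first block row of the boundary condition for the resolvent. *)
Lemma conv_Uc0 phi al be i : L al be (Uc B phi i) 0 =
  \sum_j ulsubmx B i j * L al be (Uc B phi j) 1 + \sum_k ursubmx B i k * L al be (wpast phi k) 0.
Proof.
have [_ <-] := exp_integrable_inflow phi (ulsubmx B) (ursubmx B) al be i.
apply: conv_ae; [exact: measurable_Uc|exact: measurable_inflow|exact: Uc_inflow].
Qed.

Lemma conv_Vc0 phi al be i : L al be (Vc B phi i) 0 =
  \sum_j dlsubmx B i j * L al be (Uc B phi j) 1 + \sum_k drsubmx B i k * L al be (wpast phi k) 0.
Proof.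
have [_ <-] := exp_integrable_inflow phi (dlsubmx B) (drsubmx B) al be i.
apply: conv_ae; [exact: measurable_Vc|exact: measurable_inflow|].
by apply: aeW => s; exact: Vc_inflow.
Qed.

Definition Cv : R := expR (- a) * Cu * (\sum_i \sum_j `|dlsubmx B i j|) + \sum_i \sum_j `|drsubmx B i j|.

Let Cv0 : 0 <= Cv.
Proof. by rewrite addr_ge0// mulr_ge0// mulr_ge0// expR_ge0. Qed.

(** V is cut at 0 because its halves obey different bounds: the datum [v] is in L^p, the inflow on
    the left has finite weighted mass. *)
Let vpos phi i := (phi.1.2 i : R -> R) \_ `]0, +oo[.
Let vneg phi i := Vc B phi i \_ `]-oo, 0].

Let Vc_split phi i : Vc B phi i = (fun s => 1 * vpos phi i s + vneg phi i s).
Proof.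
apply/funext => s; rewrite mul1r /vpos /vneg !patchE; have [s0|s0] := leP s 0.
  rewrite memNset ?mem_set ?add0r//= in_itv/= ?s0//.
  by apply/negP; rewrite andbT -leNgt.
rewrite mem_set ?memNset ?addr0//= ?in_itv/= ?s0//; last by apply/negP; rewrite -ltNge.
by rewrite /Vc /Vf s0 mxE.
Qed.

Let mass_vneg phi i : (mass a setT (vneg phi i) <= (Cv * `|phi|)%:E)%E.
Proof.
rewrite mass_patch; apply: (@le_trans _ _ (mass a `]-oo, 0%R] (inflow B phi (dlsubmx B) (drsubmx B) i))).
  apply: le_mass => //; [exact: measurable_Vc|exact: measurable_inflow|].
  apply: filterS (ae_neq 0) => s s0 /=; rewrite in_itv/= => s0'.
  by rewrite Vc_inflow// lt_neqAle s0.
have h : (mass a `]-oo, 0%R] (inflow B phi (dlsubmx B) (drsubmx B) i) <=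
    ((\sum_j `|dlsubmx B i j|) * expR (- a) * Cu * `|phi| + (\sum_k `|drsubmx B i k|) * `|phi|)%:E)%E.
  apply: mass_inflow => // j; rewrite (_ : _ @^-1` _ = `]-oo, 1]%classic); first exact: mass_Uc1.
  by apply/seteqP; split=> s /=; rewrite affE !in_itv/= subr_le0.
apply: (le_trans h); rewrite lee_fin -mulrDl ler_wpM2r// /Cv lerD ?row_le//.
by rewrite -mulrA mulrC ler_wpM2l ?row_le// mulr_ge0 ?expR_ge0.
Qed.

Let inLp_vpos phi i : inLp p (vpos phi i). Proof. exact: inLp_patch. Qed.

Let Np_vpos phi i : (Np p (vpos phi i) <= (`|phi| `^ p)%:E)%E.
Proof. by rewrite Np_patch lee_fin ge0_ler_powR ?nnegrE ?norm_v_le// ltW// (p_gt0 p1). Qed.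

Let measurable_vneg phi i : measurable_fun setT (vneg phi i).
Proof.
by apply/(measurable_restrictT _ (measurable_itv _))/measurable_funTS; exact: measurable_Vc.
Qed.

Lemma exp_integrable_Vc phi i T : exp_integrable (Vc B phi i) T.
Proof.
rewrite Vc_split; apply: exp_integrable_linear.
  exact: (exp_integrable_inLp p1 a1 T (inLp_vpos phi i) (normr_ge0 phi) (Np_vpos phi i)).
apply/exp_integrableP => //; apply: le_lt_trans (ltry (Cv * `|phi|)).
by apply: le_trans (mass_vneg phi i); exact: mass_subset.
Qed.

Lemma Np_conv_Uc al be phi i :
  (Np p (L al be (Uc B phi i) \_ `]0%R, 1%R[) <= (((`|al| + `|be|) * (Cu * `|phi|)) `^ p)%:E)%E.
Proof. by apply: Np_conv01 => //; [exact: measurable_Uc|rewrite mulr_ge0|exact: mass_Uc1]. Qed.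

Lemma Np_conv_Vc al be phi i :
  (Np p (L al be (Vc B phi i) \_ `]0%R, +oo[) <=
   ((6 * ((`|al| + `|be|) * (`|phi| + Cv * `|phi|))) `^ p)%:E)%E.
Proof. by rewrite Vc_split; apply: Np_conv0y => //; rewrite mulr_ge0. Qed.

Lemma Np_conv_wpast al be phi k :
  (Np p ((fun x => L al be (wpast phi k) (- x))%R \_ `]0%R, +oo[) <=
   (((`|al| + `|be|) * `|phi|) `^ p)%:E)%E.
Proof. by apply: Np_conv_past => //; [exact: inLp_wpast|exact: Np_wpast]. Qed.

Lemma measurable_conv_Uc al be phi i : measurable_fun setT (L al be (Uc B phi i)).
Proof. by apply: measurable_conv; exact: measurable_Uc. Qed.

Lemma measurable_conv_Vc al be phi i : measurable_fun setT (L al be (Vc B phi i)).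
Proof. by apply: measurable_conv; exact: measurable_Vc. Qed.

Lemma measurable_conv_wpast al be phi k :
  measurable_fun setT (fun x => L al be (wpast phi k) (- x)).
Proof.
apply: (measurableT_comp (measurable_conv a b al be (measurable_wpast phi k))).
by apply: continuous_measurable_fun => x; exact: opp_continuous.
Qed.

Lemma norm_Zr al be : exists2 K, 0 <= K & forall phi, `|Zr al be phi| <= K * `|phi|.
Proof.
set c := `|al| + `|be|; have c0 : 0 <= c by rewrite addr_ge0.
have Cv1 : 0 <= 1 + Cv by rewrite addr_ge0.
exists (\sum_(i < m) c * Cu + \sum_(i < q) 6 * (c * (1 + Cv)) + \sum_(i < r) c).
  by apply: addr_ge0; [apply: addr_ge0|]; apply: sumr_ge0 => i _ //; do !apply: mulr_ge0 => //.
move=> phi; rewrite (le_trans (norm_Xp_le _))//.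
rewrite [leRHS]mulrDl [X in _ <= X + _]mulrDl !mulr_suml.
apply: lerD; [apply: lerD|]; apply: ler_sum => i _; rewrite ffunE.
- rewrite -mulrA; apply: norm_cls_le (Np_conv_Uc al be phi i); first exact: measurable_conv_Uc.
  by do !apply: mulr_ge0 => //.
- rewrite (_ : _ * `|phi| = 6 * (c * (`|phi| + Cv * `|phi|))); last by ring.
  apply: norm_cls_le (Np_conv_Vc al be phi i); first exact: measurable_conv_Vc.
  by do !apply: mulr_ge0 => //; rewrite addr_ge0// mulr_ge0.
- apply: norm_cls_le (Np_conv_wpast al be phi i); first exact: measurable_conv_wpast.
  by rewrite mulr_ge0.
Qed.

Lemma uval_Zr al be phi : {ae mu, forall x, 0 < x < 1 ->
  uval (Zr al be phi) x = \col_i L al be (Uc B phi i) x}.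
Proof.
apply: ae_col => i.
have := @clsE _ _ p1 _ D01 _ (measurable_conv_Uc al be phi i)
  (le_lt_trans (Np_conv_Uc al be phi i) (ltry _)).
by apply: filterS => x + x01; rewrite /= in_itv/= !mxE ffunE => /(_ x01).
Qed.

Lemma vval_Zr al be phi : {ae mu, forall x, 0 < x ->
  vval (Zr al be phi) x = \col_i L al be (Vc B phi i) x}.
Proof.
apply: ae_col => i.
have := @clsE _ _ p1 _ D0y _ (measurable_conv_Vc al be phi i)
  (le_lt_trans (Np_conv_Vc al be phi i) (ltry _)).
by apply: filterS => x + x01; rewrite /= in_itv/= andbT !mxE ffunE => /(_ x01).
Qed.

Lemma wval_Zr al be phi : {ae mu, forall x, 0 < x ->
  wval (Zr al be phi) x = \col_k L al be (wpast phi k) (- x)}.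
Proof.
apply: ae_col => i.
have := @clsE _ _ p1 _ D0y _ (measurable_conv_wpast al be phi i)
  (le_lt_trans (Np_conv_wpast al be phi i) (ltry _)).
by apply: filterS => x + x01; rewrite /= in_itv/= andbT !mxE ffunE => /(_ x01).
Qed.

End real_resolvent.

(** * The transforms lie in the domain of A_p *)

Section resolvent_graph.
Context (R : realType) (m q r : nat) (p : R) (p1 : (1 <= p%:E)%E).
Context (B : 'M[R]_(m + q, m + r)).
Local Notation mu := (@lebesgue_measure R).
Local Notation X := (Xp m q r p1).
Implicit Types (phi psi : X) (al be x : R).

Lemma ae_combination n (P : R -> bool) (val : X -> R -> 'cV[R]_n) :
  (forall (c : R) phi psi, {ae mu, forall x, P x ->
     val (c *: phi + psi) x = c *: val phi x + val psi x}) ->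
  forall (c1 c2 c3 : R) phi1 phi2 phi3, {ae mu, forall x, P x ->
    val (c1 *: phi1 + c2 *: phi2 + c3 *: phi3) x =
    c1 *: val phi1 x + c2 *: val phi2 x + c3 *: val phi3 x}.
Proof.
move=> vl c1 c2 c3 phi1 phi2 phi3.
(* The rule [vl] only covers sums [c *: phi + psi]; the last multiple is therefore written as
   one. *)
have E (c : R) (V : lmodType R) (v : V) : c *: v = (c - 1) *: v + v.
  by rewrite scalerBl scale1r subrK.
have h1 := vl c1 phi1 (c2 *: phi2 + c3 *: phi3); have h2 := vl c2 phi2 (c3 *: phi3).
have h3 := vl (c3 - 1) phi3 phi3.
apply: filterS (filterI h1 (filterI h2 h3)) => x [e1 [e2 e3]] Px.
rewrite -!addrA e1// e2// (E c3 X) e3//; congr (_ + (_ + _)).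
by rewrite -E.
Qed.

(** [Ap_form] quantifies over all [T], including negative ones. *)
Lemma AC_empty (s t : R) F f : t < s -> AC s t F f.
Proof.
move=> ts; split=> [|x /andP[sx xt]]; last by have := lt_le_trans ts (le_trans sx xt); rewrite ltxx.
rewrite (_ : `[s, t]%classic = set0); first exact: integrable_set0.
apply/seteqP; split=> z //=; rewrite in_itv/= => /andP[sz /(le_trans sz)].
by rewrite leNgt ts.
Qed.

Section fixed_parameter.
Variables (a b : R).
Hypothesis ga : growth B < a.
Local Notation Z := (Zr B a b).

(** The derivative comes from [AC_conv] and the boundary condition from [conv_Uc0] and [conv_Vc0].
    For [b = 0] and the kernel [(1, 0)] this is the resolvent equation at [a]. *)
Lemma Ap_Zr al be phi :
  Ap p1 B (Z al be phi, a *: Z al be phi + (- b) *: Z be (- al) phi + (- al) *: phi).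
Proof.
set psi := (X in (_, X)).
apply/Ap_formP; exists (fun x => \col_i conv a b al be (Uc B phi i) x),
  (fun x => \col_i conv a b al be (Vc B phi i) x),
  (fun x => \col_k conv a b al be (wpast phi k) (- x)); split.
- move=> i; have h := AC_conv b al be 0 (exp_integrable_Uc ga phi i (lexx 1)).
  apply: AC_ae (AC_eq h _ (fun x _ => erefl)) _ _.
  + by move=> x _; rewrite mxE.
  + by apply: measurable_funTS; apply: measurableT_comp => //; exact: measurable_Lp.
  + have h1 := ae_combination (@uval_linear _ _ _ _ _ p1) a (- b) (- al)
      (Z al be phi) (Z be (- al) phi) phi.
    have h2 := uval_Zr b ga al be phi; have h3 := uval_Zr b ga be (- al) phi.
    apply: filterS (filterI h1 (filterI h2 (filterI h3 (filterI (ae_neq 0) (ae_neq 1))))).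
    move=> x [e1 [e2 [e3 [x0 x1]]]] /andP[x0' x1'].
    have x01 : 0 < x < 1 by rewrite !lt_neqAle x0' x1' x1 eq_sym x0.
    have -> : psi.1.1 i x = uval psi x i 0 by rewrite mxE.
    rewrite e1// e2// e3// ![in LHS]mxE /Uc (Uf_pos _ _ _ x01) mxE; ring.
- move=> i T; have h := AC_conv b al be 0 (exp_integrable_Vc ga phi i T).
  apply: AC_ae (AC_eq h _ (fun x _ => erefl)) _ _.
  + by move=> x _; rewrite mxE.
  + by apply: measurable_funTS; apply: measurableT_comp => //; exact: measurable_Lp.
  + have h1 := ae_combination (@vval_linear _ _ _ _ _ p1) a (- b) (- al)
      (Z al be phi) (Z be (- al) phi) phi.
    have h2 := vval_Zr b ga al be phi; have h3 := vval_Zr b ga be (- al) phi.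
    apply: filterS (filterI h1 (filterI h2 (filterI h3 (ae_neq 0)))).
    move=> x [e1 [e2 [e3 x0]]] /andP[x0' x1'].
    have x01 : 0 < x by rewrite lt_neqAle x0' eq_sym x0.
    have -> : psi.1.2 i x = vval psi x i 0 by rewrite mxE.
    rewrite e1// e2// e3// ![in LHS]mxE /Vc /Vf x01 mxE; ring.
- move=> k T; have [T0|T0] := leP 0 T; last exact: AC_empty.
  have NT0 : - T <= 0 by rewrite oppr_le0.
  have := AC_reflect NT0 (AC_conv b al be (- T) (exp_integrable_wpast ga phi k 0)).
  rewrite oppr0 opprK => h.
  apply: AC_ae (AC_eq h _ (fun x _ => erefl)) _ _.
  + by move=> x _; rewrite mxE.
  + by apply: measurable_funTS; exact: measurable_Lp.
  + have h1 := ae_combination (@wval_linear _ _ _ _ _ p1) a (- b) (- al)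
      (Z al be phi) (Z be (- al) phi) phi.
    have h2 := wval_Zr b ga al be phi; have h3 := wval_Zr b ga be (- al) phi.
    apply: filterS (filterI h1 (filterI h2 (filterI h3 (ae_neq 0)))).
    move=> x [e1 [e2 [e3 x0]]] /andP[x0' x1'].
    have x01 : 0 < x by rewrite lt_neqAle x0' eq_sym x0.
    have -> : psi.2 k x = wval psi x k 0 by rewrite mxE.
    rewrite e1// e2// e3// ![in LHS]mxE wpastE ?oppr_lt0// opprK mxE; ring.
- by split; [exact: uval_Zr|exact: vval_Zr|exact: wval_Zr].
- have BE (u : 'cV[R]_m) (w : 'cV[R]_r) : B *m col_mx u w =
      col_mx (ulsubmx B *m u + ursubmx B *m w) (dlsubmx B *m u + drsubmx B *m w).
    by rewrite -{1}[B]submxK mul_block_col.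
  rewrite BE; congr col_mx; apply/colP => i.
  + rewrite [LHS]mxE (conv_Uc0 b ga) [RHS]mxE [X in _ = X + _]mxE [X in _ = _ + X]mxE.
    by congr (_ + _); apply: eq_bigr => j _; congr (_ * _); rewrite mxE ?oppr0.
  + rewrite [LHS]mxE (conv_Vc0 b ga) [RHS]mxE [X in _ = X + _]mxE [X in _ = _ + X]mxE.
    by congr (_ + _); apply: eq_bigr => j _; congr (_ * _); rewrite mxE ?oppr0.
Qed.

Lemma convN al be f x : exp_integrable a f x ->
  conv a b (- al) (- be) f x = - conv a b al be f x.
Proof.
move=> fx; rewrite -[RHS]mulN1r /conv -RintegralZl//; last exact: kern_integrable.
by apply: eq_Rintegral => s _; rewrite /kern; ring.
Qed.

(** Differentiating the cosine transform produces the kernel [(0, -1)], which is thereby reduced to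
    the sine transform. *)
Lemma ZrN al be phi : Z (- al) (- be) phi = - Z al be phi.
Proof.
have E : - Z al be phi = (-1) *: Z al be phi + 0 *: Z al be phi + 0 *: Z al be phi.
  by rewrite !scale0r !addr0 scaleN1r.
rewrite E; apply/XpP; split.
- have h1 := ae_combination (@uval_linear _ _ _ _ _ p1) (-1) 0 0
    (Z al be phi) (Z al be phi) (Z al be phi).
  have h2 := uval_Zr b ga al be phi; have h3 := uval_Zr b ga (- al) (- be) phi.
  apply: filterS (filterI h1 (filterI h2 h3)) => x [e1 [e2 e3]] x0.
  rewrite e1// e2// e3// !scale0r !addr0; apply/colP => i; rewrite !mxE mulN1r.
  by apply: convN; apply: exp_integrable_Uc => //; apply/ltW; case/andP: x0.
- have h1 := ae_combination (@vval_linear _ _ _ _ _ p1) (-1) 0 0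
    (Z al be phi) (Z al be phi) (Z al be phi).
  have h2 := vval_Zr b ga al be phi; have h3 := vval_Zr b ga (- al) (- be) phi.
  apply: filterS (filterI h1 (filterI h2 h3)) => x [e1 [e2 e3]] x0.
  rewrite e1// e2// e3// !scale0r !addr0; apply/colP => i; rewrite !mxE mulN1r.
  by apply: convN; exact: exp_integrable_Vc.
- have h1 := ae_combination (@wval_linear _ _ _ _ _ p1) (-1) 0 0
    (Z al be phi) (Z al be phi) (Z al be phi).
  have h2 := wval_Zr b ga al be phi; have h3 := wval_Zr b ga (- al) (- be) phi.
  apply: filterS (filterI h1 (filterI h2 h3)) => x [e1 [e2 e3]] x0.
  rewrite e1// e2// e3// !scale0r !addr0; apply/colP => i; rewrite !mxE mulN1r.
  by apply: convN; exact: exp_integrable_wpast ga _ _ _.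
Qed.

End fixed_parameter.
End resolvent_graph.

(** * Laplace integrals as causal convolutions *)

Section laplace_conv.
Context (R : realType) (a b : R).
Local Notation mu := (@lebesgue_measure R).

Lemma kern_laplace al be (g : R -> R) x : exp_integrable a g x ->
  mu.-integrable `[0, +oo[ (EFin \o (fun t => kern a b al be t * g (x - t))) /\
  \int[mu]_(t in `[0, +oo[) (kern a b al be t * g (x - t)) = conv a b al be g x.
Proof.
move=> gx; have ik := kern_integrable b al be gx.
have pre : aff true x @^-1` `]-oo, x] = `[0, +oo[%classic.
  by apply/seteqP; split=> t /=; rewrite affE !in_itv/= andbT gerBl.
have E t : kern a b al be (x - aff true x t) * g (aff true x t) = kern a b al be t * g (x - t).
  by rewrite affE subKr.
split; first by have := integrable_aff_preimage true x (measurable_itv _) ik;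
  rewrite pre; apply: eq_integrable => // t _ /=; rewrite E.
rewrite /conv -(Rintegral_aff_preimage true x (measurable_itv _) ik) pre.
by apply: eq_Rintegral => t _; rewrite E.
Qed.

(** Since [e^(- (a + i b) t)] is the kernel [(1, 0)] minus [i] times the kernel [(0, 1)], its
    product with [g1 + i g2] splits as displayed; then substitute [s = x - t]. *)
Lemma has_laplace_conv (g1 g2 : R -> R) (G : R -> R[i]) (v : R[i]) x :
  exp_integrable a g1 x -> exp_integrable a g2 x ->
  (forall t, 0 <= t -> G t = (g1 (x - t) +i* g2 (x - t))%C) ->
  v = ((conv a b 1 0 g1 x + conv a b 0 1 g2 x) +i*
       (conv a b 1 0 g2 x - conv a b 0 1 g1 x))%C ->
  has_laplace (a +i* b)%C G v.
Proof.
move=> h1 h2 GE ->.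
have [i1 E1] := kern_laplace 1 0 h1; have [i2 E2] := kern_laplace 0 1 h2.
have [i3 E3] := kern_laplace 1 0 h2; have [i4 E4] := kern_laplace 0 1 h1.
have kE t : 0 <= t -> cexp (- (a +i* b)%C * t%:C%C) * G t =
    ((kern a b 1 0 t * g1 (x - t) + kern a b 0 1 t * g2 (x - t)) +i*
     (kern a b 1 0 t * g2 (x - t) - kern a b 0 1 t * g1 (x - t)))%C.
  move=> t0; rewrite GE// /cexp /kern; simpc.
  rewrite /= cosN sinN.
  by congr (_ +i* _)%C; ring.
have kR t : t \in `[0, +oo[%classic -> complex.Re (cexp (- (a +i* b)%C * t%:C%C) * G t) =
    kern a b 1 0 t * g1 (x - t) + kern a b 0 1 t * g2 (x - t).
  by rewrite inE/= in_itv/= andbT => t0; rewrite kE.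
have kI t : t \in `[0, +oo[%classic -> complex.Im (cexp (- (a +i* b)%C * t%:C%C) * G t) =
    kern a b 1 0 t * g2 (x - t) - kern a b 0 1 t * g1 (x - t).
  by rewrite inE/= in_itv/= andbT => t0; rewrite kE.
split.
- by apply: eq_integrable (integrable_EFinD (measurable_itv _) i1 i2) => // t t0; rewrite kR.
- by apply: eq_integrable (integrable_EFinB (measurable_itv _) i3 i4) => // t t0; rewrite kI.
- rewrite -E1 -E2 -E3 -E4 -RintegralD// -RintegralB//.
  by congr (_ +i* _)%C; apply: eq_Rintegral => t t0; rewrite ?kR ?kI.
Qed.

End laplace_conv.

(** * Algebra of real and imaginary parts *)

Section complex_combinations.
Context (R : realType) (V : lmodType R).
Implicit Types (a b : R) (c s y : V).

(** The real part of [l z - y], with [c] and [s] the cosine and sine transforms of the two parts of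
    [y] and [z] as in [Zc]; the right side is the image of the real part of [z] under A_p. *)
Lemma combination_re a b c1 s1 y1 c2 s2 :
  a *: (1 *: c1 + s2) - b *: (-1 *: s1 + c2) - y1 =
  1 *: (a *: c1 + b *: s1 - y1) + (a *: s2 - b *: c2).
Proof.
rewrite !scale1r scaleN1r !scalerDr scalerN opprD opprK.
by rewrite [X in X - y1]addrACA [LHS]addrAC.
Qed.

Lemma combination_im a b c1 s1 c2 s2 y2 :
  b *: (1 *: c1 + s2) + a *: (-1 *: s1 + c2) - y2 =
  -1 *: (a *: s1 - b *: c1) + (a *: c2 + b *: s2 - y2).
Proof.
rewrite !scale1r !scaleN1r !scalerDr scalerN opprB addrACA -[LHS]addrA.
by rewrite [b *: s2 + _]addrC.
Qed.

End complex_combinations.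

(** * Identification of the generator, resolvent and Laplace transform *)

Section resolvent.
Context (R : realType) (m q r : nat) (p : R) (p1 : (1 <= p%:E)%E).
Context (B : 'M[R]_(m + q, m + r)).
Local Notation mu := (@lebesgue_measure R).
Local Notation X := (Xp m q r p1).
Local Notation A := (Ap p1 B).
Implicit Types (phi psi : X).

Lemma norm_Tp : exists2 M : R, 1 <= M & forall t phi, 0 <= t <= 1 -> `|Tp p1 B t phi| <= M * `|phi|.
Proof.
have [M M1 h] := is_Tp_bounded p1 B; exists M => // t phi t01.
by have [psi /is_Tp_TpE -> ] := h 1%N t phi t01; rewrite expr1.
Qed.

Lemma generatorE : generator (Tp p1 B) = A.
Proof.
have [M M1 TM] := norm_Tp.
apply/seteqP; split; last exact: Ap_sub_generator.
move=> [x y] Gxy.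
(* Above [growth B] the transform solves the resolvent equation; above [M] the generator has no
   eigenvalue. *)
pose a : R := Num.max (growth B) M + 1.
have aM : M < a by rewrite /a (@le_lt_trans _ _ (Num.max (growth B) M)) ?le_max ?lexx ?orbT// ltrDl.
have ag : growth B < a by rewrite /a (@le_lt_trans _ _ (Num.max (growth B) M)) ?le_max ?lexx ?orbT// ltrDl.
pose f := a *: x - y.
have := Ap_Zr 0 ag 1 0 f; rewrite oppr0 scale0r addr0 scaleN1r.
set z := Zr B a 0 1 0 f => Az.
have Gz := Ap_sub_generator Az.
have [Tl _ _ _] := C0_semigroup_Tp p1 B.
have lT t : 0 <= t -> linear (Tp p1 B t) by move=> /Tl[].
have Gd : generator (Tp p1 B) (-1 *: z + x, -1 *: (a *: z - f) + y) := generator_linear lT Gz Gxy.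
have E : -1 *: (a *: z - f) + y = a *: (-1 *: z + x).
  by rewrite /f !scaleN1r opprB scalerDr scalerN addrAC subrK addrC.
rewrite E in Gd.
have [_ T0 TD _] := C0_semigroup_Tp p1 B.
have d0 : -1 *: z + x = 0.
  apply: (eigenvector_eq0 lT T0 TD TM _ M1 _ Gd).
    by apply: lt_trans aM; apply: lt_le_trans M1.
  by apply: (lt_trans aM); rewrite ltrDr.
have xz : x = z by apply/eqP; rewrite -subr_eq0 addrC -scaleN1r d0.
have yz : y = a *: z - f by rewrite /f xz subKr.
by rewrite yz [in X in A X]xz.
Qed.

(** Inherited from the generator, whose graph is linear by passing to the limit in difference
    quotients. *)
Lemma Ap_linear (c : R) x y x' y' : A (x, y) -> A (x', y') -> A (c *: x + x', c *: y + y').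
Proof.
rewrite -generatorE; apply: generator_linear.
by have [Tl _ _ _] := C0_semigroup_Tp p1 B => t /Tl[].
Qed.

Lemma complexify_linear (c : R) z w z' w' : complexify A (z, w) -> complexify A (z', w') ->
  complexify A (c *: z + z', c *: w + w').
Proof.
case: z w z' w' => [z1 z2] [w1 w2] [z1' z2'] [w1' w2'] [/= h1 h2] [/= h1' h2'].
by split; [exact: (@Ap_linear c _ _ _ _ h1 h1')|exact: (@Ap_linear c _ _ _ _ h2 h2')].
Qed.

(* The Laplace transform splits into cosine and sine transforms. *)
Definition Zc (a b : R) (y : X * X) : X * X :=
  (1 *: Zr B a b 1 0 y.1 + Zr B a b 0 1 y.2,
   (-1) *: Zr B a b 0 1 y.1 + Zr B a b 1 0 y.2).

Section parameter.
Variables (a b M : R).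
Hypothesis ga : growth B < a.
Hypothesis M1 : 1 <= M.
Hypothesis TM : forall t phi, 0 <= t <= 1 -> `|Tp p1 B t phi| <= M * `|phi|.
Hypothesis Ma : 2 * M < a.
Local Notation l := (a +i* b)%C.

Lemma resolvent_eqE y z : resolvent_eq A l y z <-> complexify A (z, Defs.cscale l z - y).
Proof.
split=> [[w Aw <-]|h]; first by rewrite subKr.
by exists (Defs.cscale l z - y) => //; rewrite subKr.
Qed.

Lemma cscale_linear (c : R) (z z' : X * X) :
  Defs.cscale l (c *: z + z') = c *: Defs.cscale l z + Defs.cscale l z'.
Proof.
case: z z' => [z1 z2] [w1 w2].
have E1 : a *: (c *: z1 + w1) - b *: (c *: z2 + w2) =
    c *: (a *: z1 - b *: z2) + (a *: w1 - b *: w2).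
  rewrite !scalerDr !scalerA scalerN scalerA opprD addrACA.
  by rewrite [a * c]mulrC [b * c]mulrC.
have E2 : b *: (c *: z1 + w1) + a *: (c *: z2 + w2) =
    c *: (b *: z1 + a *: z2) + (b *: w1 + a *: w2).
  by rewrite !scalerDr !scalerA addrACA [a * c]mulrC [b * c]mulrC.
exact: (f_equal2 pair E1 E2).
Qed.

Lemma resolvent_eq_linear (c : R) y y' z z' : resolvent_eq A l y z -> resolvent_eq A l y' z' ->
  resolvent_eq A l (c *: y + y') (c *: z + z').
Proof.
move=> /resolvent_eqE h /resolvent_eqE h'; apply/resolvent_eqE.
by rewrite cscale_linear opprD addrACA -scalerBr; exact: complexify_linear.
Qed.

(** The difference of two solutions is a complex eigenvector of the generator. *)
Lemma resolvent_eq_uniq y z z' : resolvent_eq A l y z -> resolvent_eq A l y z' -> z = z'.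
Proof.
move=> h h'; have /resolvent_eqE := @resolvent_eq_linear (-1) _ _ _ _ h h'.
rewrite [X in _ - X](_ : _ = 0) ?subr0; last by rewrite scaleN1r addNr.
rewrite -generatorE => hd.
have a0 : 0 < a by apply: lt_trans Ma; rewrite mulr_gt0// (lt_le_trans ltr01).
have Ma' : 2 * M < 1 + a by rewrite (lt_trans Ma)// ltrDr.
have := @complex_eigenvector_eq0 _ _ _ M (C0_semigroup_Tp p1 B) TM M1 l _ a0 Ma' hd.
by rewrite scaleN1r => e; apply/eqP; rewrite eq_sym -subr_eq0 addrC e.
Qed.

(** With [c] and [s] the cosine and sine transforms of one part of [y], [Ap_Zr] gives
    [A c = a c + b s - y] and [A s = a s - b c]; the rest is algebra. *)
Lemma resolvent_eq_Zc y : resolvent_eq A l y (Zc a b y).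
Proof.
apply/resolvent_eqE; case: y => y1 y2.
have C1 := Ap_Zr b ga 1 0 y1; have S1 := Ap_Zr b ga 0 1 y1.
have C2 := Ap_Zr b ga 1 0 y2; have S2 := Ap_Zr b ga 0 1 y2.
have E y : Zr B a b 0 (-1) y = - Zr B a b 0 1 y by rewrite -(ZrN b ga) oppr0.
rewrite E scaleNr scalerN opprK scaleN1r in C1.
rewrite E scaleNr scalerN opprK scaleN1r in C2.
rewrite oppr0 scale0r addr0 scaleNr in S1.
rewrite oppr0 scale0r addr0 scaleNr in S2.
have h1 := @Ap_linear 1 _ _ _ _ C1 S2; have h2 := @Ap_linear (-1) _ _ _ _ S1 C2.
set c1 := Zr B a b 1 0 y1 in C1 S1 h1 h2 *; set s1 := Zr B a b 0 1 y1 in C1 S1 h1 h2 *.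
set c2 := Zr B a b 1 0 y2 in C2 S2 h1 h2 *; set s2 := Zr B a b 0 1 y2 in C2 S2 h1 h2 *.
split.
  exact: (eq_ind_r (fun v => A (1 *: c1 + s2, v)) h1 (combination_re a b c1 s1 y1 c2 s2)).
exact: (eq_ind_r (fun v => A (-1 *: s1 + c2, v)) h2 (combination_im a b c1 s1 c2 s2 y2)).
Qed.

Lemma resolventE y : resolvent A l y = Zc a b y.
Proof.
apply: (resolvent_eq_uniq _ (resolvent_eq_Zc y)).
exact: (@xgetPex _ 0 (resolvent_eq A l y) (ex_intro _ _ (resolvent_eq_Zc y))).
Qed.

Lemma resolvent_set_growth : resolvent_set A l.
Proof.
split=> [y|].
  exists (Zc a b y); split=> [|z hz]; first exact: resolvent_eq_Zc.
  exact: resolvent_eq_uniq (resolvent_eq_Zc y) hz.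
have -> : resolvent A l = Zc a b by apply/funext => y; exact: resolventE.
have [K1 K10 h1] := norm_Zr p1 b ga 1 0; have [K2 K20 h2] := norm_Zr p1 b ga 0 1.
apply: (@bounded_linear_continuous _ _ _ _ (K1 + K2)).
  (* Linearity of the resolvent follows from uniqueness of solutions. *)
  move=> c y y'; apply: (resolvent_eq_uniq (resolvent_eq_Zc _)).
  exact: resolvent_eq_linear (resolvent_eq_Zc _) (resolvent_eq_Zc _).
move=> [y1 y2].
have yl : `|y1| <= `|(y1, y2)| by rewrite prod_normE le_max lexx.
have yr : `|y2| <= `|(y1, y2)| by rewrite prod_normE le_max lexx orbT.
have Z1 (y : X) : `|y| <= `|(y1, y2)| -> `|Zr B a b 1 0 y| <= K1 * `|(y1, y2)|.
  by move=> hy; apply: (le_trans (h1 y)); rewrite ler_wpM2l.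
have Z2 (y : X) : `|y| <= `|(y1, y2)| -> `|Zr B a b 0 1 y| <= K2 * `|(y1, y2)|.
  by move=> hy; apply: (le_trans (h2 y)); rewrite ler_wpM2l.
rewrite [leLHS]prod_normE ge_max /Zc /= scale1r scaleN1r mulrDl; apply/andP; split.
  by apply: (le_trans (ler_normD _ _)); apply: lerD; [exact: Z1|exact: Z2].
apply: (le_trans (ler_normD _ _)); rewrite normrN addrC.
by apply: lerD; [exact: Z1|exact: Z2].
Qed.

Lemma laplace_resolvent zeta : is_laplace_Tp B l zeta (resolvent A l zeta).
Proof.
rewrite resolventE; case: zeta => y1 y2.
have ED n (c : R) (v w : 'cV[R]_n) i : (c *: v + w) i 0 = c * v i 0 + w i 0 by rewrite !mxE.
split.
- have h1 := uval_linear 1 (Zr B a b 1 0 y1) (Zr B a b 0 1 y2).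
  have h2 := uval_linear (-1) (Zr B a b 0 1 y1) (Zr B a b 1 0 y2).
  have c1 := uval_Zr b ga 1 0 y1; have s1 := uval_Zr b ga 0 1 y1.
  have c2 := uval_Zr b ga 1 0 y2; have s2 := uval_Zr b ga 0 1 y2.
  apply: filterS (filterI h1 (filterI h2 (filterI c1 (filterI s1 (filterI c2 s2))))).
  move=> x [e1 [e2 [ec1 [es1 [ec2 es2]]]]] x01 i.
  have x1 : x <= 1 by case/andP: x01 => _ /ltW.
  apply: (has_laplace_conv (g1 := Uc B y1 i) (g2 := Uc B y2 i) (x := x)).
  + exact: exp_integrable_Uc.
  + exact: exp_integrable_Uc.
  + by move=> t _; rewrite !TuE.
  + have E1 : uval (1 *: Zr B a b 1 0 y1 + Zr B a b 0 1 y2) x i 0 =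
        conv a b 1 0 (Uc B y1 i) x + conv a b 0 1 (Uc B y2 i) x.
      by rewrite (e1 x01) ED (ec1 x01) (es2 x01) 2!mxE mul1r.
    have E2 : uval (-1 *: Zr B a b 0 1 y1 + Zr B a b 1 0 y2) x i 0 =
        conv a b 1 0 (Uc B y2 i) x - conv a b 0 1 (Uc B y1 i) x.
      by rewrite (e2 x01) ED (es1 x01) (ec2 x01) 2!mxE mulN1r addrC.
    exact: (f_equal2 (@Complex R) E1 E2).
- have h1 := vval_linear 1 (Zr B a b 1 0 y1) (Zr B a b 0 1 y2).
  have h2 := vval_linear (-1) (Zr B a b 0 1 y1) (Zr B a b 1 0 y2).
  have c1 := vval_Zr b ga 1 0 y1; have s1 := vval_Zr b ga 0 1 y1.
  have c2 := vval_Zr b ga 1 0 y2; have s2 := vval_Zr b ga 0 1 y2.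
  apply: filterS (filterI h1 (filterI h2 (filterI c1 (filterI s1 (filterI c2 s2))))).
  move=> x [e1 [e2 [ec1 [es1 [ec2 es2]]]]] x0 i.
  apply: (has_laplace_conv (g1 := Vc B y1 i) (g2 := Vc B y2 i) (x := x)).
  + exact: exp_integrable_Vc.
  + exact: exp_integrable_Vc.
  + by move=> t _; rewrite !TvE.
  + have E1 : vval (1 *: Zr B a b 1 0 y1 + Zr B a b 0 1 y2) x i 0 =
        conv a b 1 0 (Vc B y1 i) x + conv a b 0 1 (Vc B y2 i) x.
      by rewrite (e1 x0) ED (ec1 x0) (es2 x0) 2!mxE mul1r.
    have E2 : vval (-1 *: Zr B a b 0 1 y1 + Zr B a b 1 0 y2) x i 0 =
        conv a b 1 0 (Vc B y2 i) x - conv a b 0 1 (Vc B y1 i) x.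
      by rewrite (e2 x0) ED (es1 x0) (ec2 x0) 2!mxE mulN1r addrC.
    exact: (f_equal2 (@Complex R) E1 E2).
- have h1 := wval_linear 1 (Zr B a b 1 0 y1) (Zr B a b 0 1 y2).
  have h2 := wval_linear (-1) (Zr B a b 0 1 y1) (Zr B a b 1 0 y2).
  have c1 := wval_Zr b ga 1 0 y1; have s1 := wval_Zr b ga 0 1 y1.
  have c2 := wval_Zr b ga 1 0 y2; have s2 := wval_Zr b ga 0 1 y2.
  apply: filterS (filterI h1 (filterI h2 (filterI c1 (filterI s1 (filterI c2 s2))))).
  move=> x [e1 [e2 [ec1 [es1 [ec2 es2]]]]] x0 i.
  apply: (has_laplace_conv (g1 := wpast y1 i) (g2 := wpast y2 i) (x := - x)).
  + exact: exp_integrable_wpast ga _ _ _.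
  + exact: exp_integrable_wpast ga _ _ _.
  (* Only [t >= 0] matters; then [- x - t] lies in the past, where [wpast] is the reflected
     datum. *)
  + move=> t t0; have xt : - x - t < 0 by rewrite -opprD oppr_lt0 ltr_wpDr.
    by rewrite !wpastE// /Tw opprB opprK addrC.
  + have E1 : wval (1 *: Zr B a b 1 0 y1 + Zr B a b 0 1 y2) x i 0 =
        conv a b 1 0 (wpast y1 i) (- x) + conv a b 0 1 (wpast y2 i) (- x).
      by rewrite (e1 x0) ED (ec1 x0) (es2 x0) 2!mxE mul1r.
    have E2 : wval (-1 *: Zr B a b 0 1 y1 + Zr B a b 1 0 y2) x i 0 =
        conv a b 1 0 (wpast y2 i) (- x) - conv a b 0 1 (wpast y1 i) (- x).
      by rewrite (e2 x0) ED (es1 x0) (ec2 x0) 2!mxE mulN1r addrC.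
    exact: (f_equal2 (@Complex R) E1 E2).
Qed.

End parameter.
End resolvent.

Theorem theorem4p1 (R : realType) (m q r : nat)
    (m_gt0 : (0 < m)%N) (q_gt0 : (0 < q)%N) (r_gt0 : (0 < r)%N)
    (B : 'M[R]_(m + q, m + r)) (p : R) (p1 : (1 <= p%:E)%E) :
  (forall t (phi : Xp m q r p1), 0 <= t -> is_Tp B t phi (Tp p1 B t phi)) /\
  (exists l0 : R, forall l : R[i], l0 < complex.Re l ->
    resolvent_set (Ap p1 B) l /\
    forall zeta : Xp m q r p1 * Xp m q r p1,
      is_laplace_Tp B l zeta (resolvent (Ap p1 B) l zeta)) /\
  C0_semigroup (Tp p1 B) /\
  generator (Tp p1 B) = Ap p1 B.
Proof.
have [M M1 TM] := norm_Tp p1 B.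
split; first by move=> t phi; exact: TpP.
split; last by split; [exact: C0_semigroup_Tp|exact: generatorE].
(* [growth B] serves existence, through the contraction in the recursion; [2 * M] serves uniqueness,
   as the bound of the rotated semigroups on [[0, 1]]. *)
exists (Num.max (growth B) (2 * M)) => -[a b] /=; rewrite gt_max => /andP[ga Ma].
by split; [exact: (resolvent_set_growth b ga M1 TM Ma)|exact: (laplace_resolvent b ga M1 TM Ma)].
Qed.
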